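(* Let $\rho_1,\sigma_1$ be full-rank density operators on a finite-dimensional Hilbert space and $\rho_2,\sigma_2$ full-rank density operators on another. If $[\rho_2,\sigma_2]=0$, the zero-error rate satisfies $$\liminf_{n\to\infty}R_n^*(0)\ge\max\left\{\inf_{\alpha\in\mathbb R}\frac{\widehat D^{\mathrm L}_\alpha(\rho_1\|\sigma_1)}{D_\alpha(\rho_2\|\sigma_2)},\;\inf_{\alpha\in\mathbb R}\frac{\widehat D^{\mathrm R}_\alpha(\rho_1\|\sigma_1)}{D_\alpha(\rho_2\|\sigma_2)}\right\}.$$ For general (not necessarily commuting) $\rho_2,\sigma_2$, for all $n$, $$R_n^*(0)\le\min_{\alpha\in\overline{\mathbb R}}\frac{\widetilde D_\alpha(\rho_1\|\sigma_1)}{\widetilde D_\alpha(\rho_2\|\sigma_2)}.$$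
   Context: $T(\rho,\sigma)=\frac12\|\rho-\sigma\|_1$. $(\rho,\sigma)\succeq_{(\epsilon_\rho,\epsilon_\sigma)}(\rho',\sigma')$ means some quantum channel $\mathcal E$ has $T(\mathcal E(\rho),\rho')\le\epsilon_\rho$, $T(\mathcal E(\sigma),\sigma')\le\epsilon_\sigma$. $R_n^*(0)$ is the largest $R_n$ with $(\rho_1^{\otimes n},\sigma_1^{\otimes n})\succeq_{(0,0)}(\rho_2^{\otimes R_nn},\sigma_2^{\otimes R_nn})$. $\overline{\mathbb R}=\mathbb R\cup\{\pm\infty\}$. Minimal Rényi divergence: $\widetilde D_\alpha(\rho\|\sigma)=\frac{1}{\alpha-1}\log\mathrm{Tr}\bigl((\sqrt\rho\,\sigma^{\frac{1-\alpha}{\alpha}}\sqrt\rho)^\alpha\bigr)$ for $\alpha\ge\frac12$, $\frac{1}{\alpha-1}\log\mathrm{Tr}\bigl((\sqrt\sigma\,\rho^{\frac{\alpha}{1-\alpha}}\sqrt\sigma)^{1-\alpha}\bigr)$ for $\alpha\le\frac12$, with $\alpha=1,\pm\infty$ by limits ($\widetilde D_{+\infty}=\log\lambda_{\max}(\sigma^{-1/2}\rho\sigma^{-1/2})$, $\widetilde D_{-\infty}=-\log\lambda_{\max}(\rho^{-1/2}\sigma\rho^{-1/2})$). For commuting states this is the classical Rényi divergence $D_\alpha$. Pinching: if $\tau=\sum_\lambda\lambda\Pi_\lambda$ is the spectral decomposition, $\mathcal P_\tau(X)=\sum_\lambda\Pi_\lambda X\Pi_\lambda$. Left- and right-pinched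 Rényi divergences: $\widehat D^{\mathrm L}_\alpha(\rho\|\sigma)=\lim_{n\to\infty}\frac1nD_\alpha(\mathcal P_{\sigma^{\otimes n}}(\rho^{\otimes n})\|\sigma^{\otimes n})$ and $\widehat D^{\mathrm R}_\alpha(\rho\|\sigma)=\lim_{n\to\infty}\frac1nD_\alpha(\rho^{\otimes n}\|\mathcal P_{\rho^{\otimes n}}(\sigma^{\otimes n}))$ (limits exist for full-rank states). *)

(* Defs.v *)
From HB Require Import structures.
From mathcomp Require Import all_boot all_order all_algebra.
From mathcomp Require Import all_classical all_reals all_analysis.
From mathcomp Require Import complex mxtens.

Set Implicit Arguments.
Unset Strict Implicit.
Unset Printing Implicit Defensive.

Import Order.TTheory GRing.Theory Num.Theory.
Import numFieldTopology.Exports numFieldNormedType.Exports.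
Local Open Scope ring_scope.

Section QDefs.
Variable R : realType.
Local Notation C := (R[i]).

Definition cconj (z : C) : C := Complex (complex.Re z) (- complex.Im z).
Definition adj m n (A : 'M[C]_(m, n)) : 'M[C]_(n, m) := map_mx cconj A^T.

Definition rC (x : R) : C := Complex x 0.

Definition psd n (A : 'M[C]_n) : Prop :=
  adj A = A /\ forall v : 'cV[C]_n, 0 <= (adj v *m A *m v) ord0 ord0.

Definition density n (A : 'M[C]_n) : Prop := psd A /\ \tr A = 1.
Definition full_rank n (A : 'M[C]_n) : Prop := \rank A = n.

Definition unitary n (U : 'M[C]_n) : Prop := U *m adj U = 1%:M.

Definition spec_dec n (A : 'M[C]_n) (p : 'M[C]_n * ('I_n -> R)) : Prop :=
  unitary p.1 /\ A = p.1 *m diag_mx (\row_i rC (p.2 i)) *m adj p.1.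

Definition sdec n (A : 'M[C]_n) : option ('M[C]_n * ('I_n -> R)) :=
  match pselect (exists p, spec_dec A p) with
  | left h => Some (proj1_sig (cid h))
  | right _ => None
  end.

Definition mfun n (f : R -> R) (A : 'M[C]_n) : 'M[C]_n :=
  match sdec A with
  | Some p => p.1 *m diag_mx (\row_i rC (f (p.2 i))) *m adj p.1
  | None => 0
  end.

Definition msqrt n (A : 'M[C]_n) := mfun (@Num.sqrt R) A.
Definition mpow n (A : 'M[C]_n) (t : R) := mfun (fun x => powR x t) A.
Definition mlog n (A : 'M[C]_n) := mfun (@ln R) A.

Definition eigs n (A : 'M[C]_n) : seq R :=
  match sdec A with
  | Some p => [seq p.2 i | i <- enum 'I_n]
  | None => [::]
  end.
Definition lmax n (A : 'M[C]_n) : R :=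
  let s := eigs A in foldr Num.max (head 0 s) s.

Definition retr n (A : 'M[C]_n) : R := complex.Re (\tr A).

Definition tnorm n (A : 'M[C]_n) : R := retr (msqrt (adj A *m A)).
Definition tdist n (A B : 'M[C]_n) : R := 2^-1 * tnorm (A - B).

Fixpoint pw (d k : nat) : nat := if k is k'.+1 then (d * pw d k')%N else 1%N.
Fixpoint tpow d (A : 'M[C]_d) (k : nat) : 'M[C]_(pw d k) :=
  match k return 'M[C]_(pw d k) with
  | 0 => 1%:M
  | k'.+1 => A *t tpow A k'
  end.

(* ampliation id_r (x) E acting on 'M_(r * a), block index (i,k) |-> i*a+k *)
Definition ampl r a b (E : 'M[C]_a -> 'M[C]_b) (X : 'M[C]_(r * a)) : 'M[C]_(r * b) :=
  \sum_(i < r) \sum_(j < r)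
     (delta_mx i j : 'M[C]_r) *t
       E (\matrix_(k, l) X (mxtens_index (i, k)) (mxtens_index (j, l))).

Definition channel a b (E : 'M[C]_a -> 'M[C]_b) : Prop :=
  [/\ (forall (c : C) (X Y : 'M[C]_a), E (c *: X + Y) = c *: E X + E Y),
      (forall (r : nat) (X : 'M[C]_(r * a)), psd X -> psd (ampl E X)) &
      (forall X : 'M[C]_a, \tr (E X) = \tr X)].

Definition dconv a b (rho sigma : 'M[C]_a) (rho' sigma' : 'M[C]_b) (er es : R) : Prop :=
  exists E : 'M[C]_a -> 'M[C]_b, channel E /\
    tdist (E rho) rho' <= er /\ tdist (E sigma) sigma' <= es.

(* R_n^*(0) : the largest R_n (with R_n n = m a natural number) such that
   (rho1^{(x)n}, sigma1^{(x)n}) >=_(0,0) (rho2^{(x)m}, sigma2^{(x)m});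
   taken as a supremum in the extended reals (+oo if unbounded). *)
Definition Rstar0 d1 d2 (rho1 sigma1 : 'M[C]_d1) (rho2 sigma2 : 'M[C]_d2) (n : nat)
  : \bar R :=
  ereal_sup [set ((m%:R / n%:R)%:E) | m in
     [set m : nat | dconv (tpow rho1 n) (tpow sigma1 n) (tpow rho2 m) (tpow sigma2 m) 0 0]].

Definition Dform n (rho sigma : 'M[C]_n) (a : R) : R :=
  if 2^-1 <= a then
    (a - 1)^-1 * ln (retr (mpow (msqrt rho *m mpow sigma ((1 - a) / a) *m msqrt rho) a))
  else
    (a - 1)^-1 * ln (retr (mpow (msqrt sigma *m mpow rho (a / (1 - a)) *m msqrt sigma) (1 - a))).

Definition Dmin n (a : \bar R) (rho sigma : 'M[C]_n) : R :=
  match a with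
  | EFin x => if x == 1 then lim (Dform rho sigma @ dnbhs (1:R))%classic else Dform rho sigma x
  | +oo%E => ln (lmax (mpow sigma (- 2^-1) *m rho *m mpow sigma (- 2^-1)))
  | -oo%E => - ln (lmax (mpow rho (- 2^-1) *m sigma *m mpow rho (- 2^-1)))
  end.

(* classical Renyi divergence of commuting states (= Dmin on commuting states) *)
Definition Dcl n (a : R) (rho sigma : 'M[C]_n) : R := Dmin a%:E rho sigma.

Definition eigproj n (tau : 'M[C]_n) (mu : R) : 'M[C]_n :=
  mfun (fun x => if x == mu then 1 else 0) tau.
Definition pinch n (tau X : 'M[C]_n) : 'M[C]_n :=
  \sum_(mu <- undup (eigs tau)) eigproj tau mu *m X *m eigproj tau mu.

Definition DpinL n (a : R) (rho sigma : 'M[C]_n) : R :=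
  limn (fun k => k%:R^-1 * Dcl a (pinch (tpow sigma k) (tpow rho k)) (tpow sigma k)).
Definition DpinR n (a : R) (rho sigma : 'M[C]_n) : R :=
  limn (fun k => k%:R^-1 * Dcl a (tpow rho k) (pinch (tpow rho k) (tpow sigma k))).

(* ratio x / y in the extended reals; convention: x / 0 = +oo
   (excludes alpha = 0, where both divergences vanish for full-rank states) *)
Definition eratio (x y : R) : \bar R := if y == 0 then +oo%E else (x / y)%:E.

End QDefs.

(* Main.v *)
Require Import Defs.
From HB Require Import structures.
From mathcomp Require Import all_boot all_order all_algebra.
From mathcomp Require Import all_classical all_reals all_analysis.
From mathcomp Require Import complex mxtens.
From mathcomp Require Import ring lra zify.
Import Order.TTheory GRing.Theory Num.Theory.
Import numFieldTopology.Exports numFieldNormedType.Exports.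
Local Open Scope ring_scope.
Set Implicit Arguments.
Unset Strict Implicit.
Unset Printing Implicit Defensive.

(* Upper bound.  Write sigma and the pinched state P_sigma(rho) in a common eigenbasis, with
   spectra q and p.  By the pinching inequality rho <= v P_sigma(rho), v being the number of
   eigenvalues of sigma, the sandwiched trace of order a differs from the classical sum
   sum_i p_i^a q_i^(1-a) by a power of v only, and a Kraus map decreases the classical
   divergence up to the same kind of factor.  On k-th tensor powers v is polynomial in k while
   the traces are k-th powers, so the data-processing inequality holds exactly for all orders
   a >= 1/2, a <> 1.  Orders a < 1/2 follow by exchanging the states, a = 1 by continuity, and
   a = +oo by preservation of rho <= l sigma.  Multiplicativity turns m target copies obtained
   from n source copies into m D(rho2, sigma2) <= n D(rho1, sigma1).

   Lower bound.  The divergences of the pinched k-copy states are superadditive in k, hence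
   their normalizations converge, uniformly enough (they are monotone in the order) for a single
   k to satisfy D_a(p_k, q_k) > c k D_a(p2, q2) at all orders a >= 1/2, in both directions.
   Exponential tilting then shows that for large t every likelihood-ratio test separates
   m = c k t copies of (p2, q2) no better than t copies of (p_k, q_k), and by Blackwell's theorem
   a stochastic matrix maps the latter to the former.  Measuring blocks in the eigenbasis of the
   pinched state, applying this matrix and preparing eigenstates of rho2 and sigma2 is an exact
   conversion. *)

(** * Scalar inequalities *)

(** Zero error leaves nothing to approximate: asymptotic estimates must yield an inequality valid
    for every threshold at one finite [t]. What makes this possible is strict slack. Below the
    infimum, successive gaps between rates pay for replacing limits by one block length, for the
    constants and window widths lost in tilting, and for rounding to whole blocks and copies. The
    slack is uniform in the order because the target divergences are at least the one of order 1/2;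
    if that one vanishes, the two target states coincide and can be prepared in any number.

    Order 1/2 matters for data processing too: below order one the argument applies convexity of the
    power a / (1 - a), which must be at least 1. Orders a and 1 - a of exchanged arguments differ by
    the factor a / (1 - a), which cancels in ratios, so half of the line taken in both directions
    suffices. At order 0 both divergences vanish and the ratio is +oo by convention.

    No operator convexity enters: the trace inequalities reduce to scalar Jensen and Cauchy-Schwarz,
    with the squared entries of unitary or Kraus matrices as weights. *)

Section Scalar.
Variable R : realType.
Implicit Types (a x y z : R).

Lemma bernoulli_le a z : 0 < z -> 0 <= a <= 1 -> z `^ a <= 1 + a * (z - 1).
Proof.
move=> z0 /andP[a0 a1].
have zE : z `^ a = expR (a * ln z) by rewrite /powR gt_eqF.
(* tangent lines of exp at [a * ln z], at the points [ln z] and [0] *)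
have h1 := expR_ge1Dx (ln z - a * ln z).
have h2 := expR_ge1Dx (- (a * ln z)).
have m0 := expR_gt0 (a * ln z).
have e1 : z = expR (a * ln z) * expR (ln z - a * ln z).
  by rewrite -expRD addrC subrK lnK.
have e2 : 1 = expR (a * ln z) * expR (- (a * ln z)) by rewrite -expRD subrr expR0.
rewrite zE; set e := expR (a * ln z) in m0 e1 e2 *.
have k1 : e * (1 + (ln z - a * ln z)) <= z by rewrite [X in _ <= X]e1 ler_pM2l.
have k2 : e * (1 - a * ln z) <= 1 by rewrite [X in _ <= X]e2 ler_pM2l.
have -> : 1 + a * (z - 1) = a * z + (1 - a) * 1 by ring.
apply: le_trans (lerD (ler_wpM2l a0 k1) (ler_wpM2l _ k2)); last by rewrite subr_ge0.
by rewrite le_eqVlt; apply/orP; left; apply/eqP; ring.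
Qed.

(** Both ranges invert [bernoulli_le]: for a >= 1 it is applied with exponent 1/a at the point z^a,
    for a <= 0 with exponent 1/(1-a) at the point z^(a-1), where it bounds 1/z. *)
Lemma bernoulli_ge a z : 0 < z -> (1 <= a) || (a <= 0) -> 1 + a * (z - 1) <= z `^ a.
Proof.
move=> z0 /orP[a1|a0].
  have a0 : 0 < a by apply: lt_le_trans a1.
  have h := @bernoulli_le a^-1 (z `^ a) (powR_gt0 _ z0).
  have : 0 <= a^-1 <= 1 by rewrite invr_ge0 (ltW a0) /= invf_le1.
  move=> /h; rewrite -powRrM divff ?gt_eqF// (powRr1 (ltW z0)) => k.
  have -> : z `^ a = 1 + a * ((1 + a^-1 * (z `^ a - 1)) - 1).
    by rewrite [1 + _ - 1]addrC addKr mulrA divff ?gt_eqF// mul1r addrC subrK.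
  by rewrite lerD2l ler_pM2l// lerD2r.
have b0 : 0 < 1 - a by rewrite subr_gt0 (le_lt_trans a0).
have h := @bernoulli_le (1 - a)^-1 (z `^ (a - 1)) (powR_gt0 _ z0).
have : 0 <= (1 - a)^-1 <= 1 by rewrite invr_ge0 (ltW b0) /= invf_le1// lerBrDl gerDr.
move=> /h; rewrite -powRrM -[a - 1]opprB mulNr divff ?gt_eqF// (powR_inv1 (ltW z0)) => k.
have e : z `^ (a - 1) = z `^ a / z.
  by rewrite powRB ?powRr1 ?ltW//; apply/implyP => _; rewrite gt_eqF.
rewrite opprB e in k.
have : (1 - a) * (z * z^-1) <= (1 - a) * z * (1 + (1 - a)^-1 * (z `^ a / z - 1)).
  by rewrite -mulrA ler_pM2l// ler_pM2l.
rewrite divff ?gt_eqF// mulr1.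
have -> : (1 - a) * z * (1 + (1 - a)^-1 * (z `^ a / z - 1)) = (1 - a) * z + z `^ a - z.
  by field; rewrite !gt_eqF.
lra.
Qed.

Section Jensen.
Variable I : finType.
Implicit Types w p q : I -> R.

Lemma sum_gt0 w p : (forall i, 0 <= w i) -> (forall i, 0 < p i) ->
  0 < \sum_i w i -> 0 < \sum_i w i * p i.
Proof.
move=> w0 p0 s0; rewrite lt_neqAle sumr_ge0 ?andbT; last first.
  by move=> i _; rewrite mulr_ge0// ltW.
apply/eqP => /esym/eqP; rewrite psumr_eq0; last first.
  by move=> i _; rewrite mulr_ge0// ltW.
move=> /allP h; move: s0; rewrite big1 ?ltxx// => i _.
by have := h i (mem_index_enum i); rewrite /= mulf_eq0 (gt_eqF (p0 i)) orbF => /eqP.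
Qed.

Lemma powR_inv a x : 0 < x -> x^-1 `^ a = (x `^ a)^-1.
Proof. by move=> x0; rewrite -[x^-1]powR_inv1 ?ltW// -powRrM mulN1r powRN. Qed.

Lemma powR_split a x y : 0 < x -> 0 < y -> x `^ a * y `^ (1 - a) = y * (x / y) `^ a.
Proof.
move=> x0 y0; rewrite powRM ?invr_ge0 ?ltW// powR_inv// powRB; last by apply/implyP => _; rewrite gt_eqF.
by rewrite powRr1 ?ltW// mulrCA.
Qed.

(** x^a y^(1-a) is the perspective of the power function, hence jointly convex and homogeneous, so
    the weights need no normalization. Each term is bounded by the tangent at the ratio [m] of the
    two means; the linear parts cancel in the sum. *)
Lemma perspective_ge a w p q : (forall i, 0 <= w i) -> (forall i, 0 < p i) ->
  (forall i, 0 < q i) -> 0 < \sum_i w i -> (1 <= a) || (a <= 0) ->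
  (\sum_i w i * p i) `^ a * (\sum_i w i * q i) `^ (1 - a) <=
  \sum_i w i * (p i `^ a * q i `^ (1 - a)).
Proof.
move=> w0 p0 q0 s0 ha.
have P0 := sum_gt0 w0 p0 s0; have Q0 := sum_gt0 w0 q0 s0.
set P := \sum_i w i * p i in P0 *; set Q := \sum_i w i * q i in Q0 *.
rewrite powR_split//; set m := P / Q.
have m0 : 0 < m by rewrite divr_gt0.
have mV : 0 < m^-1 by rewrite invr_gt0.
have step i : m `^ a * (q i + a * (p i / m - q i)) <= p i `^ a * q i `^ (1 - a).
  rewrite powR_split//; have r0 : 0 < p i / q i / m by rewrite !divr_gt0.
  have := bernoulli_ge r0 ha.
  rewrite -(ler_pM2l (q0 i)) -(ler_pM2l (powR_gt0 a m0)).
  rewrite (powRM a (ltW (divr_gt0 (p0 i) (q0 i))) (ltW mV)) powR_inv//.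
  have -> : m `^ a * (q i * ((p i / q i) `^ a * (m `^ a)^-1)) = q i * (p i / q i) `^ a.
    by field; rewrite gt_eqF// powR_gt0.
  apply: le_trans.
  by rewrite le_eqVlt; apply/orP; left; apply/eqP; field; rewrite !gt_eqF.
apply: le_trans (ler_sum _ (fun i _ => ler_wpM2l (w0 i) (step i))).
under eq_bigr do rewrite mulrCA.
rewrite -mulr_sumr.
have -> : \sum_i w i * (q i + a * (p i / m - q i)) = Q + a * (P / m - Q).
  rewrite /Q /P mulr_suml -sumrB mulr_sumr -big_split /=.
  by apply: eq_bigr => i _; ring.
have -> : P / m = Q by rewrite /m; field; rewrite !gt_eqF.
by rewrite subrr mulr0 addr0 mulrC.
Qed.

Lemma perspective_le a w p q : (forall i, 0 <= w i) -> (forall i, 0 < p i) ->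
  (forall i, 0 < q i) -> 0 < \sum_i w i -> 0 <= a <= 1 ->
  \sum_i w i * (p i `^ a * q i `^ (1 - a)) <=
  (\sum_i w i * p i) `^ a * (\sum_i w i * q i) `^ (1 - a).
Proof.
move=> w0 p0 q0 s0 ha.
have P0 := sum_gt0 w0 p0 s0; have Q0 := sum_gt0 w0 q0 s0.
set P := \sum_i w i * p i in P0 *; set Q := \sum_i w i * q i in Q0 *.
rewrite (powR_split a P0 Q0); set m := P / Q.
have m0 : 0 < m by rewrite divr_gt0.
have mV : 0 < m^-1 by rewrite invr_gt0.
have step i : p i `^ a * q i `^ (1 - a) <= m `^ a * (q i + a * (p i / m - q i)).
  rewrite powR_split//; have r0 : 0 < p i / q i / m by rewrite !divr_gt0.
  have := bernoulli_le r0 ha.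
  rewrite -(ler_pM2l (q0 i)) -(ler_pM2l (powR_gt0 a m0)).
  rewrite (powRM a (ltW (divr_gt0 (p0 i) (q0 i))) (ltW mV)) powR_inv//.
  have -> : m `^ a * (q i * ((p i / q i) `^ a * (m `^ a)^-1)) = q i * (p i / q i) `^ a.
    by field; rewrite gt_eqF// powR_gt0.
  move=> /le_trans; apply.
  by rewrite le_eqVlt; apply/orP; left; apply/eqP; field; rewrite !gt_eqF.
apply: le_trans (ler_sum _ (fun i _ => ler_wpM2l (w0 i) (step i))) _.
under eq_bigr do rewrite mulrCA.
rewrite -mulr_sumr.
have -> : \sum_i w i * (q i + a * (p i / m - q i)) = Q + a * (P / m - Q).
  rewrite /Q /P mulr_suml -sumrB mulr_sumr -big_split /=.
  by apply: eq_bigr => i _; ring.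
have -> : P / m = Q by rewrite /m; field; rewrite !gt_eqF.
by rewrite subrr mulr0 addr0 mulrC.
Qed.

Lemma jensen_ge a w p : (forall i, 0 <= w i) -> (forall i, 0 < p i) ->
  \sum_i w i = 1 -> (1 <= a) || (a <= 0) ->
  (\sum_i w i * p i) `^ a <= \sum_i w i * p i `^ a.
Proof.
move=> w0 p0 s1 ha.
have := @perspective_ge a w p (fun=> 1) w0 p0 (fun=> ltr01) _ ha.
have e i : w i * (p i `^ a * 1 `^ (1 - a)) = w i * p i `^ a by rewrite powR1 mulr1.
by rewrite s1 (eq_bigr _ (fun i _ => e i)) -mulr_suml s1 mulr1 powR1 mulr1; exact.
Qed.

Lemma jensen_le a w p : (forall i, 0 <= w i) -> (forall i, 0 < p i) ->
  \sum_i w i = 1 -> 0 <= a <= 1 ->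
  \sum_i w i * p i `^ a <= (\sum_i w i * p i) `^ a.
Proof.
move=> w0 p0 s1 ha.
have := @perspective_le a w p (fun=> 1) w0 p0 (fun=> ltr01) _ ha.
have e i : w i * (p i `^ a * 1 `^ (1 - a)) = w i * p i `^ a by rewrite powR1 mulr1.
by rewrite s1 (eq_bigr _ (fun i _ => e i)) -mulr_suml s1 mulr1 powR1 mulr1; exact.
Qed.

End Jensen.
End Scalar.

(** * Martingale couplings of finite laws *)

Section Coupling.
Variable R : realType.

Definition pospart (x : R) := Num.max x 0.

Lemma pospart_ge0 x : 0 <= pospart x. Proof. by rewrite le_max lexx orbT. Qed.
Lemma pospart_id x : 0 <= x -> pospart x = x. Proof. by move=> ?; apply/max_idPl. Qed.
Lemma pospart_0 x : x <= 0 -> pospart x = 0. Proof. by move=> ?; apply/max_idPr. Qed.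
Lemma pospart_ge x : x <= pospart x. Proof. by rewrite le_max lexx. Qed.

Lemma pospartN x : pospart (- x) = pospart x - x.
Proof.
have [h|/ltW h] := leP 0 x; first by rewrite (pospart_id h) pospart_0 ?oppr_le0// subrr.
by rewrite (pospart_0 h) pospart_id ?oppr_ge0// sub0r.
Qed.

Lemma pospart_convex m x y : 0 <= m <= 1 ->
  pospart (m * x + (1 - m) * y) <= m * pospart x + (1 - m) * pospart y.
Proof.
move=> /andP[m0 m1]; have m1' : 0 <= 1 - m by rewrite subr_ge0.
rewrite ge_max; apply/andP; split; last by rewrite addr_ge0// mulr_ge0// pospart_ge0.
by apply: lerD; apply: ler_wpM2l => //; exact: pospart_ge.
Qed.

Variables (X Y : finType) (r : X -> R) (r' : Y -> R).

(** The convex order, tested on hinge functions: the law of [r'] under [v] is less spread out than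
    that of [r] under [u]. Total masses are only equal, not 1, so that the relation survives the
    removal of atoms. *)
Definition couplable (u : X -> R) (v : Y -> R) :=
  [/\ (forall x, 0 <= u x), (forall y, 0 <= v y), \sum_x u x = \sum_y v y,
      \sum_x u x * r x = \sum_y v y * r' y &
      forall s, \sum_y v y * pospart (r' y - s) <= \sum_x u x * pospart (r x - s)].

(** The last clause is the martingale property: given [y], the conditional mean of [r] is [r' y]. *)
Definition coupling (u : X -> R) (v : Y -> R) (T : X -> Y -> R) :=
  [/\ (forall x y, 0 <= T x y), (forall x, \sum_y T x y = u x),
      (forall y, \sum_x T x y = v y) &
      (forall y, \sum_x T x y * r x = v y * r' y)].

(** The two hinges at [s] differ by an affine function, which has the same integral on both
    sides. *)
Lemma couplable_lower u v : couplable u v ->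
  forall s, \sum_y v y * pospart (s - r' y) <= \sum_x u x * pospart (s - r x).
Proof.
move=> [_ _ suv srv dom] s.
have eX : \sum_x u x * pospart (s - r x) =
    \sum_x u x * pospart (r x - s) - \sum_x u x * r x + (\sum_x u x) * s.
  rewrite mulr_suml -sumrB -big_split /=; apply: eq_bigr => x _.
  by rewrite -(opprB (r x) s) pospartN; ring.
have eY : \sum_y v y * pospart (s - r' y) =
    \sum_y v y * pospart (r' y - s) - \sum_y v y * r' y + (\sum_y v y) * s.
  rewrite mulr_suml -sumrB -big_split /=; apply: eq_bigr => y _.
  by rewrite -(opprB (r' y) s) pospartN; ring.
by rewrite eX eY suv srv !lerD2r.
Qed.

(** Otherwise the hinge placed at the largest atom of [u] would vanish under [u] but not under
    [v]. *)
Lemma exists_above u v y0 : couplable u v -> 0 < v y0 ->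
  exists x, 0 < u x /\ r' y0 <= r x.
Proof.
move=> [u0 v0 suv srv dom] vy.
have sv : 0 < \sum_y v y.
  by rewrite (bigD1 y0)//= ltr_wpDr// sumr_ge0.
have [x0 ux0] : exists x, 0 < u x.
  apply/not_existsP => h; move: sv; rewrite -suv big1 ?ltxx// => x _.
  by apply/eqP; rewrite eq_le u0 andbT leNgt; apply/negP/h.
case: (@arg_maxP _ _ _ x0 (fun x => 0 < u x) r ux0) => x1 ux1 hmax.
exists x1; split => //; rewrite leNgt; apply/negP => lt1.
have := dom (r x1); rewrite leNgt => /negP; apply.
rewrite [X in X < _]big1; last first.
  move=> x _; have := u0 x; rewrite le_eqVlt => /predU1P[<-|ux]; first by rewrite mul0r.
  by rewrite pospart_0 ?mulr0// subr_le0; exact: hmax.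
rewrite (bigD1 y0)//= ltr_wpDr//.
  by apply: sumr_ge0 => y _; rewrite mulr_ge0// pospart_ge0.
by rewrite mulr_gt0// pospart_id ?subr_gt0// ltW// subr_gt0.
Qed.

Lemma exists_below u v y0 : couplable u v -> 0 < v y0 ->
  exists x, 0 < u x /\ r x <= r' y0.
Proof.
move=> uv vy; have dom := couplable_lower uv; case: uv => [u0 v0 suv srv _].
have sv : 0 < \sum_y v y.
  by rewrite (bigD1 y0)//= ltr_wpDr// sumr_ge0.
have [x0 ux0] : exists x, 0 < u x.
  apply/not_existsP => h; move: sv; rewrite -suv big1 ?ltxx// => x _.
  by apply/eqP; rewrite eq_le u0 andbT leNgt; apply/negP/h.
case: (@arg_minP _ _ _ x0 (fun x => 0 < u x) r ux0) => x1 ux1 hmin.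
exists x1; split => //; rewrite leNgt; apply/negP => lt1.
have := dom (r x1); rewrite leNgt => /negP; apply.
rewrite [X in X < _]big1; last first.
  move=> x _; have := u0 x; rewrite le_eqVlt => /predU1P[<-|ux]; first by rewrite mul0r.
  by rewrite pospart_0 ?mulr0// subr_le0; exact: hmin.
rewrite (bigD1 y0)//= ltr_wpDr//.
  by apply: sumr_ge0 => y _; rewrite mulr_ge0// pospart_ge0.
by rewrite mulr_gt0// pospart_id ?subr_gt0// ltW// subr_gt0.
Qed.

(** Induction measure for [coupling_exists]: each step exhausts an atom of [u] or one of [v]. *)
Definition atoms (u : X -> R) (v : Y -> R) :=
  addn #|[set x | u x != 0]| #|[set y | v y != 0]|.

Definition less_at (v : Y -> R) y0 d y := v y - d * (y == y0)%:R.

Lemma sum_less_at v y0 d (f : Y -> R) :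
  \sum_y less_at v y0 d y * f y = \sum_y v y * f y - d * f y0.
Proof.
under eq_bigr do rewrite mulrBl; rewrite sumrB; congr (_ - _).
rewrite (bigD1 y0)//= eqxx mulr1 big1 ?addr0// => y /negPf ->.
by rewrite mulr0 mul0r.
Qed.

(** The piece [a] has mass [d] and barycentre [r' y0], so sending all of it to [y0] respects the
    martingale condition. *)
Lemma coupling_extend u v a y0 d T : (forall x, 0 <= a x) ->
  \sum_x a x = d -> \sum_x a x * r x = d * r' y0 ->
  coupling (fun x => u x - a x) (less_at v y0 d) T ->
  coupling u v (fun x y => T x y + a x * (y == y0)%:R).
Proof.
move=> a0 sa sar [T0 Tu Tv Tr]; split.
- by move=> x y; rewrite addr_ge0// mulr_ge0// ler0n.
- move=> x; rewrite big_split /= Tu (bigD1 y0)//= eqxx mulr1 big1 ?addr0 ?subrK//.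
  by move=> y /negPf ->; rewrite mulr0.
- by move=> y; rewrite big_split /= Tv -mulr_suml sa /less_at subrK.
- move=> y; under eq_bigr do rewrite mulrDl.
  rewrite big_split /= Tr /less_at.
  under [X in _ + X]eq_bigr do rewrite mulrAC.
  rewrite -mulr_suml sar mulrBl.
  by have [->|/negPf ne] := eqVneq y y0; rewrite ?mulr1 ?mulr0 ?subrK// ?mul0r subr0 addr0.
Qed.

Lemma couplable_step u v a y0 d : couplable u v -> (forall x, 0 <= a x <= u x) ->
  \sum_x a x = d -> \sum_x a x * r x = d * r' y0 -> d <= v y0 ->
  (forall s, \sum_y less_at v y0 d y * pospart (r' y - s) <=
     \sum_x (u x - a x) * pospart (r x - s)) ->
  couplable (fun x => u x - a x) (less_at v y0 d).
Proof.
move=> [u0 v0 suv srv dom] ha sa sar dv dom'; split => //.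
- by move=> x; have /andP[] := ha x; rewrite subr_ge0.
- move=> y; rewrite /less_at; have [->|_] := eqVneq y y0.
    by rewrite mulr1 subr_ge0.
  by rewrite mulr0 subr0.
- have e : \sum_y d * (y == y0)%:R = d.
    by rewrite (bigD1 y0)//= eqxx mulr1 big1 ?addr0// => y /negPf ->; rewrite mulr0.
  by rewrite sumrB sa suv sumrB e.
- by under eq_bigr do rewrite mulrBl; rewrite sumrB sar srv sum_less_at.
Qed.

Lemma atoms_step (u : X -> R) (v : Y -> R) (a : X -> R) y0 d : (forall x, 0 <= a x <= u x) -> 0 < d ->
  0 < v y0 -> d = v y0 \/ (exists x, 0 < u x /\ a x = u x) ->
  (atoms (fun x => u x - a x)%R (less_at v y0 d) < atoms u v)%N.
Proof.
move=> ha d0 vy h.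
have sX : [set x | u x - a x != 0] \subset [set x | u x != 0].
  apply/fintype.subsetP => x; rewrite !inE; apply: contraNN => /eqP ux.
  by have := ha x; rewrite ux sub0r oppr_eq0 andbC => /le_anti ->.
have sY : [set y | less_at v y0 d y != 0] \subset [set y | v y != 0].
  apply/fintype.subsetP => y; rewrite !inE; apply: contraNN => /eqP vy'.
  rewrite /less_at vy'; case: (eqVneq y y0) => [e|_]; last by rewrite mulr0 subr0.
  by rewrite e in vy'; rewrite vy' ltxx in vy.
rewrite /atoms; case: h => [dv|[x [ux ax]]].
  rewrite -addnS leq_add ?subset_leq_card//; apply: proper_card.
  apply/fintype.properP; split => //; exists y0; rewrite !inE; first by rewrite gt_eqF.
  by rewrite /less_at dv eqxx mulr1 subrr eqxx.
rewrite -addSn leq_add ?subset_leq_card//; apply: proper_card.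
apply/fintype.properP; split => //; exists x; rewrite !inE; first by rewrite gt_eqF.
by rewrite ax subrr eqxx.
Qed.

(* A piece of atom(s) of [u] adjacent to [r' y0] is matched with [y0]. Because [u] has no
   atom strictly between them, the left potential stays affine there and convexity
   of the right potential preserves the domination. *)
Lemma coupling_exists u v : couplable u v -> exists T, coupling u v T.
Proof.
have [n le_n] := ubnP (atoms u v); elim: n u v le_n => // n IH u v le_n uv.
have [[y0 vy]|v0] := pselect (exists y, 0 < v y); last first.
  have [u0 v0' suv srv _] := uv.
  have vz y : v y = 0.
    by apply/eqP; rewrite eq_le v0' andbT leNgt; apply/negP => vy; apply: v0; exists y.
  have uz x : u x = 0.
    move: suv; rewrite [RHS]big1// => /eqP; rewrite psumr_eq0// => /allP h.
    by apply/eqP; exact: h (mem_index_enum x).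
  exists (fun _ _ => 0); split => // [x|y|y]; rewrite ?uz ?vz ?mul0r big1// => i _.
  by rewrite mul0r.
have step a d : (forall x, 0 <= a x <= u x) ->
    \sum_x a x = d -> \sum_x a x * r x = d * r' y0 -> d <= v y0 -> 0 < d ->
    d = v y0 \/ (exists x, 0 < u x /\ a x = u x) ->
    (forall s, \sum_y less_at v y0 d y * pospart (r' y - s) <=
     \sum_x (u x - a x) * pospart (r x - s)) -> exists T, coupling u v T.
  move=> ha sa sar dv d0 hd dom.
  have [|T hT] := IH _ _ _ (couplable_step uv ha sa sar dv dom).
    by rewrite -ltnS (leq_trans _ le_n)// ltnS; apply: atoms_step.
  by eexists; apply: coupling_extend hT => // x; have /andP[] := ha x.
have [u0 v0 suv srv dom] := uv.
have sumdelta (x1 : X) (c : R) (f : X -> R) : \sum_x c * (x == x1)%:R * f x = c * f x1.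
  rewrite (bigD1 x1)//= eqxx mulr1 big1 ?addr0// => x /negPf ->.
  by rewrite mulr0 mul0r.
have sumdelta1 (x1 : X) (c : R) : \sum_x c * (x == x1)%:R = c.
  by rewrite (bigD1 x1)//= eqxx mulr1 big1 ?addr0// => x /negPf ->; rewrite mulr0.
have [x1' [ux1' rx1']] := exists_above uv vy.
have /(@arg_minP _ _ _ x1' (fun x => (0 < u x) && (r' y0 <= r x)) r) :
  (0 < u x1') && (r' y0 <= r x1') by rewrite ux1'.
case=> x1 /andP[ux1 rx1] min1.
have [x2' [ux2' rx2']] := exists_below uv vy.
have /(@arg_maxP _ _ _ x2' (fun x => (0 < u x) && (r x <= r' y0)) r) :
  (0 < u x2') && (r x2' <= r' y0) by rewrite ux2'.
case=> x2 /andP[ux2 rx2] max2.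
(* An atom of [u] lies exactly at [r' y0] and is matched with [y0] directly: both sides of the
   domination lose the same hinge value. *)
have [e1|ne1] := eqVneq (r x1) (r' y0).
  pose d := Num.min (u x1) (v y0).
  have d0 : 0 < d by rewrite lt_min ux1.
  apply: (step (fun x => d * (x == x1)%:R) d) => //.
  - move=> x; rewrite mulr_ge0 ?ler0n ?(ltW d0)//=.
    by case: eqVneq => [->|_]; rewrite ?mulr1 ?mulr0// ge_min lexx.
  - by rewrite sumdelta e1.
  - by rewrite ge_min lexx orbT.
  - rewrite /d; case: (leP (u x1) (v y0)) => h; [right|by left].
    by exists x1; rewrite eqxx mulr1.
  - move=> s; rewrite sum_less_at; under [X in _ <= X]eq_bigr do rewrite mulrBl.
    by rewrite sumrB sumdelta e1 lerD2r.
have lt1 : r' y0 < r x1 by rewrite lt_neqAle eq_sym ne1.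
have lt2 : r x2 < r' y0.
  rewrite lt_neqAle rx2 andbT; apply/eqP => e2.
  have /min1 : (0 < u x2) && (r' y0 <= r x2) by rewrite ux2 e2 lexx.
  by move=> h; move: lt1; rewrite -e2 ltNge h.
have d12 : 0 < r x1 - r x2 by rewrite subr_gt0 (lt_trans lt2).
have ne12 : x1 != x2 by apply/eqP => e; move: d12; rewrite e subrr ltxx.
(* Barycentric coordinates of [r' y0] between its neighbours [r x2] and [r x1]. *)
pose la := (r' y0 - r x2) / (r x1 - r x2).
pose lb := (r x1 - r' y0) / (r x1 - r x2).
have la0 : 0 < la by rewrite divr_gt0// subr_gt0.
have lb0 : 0 < lb by rewrite divr_gt0// subr_gt0.
have lab : la + lb = 1 by rewrite /la /lb; field; rewrite gt_eqF.
have labr : la * r x1 + lb * r x2 = r' y0 by rewrite /la /lb; field; rewrite gt_eqF.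
(* The largest mass that keeps all three atoms nonnegative; the one attaining the minimum
   disappears. *)
pose d := Num.min (v y0) (Num.min (u x1 / la) (u x2 / lb)).
have d0 : 0 < d by rewrite !lt_min vy (divr_gt0 ux1 la0) (divr_gt0 ux2 lb0).
have da : d * la <= u x1 by rewrite -ler_pdivlMr// !ge_min lexx orbT.
have db : d * lb <= u x2 by rewrite -ler_pdivlMr// !ge_min lexx !orbT.
pose a x := d * la * (x == x1)%:R + d * lb * (x == x2)%:R.
have suma f : \sum_x a x * f x = d * (la * f x1 + lb * f x2).
  rewrite /a; under eq_bigr do rewrite mulrDl.
  by rewrite big_split /= !sumdelta; ring.
have ha x : 0 <= a x <= u x.
  rewrite /a; have [->|n1] := eqVneq x x1.
    by rewrite (negPf ne12) mulr1 mulr0 addr0 da mulr_ge0// ltW.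
  rewrite mulr0 add0r; have [->|n2] := eqVneq x x2; last by rewrite mulr0 lexx u0.
  by rewrite mulr1 db mulr_ge0// ltW.
apply: (step a d) => //.
- by rewrite /a big_split /= !sumdelta1 -mulrDr lab mulr1.
- by rewrite suma labr.
- by rewrite !ge_min lexx.
- have [->|[dE|dE]] : d = v y0 \/ (d = u x1 / la \/ d = u x2 / lb); first by
    rewrite /d; case: (leP (v y0)) => _; [left|right; case: leP; [left|right]].
  + by left.
  + by right; exists x1; rewrite /a dE eqxx (negPf ne12) mulr1 mulr0 addr0 divfK ?gt_eqF.
  + by right; exists x2; rewrite /a dE eqxx eq_sym (negPf ne12) mulr1 mulr0 add0r divfK ?gt_eqF.
- move=> s; under [X in _ <= X]eq_bigr do rewrite mulrBl.
  rewrite sum_less_at sumrB suma.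
  (* If [s] is not strictly between the neighbours, the hinge is affine on the three points
     involved, so both sides decrease by the same amount. *)
  have [le_s|lt_s] := leP s (r x2).
    rewrite !pospart_id ?subr_ge0//; do ?exact: le_trans le_s (ltW _).
    + suff -> : la * (r x1 - s) + lb * (r x2 - s) = r' y0 - s by rewrite lerD2r.
      by rewrite -labr -[s in RHS]mul1r -lab; ring.
    + by rewrite (le_trans le_s)// ltW// (lt_trans lt2).
  have [le_s|gt_s] := leP (r x1) s.
    rewrite !pospart_0 ?subr_le0// ?(le_trans _ le_s)// ?(ltW lt1)//.
      by rewrite !mulr0 addr0 mulr0 !subr0.
    by rewrite ltW// (lt_trans lt2).
  (* For [s] between the neighbours, the domination is interpolated from those at [r x1] and [r x2]:
     the remaining terms of [u] are exactly affine in [s] there ([e2]), those of [v] convex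
     ([e3]). *)
  pose m := (s - r x2) / (r x1 - r x2).
  have m01 : 0 <= m <= 1.
    by rewrite /m ler_pdivrMr// mul1r lerD2r (ltW gt_s) andbT ltW// divr_gt0// subr_gt0.
  have sE : s = m * r x1 + (1 - m) * r x2 by rewrite /m; field; rewrite gt_eqF.
  have e1 : la * pospart (r x1 - s) + lb * pospart (r x2 - s) = la * (1 - m) * (r x1 - r x2).
    rewrite (pospart_id (x := r x1 - s)) ?subr_ge0 ?(ltW gt_s)//.
    rewrite (pospart_0 (x := r x2 - s)) ?subr_le0 ?(ltW lt_s)//.
    by rewrite {1}sE; ring.
  have e2 x : u x * pospart (r x - s) =
     m * (u x * pospart (r x - r x1)) + (1 - m) * (u x * pospart (r x - r x2)).
    have := u0 x; rewrite le_eqVlt => /predU1P[<-|ux]; first by rewrite !mul0r !mulr0 addr0.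
    have [h|h] := leP (r' y0) (r x).
      have hx1 : r x1 <= r x by apply: min1; rewrite ux h.
      rewrite !pospart_id ?subr_ge0//; do ?[by rewrite (le_trans _ hx1)// ltW].
        by rewrite sE; ring.
      by rewrite (le_trans _ hx1)// ltW// (lt_trans lt2).
    have hx2 : r x <= r x2 by apply: max2; rewrite ux ltW.
    have hx2s : r x <= s by rewrite (le_trans hx2)// ltW.
    have hx21 : r x <= r x1 by rewrite (le_trans hx2)// ltW// (lt_trans lt2).
    by rewrite !pospart_0 ?subr_le0// !mulr0 addr0.
  rewrite (eq_bigr _ (fun x _ => e2 x)) big_split /= -!mulr_sumr e1.
  have e3 : \sum_y less_at v y0 d y * pospart (r' y - s) <=
      m * \sum_y less_at v y0 d y * pospart (r' y - r x1) +
      (1 - m) * \sum_y less_at v y0 d y * pospart (r' y - r x2).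
    rewrite !mulr_sumr -big_split /=; apply: ler_sum => y _.
    have w0 : 0 <= less_at v y0 d y.
      rewrite /less_at; case: (eqVneq y y0) => [->|_]; last by rewrite mulr0 subr0.
      by rewrite mulr1 subr_ge0 !ge_min lexx.
    rewrite !(mulrCA _ (less_at _ _ _ _)) -mulrDr ler_wpM2l//.
    rewrite (_ : r' y - s = m * (r' y - r x1) + (1 - m) * (r' y - r x2)); last by rewrite sE; ring.
    exact: pospart_convex.
  have /andP[m0 m1] := m01.
  have f1 := ler_wpM2l m0 (dom (r x1)).
  have f2 : (1 - m) * _ <= (1 - m) * _ := ler_wpM2l _ (dom (r x2)).
  rewrite subr_ge0 in f2; have {}f2 := f2 m1.
  rewrite !sum_less_at in e3.
  rewrite (pospart_0 (x := r' y0 - r x1)) ?subr_le0// in e3.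
  rewrite (pospart_id (x := r' y0 - r x2)) ?subr_ge0// in e3.
  have er : la * (r x1 - r x2) = r' y0 - r x2 by rewrite /la divfK ?gt_eqF.
  have -> : d * (la * (1 - m) * (r x1 - r x2)) = (1 - m) * (d * (r' y0 - r x2)).
    by rewrite -er; ring.
  apply: le_trans e3 _; rewrite mulr0 subr0 mulrBr addrA lerD2r.
  exact: lerD.
Qed.

End Coupling.

(** * Classical Renyi divergences *)

Section Renyi.
Variable R : realType.
Implicit Types (a b : R).

Section Single.
Variable I : finType.
Implicit Types p q : I -> R.

Definition pmf p := (forall i, 0 < p i) /\ \sum_i p i = 1.
Definition Qc a p q : R := \sum_i p i `^ a * q i `^ (1 - a).
Definition cD a p q : R := (a - 1)^-1 * ln (Qc a p q).
Definition KL p q : R := \sum_i p i * ln (p i / q i).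
(** The exponential family from [q] (a = 0) to [p] (a = 1). The mean [tmean] of the log-likelihood
    ratio under it is the derivative of [ln (Qc a p q)] in [a], which links orders with
    thresholds. *)
Definition tilt a p q i : R := p i `^ a * q i `^ (1 - a) / Qc a p q.
Definition tmean a p q : R := \sum_i tilt a p q i * ln (p i / q i).

Lemma pmf_inh p : pmf p -> exists i : I, True.
Proof.
move=> [_ s1]; apply/not_existsP => h; move: s1; rewrite big1 => [/eqP|i].
  by rewrite eq_sym oner_eq0.
by case: (h i).
Qed.

Lemma Qc_gt0 a p q : pmf p -> pmf q -> 0 < Qc a p q.
Proof.
move=> hp hq; have [i _] := pmf_inh hp.
rewrite /Qc (bigD1 i)//= ltr_wpDr//; first by rewrite sumr_ge0// => j _; rewrite mulr_ge0 ?powR_ge0.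
by rewrite mulr_gt0 ?powR_gt0 ?(proj1 hp) ?(proj1 hq).
Qed.

Lemma Qc1 p q : pmf p -> Qc 1 p q = 1.
Proof.
move=> [p0 s1]; rewrite -[RHS]s1; apply: eq_bigr => i _.
by rewrite subrr powRr0 powRr1 ?mulr1// ltW.
Qed.

Lemma Qc_swap a p q : Qc (1 - a) q p = Qc a p q.
Proof. by apply: eq_bigr => i _; rewrite mulrC subKr. Qed.

Lemma Qc0 p q : pmf q -> Qc 0 p q = 1.
Proof. by move=> hq; rewrite -Qc_swap subr0 Qc1. Qed.

Lemma cD_swap a p q : a != 0 -> a != 1 -> cD a p q = a / (1 - a) * cD (1 - a) q p.
Proof.
move=> a0 a1; rewrite /cD Qc_swap (_ : 1 - a - 1 = - a); last by rewrite addrAC subrr sub0r.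
rewrite mulrA; congr (_ * _).
have a1' : 1 - a != 0 by rewrite subr_eq0 eq_sym.
have a1'' : a - 1 != 0 by rewrite subr_eq0.
by field; rewrite ?a0 ?a1' ?a1''.
Qed.

Lemma powR_mulE a x y : 0 < x -> 0 < y -> x `^ a * y `^ (1 - a) = x * expR ((a - 1) * ln (x / y)).
Proof.
move=> x0 y0; rewrite /powR !gt_eqF// ln_div// -expRD -{2}[x]lnK// -expRD.
by congr expR; ring.
Qed.

Lemma Qc_exp a p q : pmf p -> pmf q ->
  Qc a p q = \sum_i p i * expR ((a - 1) * ln (p i / q i)).
Proof. by move=> [p0 _] [q0 _]; apply: eq_bigr => i _; rewrite powR_mulE. Qed.

Lemma exp_jensen (w x : I -> R) : (forall i, 0 <= w i) -> \sum_i w i = 1 ->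
  expR (\sum_i w i * x i) <= \sum_i w i * expR (x i).
Proof.
move=> w0 s1; set m := \sum_i _.
have step i : w i * (expR m * (1 + (x i - m))) <= w i * expR (x i).
  apply: ler_wpM2l => //; rewrite (_ : expR (x i) = expR m * expR (x i - m)); last by rewrite -expRD subrKC.
  rewrite ler_pM2l ?expR_gt0//.
  exact: expR_ge1Dx.
apply: le_trans (ler_sum _ (fun i _ => step i)).
under eq_bigr do rewrite mulrCA.
rewrite -mulr_sumr ler_peMr ?expR_ge0//.
under eq_bigr do rewrite mulrDr mulr1 mulrBr.
by rewrite big_split /= s1 sumrB -mulr_suml s1 mul1r subrr addr0.
Qed.

(** The tangent at order 1 of the convex function [ln Qc], which vanishes there with slope [KL]. *)
Lemma lnQc_ge_KL a p q : pmf p -> pmf q -> (a - 1) * KL p q <= ln (Qc a p q).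
Proof.
move=> hp hq; rewrite -ler_expR lnK ?posrE ?Qc_gt0// Qc_exp//.
rewrite /KL mulr_sumr; under eq_bigr do rewrite mulrCA.
by apply: exp_jensen; [move=> i; rewrite ltW// (proj1 hp)|rewrite (proj2 hp)].
Qed.

(** This is the Hoelder inequality, obtained from the concave perspective with unit weights. *)
Lemma lnQc_convex la a b p q : pmf p -> pmf q -> 0 <= la <= 1 ->
  ln (Qc (la * a + (1 - la) * b) p q) <= la * ln (Qc a p q) + (1 - la) * ln (Qc b p q).
Proof.
move=> hp hq hla.
have gt c i : 0 < p i `^ c * q i `^ (1 - c).
  by rewrite mulr_gt0 ?powR_gt0 ?(proj1 hp) ?(proj1 hq).
have [i0 _] := pmf_inh hp.
have s0 : 0 < \sum_(i : I) (1 : R).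
  by rewrite sumr_const -(mulr_natl 1) mulr1 ltr0n; apply/card_gt0P; exists i0.
have := @perspective_le R I la (fun=> 1) _ _ (fun=> ler01) (gt a) (gt b) s0 hla.
under eq_bigr do rewrite mul1r.
under [X in _ <= X `^ la * _]eq_bigr do rewrite mul1r.
under [X in _ <= _ * X `^ _]eq_bigr do rewrite mul1r.
have Qa := Qc_gt0 a hp hq; have Qb := Qc_gt0 b hp hq.
rewrite -!/(Qc _ _ _) -!ln_powR -lnM ?posrE ?powR_gt0//.
rewrite ler_ln ?posrE ?Qc_gt0 ?mulr_gt0 ?powR_gt0//; apply: le_trans.
rewrite le_eqVlt; apply/orP; left; apply/eqP.
apply: eq_bigr => i _; have p0 := proj1 hp i; have q0 := proj1 hq i.
rewrite !powRM ?powR_ge0// -!powRrM mulrACA -!powRD; first 1 last.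
- by apply/implyP => _; rewrite gt_eqF.
- by apply/implyP => _; rewrite gt_eqF.
by congr (_ `^ _ * _ `^ _); ring.
Qed.

Lemma cD_ge_KL a p q : pmf p -> pmf q -> 1 < a -> KL p q <= cD a p q.
Proof.
move=> hp hq a1; rewrite /cD mulrC ler_pdivlMr ?subr_gt0// mulrC.
exact: lnQc_ge_KL.
Qed.

Lemma cD_le_KL a p q : pmf p -> pmf q -> a < 1 -> cD a p q <= KL p q.
Proof.
move=> hp hq a1; rewrite /cD mulrC ler_ndivrMr ?subr_lt0// mulrC.
exact: lnQc_ge_KL.
Qed.

(** [cD a] is the slope of the chord of [ln Qc] between [a] and 1, and chords of a convex function
    from a fixed point have increasing slopes. Orders on opposite sides of 1 are compared through
    [KL]. *)
Lemma cD_mono a b p q : pmf p -> pmf q -> a != 1 -> b != 1 -> a <= b ->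
  cD a p q <= cD b p q.
Proof.
move=> hp hq na nb ab; have [lt1a|lta1|/eqP] := ltgtP 1 a; last by rewrite eq_sym (negPf na).
  have lt1b := lt_le_trans lt1a ab.
  have hl : 0 <= (a - 1) / (b - 1) <= 1.
    rewrite divr_ge0 ?subr_ge0 ?(ltW lt1a) ?(ltW lt1b)//=.
    by rewrite ler_pdivrMr ?subr_gt0// mul1r lerD2r.
  have := lnQc_convex b 1 hp hq hl; rewrite (Qc1 _ hp) ln1 mulr0 addr0.
  have -> : (a - 1) / (b - 1) * b + (1 - (a - 1) / (b - 1)) * 1 = a.
    by field; rewrite gt_eqF// subr_gt0.
  rewrite /cD => h; rewrite mulrC ler_pdivrMr ?subr_gt0//.
  by rewrite mulrC mulrA.
have [lt1b|ltb1|/eqP] := ltgtP 1 b; last by rewrite eq_sym (negPf nb).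
  exact: le_trans (cD_le_KL hp hq lta1) (cD_ge_KL hp hq lt1b).
have hl : 0 <= (1 - b) / (1 - a) <= 1.
  rewrite divr_ge0 ?subr_ge0 ?(ltW lta1) ?(ltW ltb1)//=.
  by rewrite ler_pdivrMr ?subr_gt0// mul1r lerD2l lerN2.
have := lnQc_convex a 1 hp hq hl; rewrite (Qc1 _ hp) ln1 mulr0 addr0.
have -> : (1 - b) / (1 - a) * a + (1 - (1 - b) / (1 - a)) * 1 = b.
  by field; rewrite gt_eqF// subr_gt0.
rewrite /cD => h; rewrite [X in _ <= X]mulrC ler_ndivlMr ?subr_lt0//.
apply: le_trans h _; rewrite le_eqVlt; apply/orP; left; apply/eqP; field.
by rewrite !subr_eq0 na eq_sym na.
Qed.

Lemma tilt_pmf a p q : pmf p -> pmf q -> pmf (tilt a p q).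
Proof.
move=> hp hq; have Q0 := Qc_gt0 a hp hq; split => [i|].
  by rewrite divr_gt0// mulr_gt0 ?powR_gt0 ?(proj1 hp) ?(proj1 hq).
by rewrite -mulr_suml divff// gt_eqF.
Qed.

Lemma tiltE a p q i : pmf p -> pmf q ->
  p i = tilt a p q i * (Qc a p q * expR ((1 - a) * ln (p i / q i))).
Proof.
move=> hp hq; have p0 := proj1 hp i; have q0 := proj1 hq i.
rewrite /tilt powR_mulE//; set l := ln _.
have e : expR ((a - 1) * l) * expR ((1 - a) * l) = 1.
  by rewrite -expRD -mulrDl subrKA subrr mul0r expR0.
by rewrite -[LHS]mulr1 -[X in _ * X = _]e; field; rewrite gt_eqF ?Qc_gt0.
Qed.

Lemma tmean1 p q : pmf p -> tmean 1 p q = KL p q.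
Proof.
move=> hp; apply: eq_bigr => i _.
by rewrite /tilt Qc1// subrr powRr0 powRr1 ?mulr1 ?divr1// ltW// (proj1 hp).
Qed.

Lemma tmean_swap a p q : pmf p -> pmf q -> tmean (1 - a) q p = - tmean a p q.
Proof.
move=> hp hq; rewrite /tmean -sumrN; apply: eq_bigr => i _.
have p0 := proj1 hp i; have q0 := proj1 hq i.
rewrite /tilt Qc_swap subKr !ln_div ?posrE// -mulrN opprB; congr (_ / _ * _).
exact: mulrC.
Qed.

(** The tangent of [ln Qc] at order [a], evaluated at order 1, lies below the value 0 taken
    there. *)
Lemma lnQc_le_tmean a p q : pmf p -> pmf q -> ln (Qc a p q) <= (a - 1) * tmean a p q.
Proof.
move=> hp hq; have Q0 := Qc_gt0 a hp hq.
have [t0 t1] := tilt_pmf a hp hq.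
have := exp_jensen (fun i => (1 - a) * ln (p i / q i)) (fun i => ltW (t0 i)) t1.
under eq_bigr do rewrite mulrCA; rewrite -mulr_sumr -/(tmean a p q).
have -> : \sum_i tilt a p q i * expR ((1 - a) * ln (p i / q i)) = (Qc a p q)^-1.
  apply: (mulfI (lt0r_neq0 Q0)); rewrite mulfV ?gt_eqF// -[RHS](proj2 hp) mulr_sumr.
  by apply: eq_bigr => i _; rewrite mulrCA -tiltE.
rewrite -[(Qc a p q)^-1]lnK ?posrE ?invr_gt0// ler_expR lnV ?posrE//.
by rewrite lerNr -mulNr opprB.
Qed.

Lemma tmean_le_KL a p q : pmf p -> pmf q -> a < 1 -> tmean a p q <= KL p q.
Proof.
move=> hp hq a1; rewrite -(ler_nM2l (x := a - 1)) ?subr_lt0//.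
exact: le_trans (lnQc_ge_KL _ hp hq) (lnQc_le_tmean _ hp hq).
Qed.

Lemma cD_le_tmean a p q : pmf p -> pmf q -> 1 < a -> cD a p q <= tmean a p q.
Proof.
move=> hp hq a1; rewrite /cD mulrC ler_pdivrMr ?subr_gt0// mulrC.
exact: lnQc_le_tmean.
Qed.

End Single.
End Renyi.

(** * Derivatives in the order and the limit at order one *)

Section Limits.
Variable R : realType.

Lemma is_derive_powRr (x t : R) : 0 < x -> is_derive t 1 (powR x) (x `^ t * ln x).
Proof.
move=> x0; have -> : powR x = expR \o (fun s : R => s * ln x).
  by apply/funext => s; rewrite /powR /= gt_eqF.
have h : is_derive t 1 (fun s : R => s * ln x) (ln x).
  have -> : (fun s : R => s * ln x) = ln x \*: (@id R).
    by apply/funext => s; rewrite /= mulrC.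
  by apply: is_derive_eq; rewrite scaler1.
have := @is_derive1_comp _ expR (fun s => s * ln x) t _ _ (is_derive_expR _) h.
by [].
Qed.

Lemma is_derive_powR_subr (x t : R) : 0 < x ->
  is_derive t 1 (fun a => x `^ (1 - a)) (- (x `^ (1 - t) * ln x)).
Proof.
move=> x0; have h : is_derive t 1 (fun a : R => 1 - a) (-1).
  have -> : (fun a : R => 1 - a) = cst 1 - id by apply/funext.
  by apply: is_derive_eq; rewrite sub0r.
have := @is_derive1_comp _ (powR x) (fun a => 1 - a) t _ _ (is_derive_powRr _ x0) h.
by rewrite mulrN1.
Qed.

(** The expression is the difference quotient of ln f at 1. It serves the classical sums, the Petz
    trace and [basis_Q] alike. *)
Lemma ln_quotient_cvg1 (f : R -> R) (D : R) : f 1 = 1 -> is_derive (1 : R) (1 : R) f D ->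
  ((fun a => (a - 1)^-1 * ln (f a)) @ dnbhs (1 : R) --> D)%classic.
Proof.
move=> f1 df; have dg : is_derive (1 : R) (1 : R) (@ln R \o f) D.
  have dl : is_derive (f 1) 1 (@ln R) 1.
    by rewrite f1 -[X in is_derive _ _ _ X]invr1; exact: is_derive1_ln.
  by have := is_derive1_comp dl df; rewrite mul1r.
have [cv eD] := dg; have := cv; rewrite /derivable -/(derive _ _ _) eD.
move=> /cvgrPdist_lt h; apply/cvgrPdist_lt => e e0.
have := h e e0; rewrite /dnbhs !near_withinE => /nbhs_ballP[d /= d0 hd].
apply/nbhs_ballP; exists d => //= a ad a1.
have := hd (a - 1); rewrite /ball /= sub0r normrN.
have ad' : `|a - 1| < d by rewrite distrC.
move=> /(_ ad'); rewrite subr_eq0 => /(_ a1).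
by rewrite /= f1 ln1 subr0 /GRing.scale /= mulr1 subrK.
Qed.

Variable n : nat.
Implicit Types p q : 'I_n -> R.

Lemma is_derive_Qc p q (t : R) : pmf p -> pmf q ->
  is_derive t 1 (fun a => Qc a p q)
    (\sum_i p i `^ t * q i `^ (1 - t) * ln (p i / q i)).
Proof.
move=> [p0 _] [q0 _].
have -> : (fun a => Qc a p q) = \sum_(i < n) (fun a : R => p i `^ a * q i `^ (1 - a)).
  by apply/funext => a; rewrite fct_sumE.
apply: is_derive_sum => i.
have h : is_derive t 1 (fun a : R => p i `^ a * q i `^ (1 - a)) _ :=
  is_deriveM (is_derive_powRr t (p0 i)) (is_derive_powR_subr t (q0 i)).
apply: (is_derive_eq h); rewrite /GRing.scale /= ln_div ?posrE//; ring.
Qed.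

Lemma cD_cvg1 p q : pmf p -> pmf q ->
  ((fun a => cD a p q) @ dnbhs (1 : R) --> KL p q)%classic.
Proof.
move=> hp hq; apply: ln_quotient_cvg1; first exact: Qc1.
have := is_derive_Qc 1 hp hq; rewrite (eq_bigr (fun i => p i * ln (p i / q i)))// => i _.
by rewrite subrr powRr0 powRr1 ?mulr1// ltW// (proj1 hp).
Qed.

Lemma tmean_continuous p q : pmf p -> pmf q -> continuous (fun a => tmean a p q).
Proof.
move=> hp hq a.
have -> : (fun a => tmean a p q) = (fun a =>
   (\sum_(i < n) (fun b : R => ln (p i / q i) * (p i `^ b * q i `^ (1 - b)))) a / Qc a p q).
  apply/funext => b; rewrite /tmean fct_sumE mulr_suml.
  by apply: eq_bigr => i _; rewrite /tilt /=; ring.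
have dcont (f : R -> R) D : is_derive a 1 f D -> {for a, continuous f}.
  by move=> [df _]; apply: differentiable_continuous; rewrite -derivable1_diffP.
apply: cvgM; last first.
  by apply: cvgV; [rewrite gt_eqF// Qc_gt0|apply: dcont (is_derive_Qc a hp hq)].
apply: dcont (is_derive_sum _) => i.
exact: (is_deriveZ (ln (p i / q i))
  (is_deriveM (is_derive_powRr a (proj1 hp i)) (is_derive_powR_subr a (proj1 hq i)))).
Qed.

End Limits.

(** * Product laws and concentration of log-likelihood ratios *)

Section Powers.
Variable R : realType.

Lemma sum_mxtens (V : nmodType) m n (F : 'I_(m * n) -> V) :
  \sum_k F k = \sum_i \sum_j F (mxtens_index (i, j)).
Proof.
rewrite pair_bigA /= (reindex (@mxtens_index m n)) /=.
  by apply: eq_bigr => -[i j].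
by exists (@mxtens_unindex m n) => k _; rewrite (mxtens_indexK, mxtens_unindexK).
Qed.

(** Indexed like [tpow], so that the spectrum of a tensor power is literally a [vpow]. *)
Fixpoint vpow (d : nat) (f : 'I_d -> R) (k : nat) : 'I_(pw d k) -> R :=
  match k return 'I_(pw d k) -> R with
  | 0 => fun=> 1
  | k'.+1 => fun i => f (mxtens_unindex i).1 * @vpow d f k' (mxtens_unindex i).2
  end.
Arguments vpow {d} f k i.

Fixpoint vsum (d : nat) (f : 'I_d -> R) (k : nat) : 'I_(pw d k) -> R :=
  match k return 'I_(pw d k) -> R with
  | 0 => fun=> 0
  | k'.+1 => fun i => f (mxtens_unindex i).1 + @vsum d f k' (mxtens_unindex i).2
  end.
Arguments vsum {d} f k i.

Variable d : nat.
Implicit Types (f g p q : 'I_d -> R) (k : nat).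

Lemma vpowS f k i j : vpow f k.+1 (mxtens_index (i, j)) = f i * vpow f k j.
Proof. by rewrite -[RHS]/(f (i, j).1 * vpow f k (i, j).2) -[in RHS](mxtens_indexK (i, j)). Qed.

Lemma vsumS f k i j : vsum f k.+1 (mxtens_index (i, j)) = f i + vsum f k j.
Proof. by rewrite -[RHS]/(f (i, j).1 + vsum f k (i, j).2) -[in RHS](mxtens_indexK (i, j)). Qed.

Lemma sum_vpow f k : \sum_i vpow f k i = (\sum_i f i) ^+ k.
Proof.
elim: k => [|k IH]; first by rewrite /= big_ord_recl big_ord0 addr0.
rewrite [LHS]sum_mxtens exprS -IH mulr_suml; apply: eq_bigr => i _.
by rewrite mulr_sumr; apply: eq_bigr => j _; exact: vpowS.
Qed.

Lemma vpow_gt0 f k : (forall i, 0 < f i) -> forall i, 0 < vpow f k i.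
Proof. by move=> f0; elim: k => [|k IH] i //=; rewrite mulr_gt0. Qed.

Lemma vpow_pmf p k : pmf p -> pmf (vpow p k).
Proof. by move=> [p0 p1]; split; [exact: vpow_gt0|rewrite sum_vpow p1 expr1n]. Qed.

Lemma vpowM f g k i : vpow (fun i => f i * g i) k i = vpow f k i * vpow g k i.
Proof. by elim: k i => [|k IH] i /=; rewrite ?mulr1// IH mulrACA. Qed.

Lemma eq_vpow f g k : f =1 g -> vpow f k =1 vpow g k.
Proof. by move=> e; elim: k => [|k IH] i //=; rewrite e IH. Qed.

Lemma vpow_powR f a k i : (forall i, 0 < f i) -> vpow (fun i => f i `^ a) k i = vpow f k i `^ a.
Proof.
move=> f0; elim: k i => [|k IH] i /=; first by rewrite powR1.
by rewrite IH powRM// ltW// vpow_gt0.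
Qed.

Lemma vpow_expR f c k i : vpow (fun i => expR (c * f i)) k i = expR (c * vsum f k i).
Proof.
by elim: k i => [|k IH] i /=; rewrite ?mulr0 ?expR0// IH -expRD -mulrDr.
Qed.

Lemma ln_vpow p q k i : (forall i, 0 < p i) -> (forall i, 0 < q i) ->
  ln (vpow p k i / vpow q k i) = vsum (fun i => ln (p i / q i)) k i.
Proof.
move=> p0 q0; elim: k i => [|k IH] i /=; first by rewrite divr1 ln1.
rewrite -IH -mulf_div [LHS]lnM // posrE; apply: divr_gt0 => //; exact: vpow_gt0.
Qed.

Lemma Qc_vpow a p q k : (forall i, 0 < p i) -> (forall i, 0 < q i) ->
  Qc a (vpow p k) (vpow q k) = Qc a p q ^+ k.
Proof.
move=> p0 q0; rewrite -[RHS]sum_vpow; apply: eq_bigr => i _.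
by rewrite vpowM !vpow_powR//.
Qed.

Lemma vsum_moment1 (w l : 'I_d -> R) k : \sum_i w i = 1 -> \sum_i w i * l i = 0 ->
  \sum_i vpow w k i * vsum l k i = 0.
Proof.
move=> w1 wl; elim: k => [|k IH]; first by rewrite big1// => i _; rewrite mulr0.
rewrite [LHS]sum_mxtens; under eq_bigr do under eq_bigr do rewrite vpowS vsumS mulrDr.
under eq_bigr do rewrite big_split /=.
rewrite big_split /= [X in X + _ = 0](_ : _ = \sum_i w i * l i * \sum_j vpow w k j).
  rewrite -mulr_suml wl mul0r add0r big1// => i _.
  by under eq_bigr do rewrite -mulrA; rewrite -mulr_sumr IH mulr0.
by apply: eq_bigr => i _; rewrite mulr_sumr; apply: eq_bigr => j _; rewrite mulrAC.
Qed.

(** Variances add for independent letters: the cross term vanishes because [l] is centred. *)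
Lemma vsum_moment2 (w l : 'I_d -> R) k : \sum_i w i = 1 -> \sum_i w i * l i = 0 ->
  \sum_i vpow w k i * vsum l k i ^+ 2 = k%:R * \sum_i w i * l i ^+ 2.
Proof.
move=> w1 wl; elim: k => [|k IH].
  by rewrite big1 ?mul0r// => i _; rewrite expr0n /= mulr0.
rewrite [LHS]sum_mxtens.
have e i j : vpow w k.+1 (mxtens_index (i, j)) * vsum l k.+1 (mxtens_index (i, j)) ^+ 2 =
   w i * l i ^+ 2 * vpow w k j + (w i * l i * 2) * (vpow w k j * vsum l k j) +
   w i * (vpow w k j * vsum l k j ^+ 2).
  by rewrite vpowS vsumS; ring.
under eq_bigr do under eq_bigr do rewrite e.
under eq_bigr do rewrite !big_split /= -!mulr_sumr vsum_moment1// mulr0 addr0 sum_vpow w1 expr1n mulr1 IH.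
by rewrite big_split /= -mulr_suml w1 mul1r -natr1 mulrDl mul1r addrC.
Qed.

Lemma vsum_sub (l : 'I_d -> R) c k i : vsum (fun i => l i - c) k i = vsum l k i - c * k%:R.
Proof.
elim: k i => [|k IH] i /=; first by rewrite mulr0 subr0.
by rewrite IH -natr1; ring.
Qed.

(** Chebyshev: with [V] the variance of one letter, the mass outside the window is at most V / (e^2
    k), which is at most 1/2 once k >= 2 V / e^2. *)
Lemma window_mass (w l : 'I_d -> R) (e : R) : pmf w -> 0 < e ->
  (\forall k \near \oo, 2^-1 <=
    \sum_(i | `|vsum l k i - (\sum_i w i * l i) * k%:R| <= e * k%:R) vpow w k i)%classic.
Proof.
move=> [w0 w1] e0; set m := \sum_i w i * l i.
pose V := \sum_i w i * (l i - m) ^+ 2.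
have V0 : 0 <= V by apply: sumr_ge0 => i _; rewrite mulr_ge0 ?sqr_ge0// ltW.
have wl : \sum_i w i * (l i - m) = 0.
  by under eq_bigr do rewrite mulrBr; rewrite sumrB -mulr_suml w1 mul1r subrr.
near=> k.
have k0 : 0 < k%:R :> R by near: k; exact: nbhs_infty_gtr.
have kV : 2 * V / e ^+ 2 <= k%:R by near: k; exact: nbhs_infty_ger.
have tot := sum_vpow w k; rewrite w1 expr1n in tot.
have := vsum_moment2 k w1 wl; rewrite -/V => m2.
set W := (X in _ <= X).
have : (1 - W) * (e * k%:R) ^+ 2 <= k%:R * V.
  rewrite -m2 -{1}tot (bigID (fun i => `|vsum l k i - m * k%:R| <= e * k%:R)) /=.
  rewrite -/W addrAC subrr add0r mulr_suml.
  rewrite [X in _ <= X](bigID (fun i => `|vsum l k i - m * k%:R| <= e * k%:R)) /=.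
  rewrite ler_wpDl//; first by apply: sumr_ge0 => i _; rewrite mulr_ge0 ?sqr_ge0// ltW// vpow_gt0.
  apply: ler_sum => i; rewrite -ltNge => h.
  rewrite ler_wpM2l ?(ltW (vpow_gt0 _ _))// vsum_sub -[X in _ <= X]real_normK ?num_real//.
  by rewrite lerXn2r ?nnegrE// ?mulr_ge0 ?(ltW e0) ?(ltW k0)// ltW.
move=> h; rewrite leNgt; apply/negP => W2.
have ek0 : 0 < (e * k%:R) ^+ 2 by rewrite exprn_gt0// mulr_gt0.
have : 2^-1 * (e * k%:R) ^+ 2 < (1 - W) * (e * k%:R) ^+ 2.
  by rewrite ltr_pM2r//; lra.
rewrite ltNge => /negP; apply; apply: le_trans h _.
rewrite ler_pdivrMr ?exprn_gt0// in kV.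
rewrite exprMn (_ : _ * (_ * _) = k%:R * (2^-1 * (k%:R * e ^+ 2))); last by ring.
by rewrite ler_pM2l//; lra.
Unshelve. all: by end_near.
Qed.

End Powers.

Arguments vpow {R d} f k i.
Arguments vsum {R d} f k i.

(** * Comparison of likelihood-ratio tests for large samples *)

Section Overlap.
Variable R : realType.

Section Generic.
Variable I : finType.
Implicit Types (P Q : I -> R) (s a : R).

(** By Neyman-Pearson, the least value over all tests of the error under [P] plus [s] times the
    error under [Q]. *)
Definition overlap s P Q : R := \sum_i Num.min (P i) (s * Q i).

Lemma overlap_swap s P Q : 0 < s -> overlap s P Q = s * overlap s^-1 Q P.
Proof.
move=> s0; rewrite /overlap mulr_sumr; apply: eq_bigr => i _.
by rewrite minr_pMr ?ltW// mulrA divff ?gt_eqF// mul1r minC.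
Qed.

Lemma overlap_le1 s P Q : pmf P -> overlap s P Q <= 1.
Proof. by move=> [P0 <-]; apply: ler_sum => i _; rewrite ge_min lexx. Qed.

Lemma hockey_overlap s P Q : \sum_i pospart (P i - s * Q i) = \sum_i P i - overlap s P Q.
Proof.
rewrite -sumrB; apply: eq_bigr => i _.
have [h|/ltW h] := leP (P i) (s * Q i); first by rewrite pospart_0 ?subr_le0// subrr.
by rewrite pospart_id ?subr_ge0.
Qed.

(** Chernoff bound: a minimum is at most any weighted geometric mean. *)
Lemma overlap_upper a th P Q : pmf P -> pmf Q -> 0 <= a <= 1 ->
  overlap (expR th) P Q <= expR ((1 - a) * th + ln (Qc a P Q)).
Proof.
move=> hP hQ /andP[a0 a1]; have a1' : 0 <= 1 - a by rewrite subr_ge0.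
rewrite expRD lnK ?posrE ?Qc_gt0// mulr_sumr; apply: ler_sum => i _.
have P0 := proj1 hP i; have Q0 := proj1 hQ i.
have sQ0 : 0 < expR th * Q i by rewrite mulr_gt0 ?expR_gt0.
set m := Num.min _ _; have m0 : 0 < m by rewrite lt_min P0.
have -> : m = m `^ a * m `^ (1 - a).
  by rewrite -powRD ?(gt_eqF m0) ?implybT// subrKC powRr1// ltW.
rewrite mulrCA.
have -> : expR ((1 - a) * th) * Q i `^ (1 - a) = (expR th * Q i) `^ (1 - a).
  rewrite powRM ?expR_ge0 ?(ltW Q0)//; congr (_ * _).
  by rewrite /powR gt_eqF ?expR_gt0// expRK.
apply: ler_pM; rewrite ?powR_ge0// ge0_ler_powR ?nnegrE ?(ltW m0) ?(ltW P0) ?(ltW sQ0)//.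
  by rewrite ge_min lexx.
by rewrite ge_min lexx orbT.
Qed.

(** Where P exceeds sQ, the factor (P/(sQ))^(a-1) is at least 1 and may be inserted; elsewhere the
    hinge is 0. *)
Lemma hockey_upper a th P Q : pmf P -> pmf Q -> 1 <= a ->
  \sum_i pospart (P i - expR th * Q i) <= expR ((1 - a) * th + ln (Qc a P Q)).
Proof.
move=> hP hQ a1; rewrite expRD lnK ?posrE ?Qc_gt0// mulr_sumr; apply: ler_sum => i _.
have P0 := proj1 hP i; have Q0 := proj1 hQ i.
have [h|/ltW h] := leP (P i) (expR th * Q i).
  by rewrite pospart_0 ?subr_le0// !mulr_ge0 ?expR_ge0 ?powR_ge0.
rewrite pospart_id ?subr_ge0//.
apply: (@le_trans _ _ (P i)); first by rewrite gerBl mulr_ge0 ?expR_ge0// ltW.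
rewrite powR_mulE// mulrCA -expRD ler_peMr ?(ltW P0)// -[leLHS]expR0 ler_expR.
have : th <= ln (P i / Q i).
  by rewrite -ler_expR lnK ?posrE ?divr_gt0// ler_pdivlMr.
move=> hth; rewrite (_ : _ + _ = (a - 1) * (ln (P i / Q i) - th)); last by ring.
by rewrite mulr_ge0 ?subr_ge0.
Qed.

End Generic.

Section Local.
Variables (n1 n2 : nat) (p q : 'I_n1 -> R) (p2 q2 : 'I_n2 -> R) (c0 : R).
Hypotheses (hp : pmf p) (hq : pmf q) (hp2 : pmf p2) (hq2 : pmf q2) (c00 : 0 < c0).

Definition copies (t : nat) := Num.trunc (c0 * t%:R).

Lemma copies_le t : (copies t)%:R <= c0 * t%:R.
Proof. by rewrite truncn_le mulr_ge0// ltW. Qed.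

Lemma copies_gt t : c0 * t%:R - 1 < (copies t)%:R.
Proof. by rewrite ltrBlDr -[1]/(1%:R) -natrD addn1; exact: truncnS_gt. Qed.

Lemma copies_infty (A : nat -> Prop) :
  (\forall k \near \oo, A k)%classic -> (\forall t \near \oo, A (copies t))%classic.
Proof.
move=> [N _ hN]; near=> t; apply: hN => /=.
have : N%:R / c0 + c0^-1 <= t%:R by near: t; exact: nbhs_infty_ger.
rewrite -[X in _ + X]mul1r -mulrDl ler_pdivrMr// mulrC => h.
have := copies_gt t; rewrite -(ler_nat R) => h2; apply/ltW; apply: le_lt_trans h2; lra.
Unshelve. all: by end_near.
Qed.

(* The slope [x] parametrizes the likelihood-ratio threshold [expR (x * t)]. *)
Definition dominated (x : R) (t : nat) :=
  overlap (expR (x * t%:R)) (vpow p t) (vpow q t) <=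
  overlap (expR (x * t%:R)) (vpow p2 (copies t)) (vpow q2 (copies t)).

Lemma vpow_const n (c : R) k i : vpow (fun _ : 'I_n => c) k i = c ^+ k.
Proof. by elim: k i => [|k IH] i //=; rewrite IH exprS. Qed.

Lemma vpow_tilt n a (f g : 'I_n -> R) k i : pmf f -> pmf g ->
  vpow f k i = vpow (tilt a f g) k i *
    expR (k%:R * ln (Qc a f g) + (1 - a) * vsum (fun i => ln (f i / g i)) k i).
Proof.
move=> hf hg.
rewrite (@eq_vpow _ _ f (fun i => tilt a f g i * (Qc a f g * expR ((1 - a) * ln (f i / g i))))); last first.
  by move=> j; exact: tiltE.
rewrite vpowM vpowM vpow_const vpow_expR expRD expRM_natl lnK ?posrE ?Qc_gt0//.
Qed.

(* Exponential tilting: under the tilted law, whose mean log-likelihood ratio [mu] exceeds the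
   slope, a window of radius [d t] around [mu t] carries half of the mass (Chebyshev); the
   target is bounded through its Renyi divergence of order [al]. *)
Lemma dominated_above al a : 1 < al -> a < tmean al p q ->
  0 <= ln (Qc al p2 q2) ->
  (al - 1) * (tmean al p q - a) < ln (Qc al p q) - c0 * ln (Qc al p2 q2) ->
  (\forall x \near a & t \near \oo, dominated x t)%classic.
Proof.
move=> al1 amu lnQ2; set mu := tmean al p q in amu *.
set L := ln (Qc al p q); set L2 := ln (Qc al p2 q2) in lnQ2 *; move=> he.
pose e := L - c0 * L2 - (al - 1) * (mu - a).
have e0 : 0 < e by rewrite subr_gt0.
have eD : L - c0 * L2 - (al - 1) * (mu - a) = e by [].
have al0 : 0 < al - 1 by rewrite subr_gt0.
(* The first bound keeps the whole window above the slope, so that there P is at least twice the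
   threshold times Q. The second keeps the loss (al - 1) d t of the change of measure within the
   slack e t. *)
pose d := Num.min ((mu - a) / 4) (e / (4 * (al - 1))).
have d0 : 0 < d by rewrite lt_min !divr_gt0// ?subr_gt0// mulr_gt0.
have dmu : 4 * d <= mu - a by rewrite mulrC -ler_pdivlMr// /d ge_min lexx.
have de : 4 * (d * (al - 1)) <= e.
  by rewrite mulrCA -ler_pdivlMr ?mulr_gt0// /d ge_min lexx orbT.
clearbody e d.
have win := window_mass (fun i => ln (p i / q i)) (tilt_pmf al hp hq) d0.
rewrite -/(tmean al p q) -/mu in win.
near=> x t.
have xa : `|a - x| < d by near: x; exact: (@nbhsx_ballx _ R a d d0).
have W : 2^-1 <= \sum_(i | `|vsum (fun i => ln (p i / q i)) t i - mu * t%:R| <= d * t%:R)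
   vpow (tilt al p q) t i by near: t; exact: win.
have t1 : d^-1 <= t%:R by near: t; exact: nbhs_infty_ger.
have t2 : 4 / e <= t%:R by near: t; exact: nbhs_infty_ger.
have t0 : 0 < t%:R :> R by rewrite (lt_le_trans _ t1)// invr_gt0.
rewrite ler_pdivrMr// in t2.
have {}t1 : 1 <= d * t%:R by rewrite -ler_pdivrMl// mulr1.
have [ax xa'] : a - x < d /\ x - a < d.
  by split; apply: le_lt_trans xa; rewrite ?ler_norm// distrC ler_norm.
have [hP hQ] := (vpow_pmf t hp, vpow_pmf t hq).
have [hP2 hQ2] := (vpow_pmf (copies t) hp2, vpow_pmf (copies t) hq2).
(* Both overlaps may be close to 1 here, so their complements are compared. *)
rewrite /dominated -lerN2 -(lerD2l 1) -{1}(proj2 hP2) -[X in _ <= X - _](proj2 hP) -!hockey_overlap.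
apply: le_trans (hockey_upper _ hP2 hQ2 (ltW al1)) _.
rewrite (Qc_vpow _ _ (proj1 hp2) (proj1 hq2)) lnXn ?Qc_gt0// -/L2 -[L2 *+ _]mulr_natl /=.
pose E := t%:R * L - (al - 1) * ((mu + d) * t%:R).
(* [E] is the logarithm of the density with respect to the tilted law at the upper end of the
   window. Of the factor 1/4, one half is the window mass, the other the share of P that survives in
   the hinge. *)
apply: (@le_trans _ _ (4^-1 * expR E)).
  rewrite -[4^-1]lnK ?posrE ?invr_gt0// -expRD ler_expR.
  have l4 : -2 <= ln (4^-1 : R).
    rewrite -ler_expR lnK ?posrE ?invr_gt0// expRN lef_pV2 ?posrE ?expR_gt0//.
    have e2 : expR 2 = expR 1 * expR 1 :> R by rewrite -expRD.
    have := expR_ge1Dx (1 : R); rewrite e2 => h.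
    have : (1 + 1) * (1 + 1) <= expR 1 * expR 1 :> R by apply: ler_pM.
    lra.
  have m1 : (copies t)%:R * L2 <= c0 * t%:R * L2 by rewrite ler_wpM2r// copies_le.
  have x1 : (al - 1) * ((mu + d - x) * t%:R) <= (al - 1) * (mu - a) * t%:R + e / 2 * t%:R.
    rewrite mulrA -mulrDl ler_wpM2r ?ltW//; nra.
  have eE : e * t%:R = L * t%:R - c0 * L2 * t%:R - (al - 1) * (mu - a) * t%:R.
    by rewrite -eD; ring.
  rewrite /E; lra.
apply: (@le_trans _ _ (\sum_(i | `|vsum (fun i => ln (p i / q i)) t i - mu * t%:R| <= d * t%:R)
   2^-1 * expR E * vpow (tilt al p q) t i)).
  rewrite -mulr_sumr [leLHS](_ : _ = 2^-1 * expR E * 2^-1); last by field.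
  by rewrite ler_wpM2l// mulr_ge0 ?expR_ge0.
rewrite [leRHS](bigID (fun i => `|vsum (fun i => ln (p i / q i)) t i - mu * t%:R| <= d * t%:R))/=.
rewrite ler_wpDr//; first by apply: sumr_ge0 => i _; exact: pospart_ge0.
apply: ler_sum => i; rewrite ler_norml => /andP[w1 w2].
set l := vsum _ t i in w1 w2.
have P0 := proj1 hP i; have Q0 := proj1 hQ i.
have lE : ln (vpow p t i / vpow q t i) = l.
  by apply: ln_vpow; [exact: (proj1 hp)|exact: (proj1 hq)].
have PE : vpow p t i = vpow q t i * expR l.
  by rewrite -lE lnK ?posrE ?divr_gt0// mulrC divfK// gt_eqF.
apply: le_trans (pospart_ge _).
have half : expR (x * t%:R) * vpow q t i <= 2^-1 * vpow p t i.
  rewrite PE mulrC mulrCA ler_wpM2l// ?(ltW Q0)//.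
  have : expR (x * t%:R - l) <= 2^-1.
    rewrite -[_ - l]opprB expRN lef_pV2 ?posrE ?expR_gt0//.
    by apply: le_trans (expR_ge1Dx _); nra.
  by rewrite expRD expRN ler_pdivrMr ?expR_gt0.
apply: (@le_trans _ _ (2^-1 * vpow p t i)); last by lra.
rewrite (vpow_tilt al i hp hq) -/L -/l -mulrA ler_wpM2l// mulrC ler_wpM2l ?(ltW (vpow_gt0 _ _))//.
  by move=> j; case: (tilt_pmf al hp hq).
by rewrite ler_expR /E -[(1 - al)]opprB mulNr lerD2l lerN2 ler_wpM2l ?(ltW al0)//; lra.
Unshelve. all: by end_near.
Qed.

Lemma lnQc_le0 n (f g : 'I_n -> R) al : pmf f -> pmf g -> 0 <= al <= 1 -> ln (Qc al f g) <= 0.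
Proof.
move=> hf hg hal; have := lnQc_convex 1 0 hf hg hal.
by rewrite mulr1 mulr0 addr0 (Qc1 _ hf) (Qc0 _ hg) ln1 !mulr0 addr0.
Qed.

(** The roles are exchanged with respect to [dominated_above]: the source overlap is bounded by
    Chernoff, and the target law is tilted to bound its overlap from below. Against the common
    exponent, the two members of the minimum cost (1 - al)(th - l) and al (l - th), where [th] is
    the log-threshold and [l] the log-likelihood ratio. *)
Lemma dominated_below al a : 0 < al < 1 -> c0 * tmean al p2 q2 <= a ->
  (1 - al) * (a - c0 * tmean al p2 q2) < c0 * ln (Qc al p2 q2) - ln (Qc al p q) ->
  (\forall x \near a & t \near \oo, dominated x t)%classic.
Proof.
move=> /andP[al0 al1]; set mu := tmean al p2 q2 => mua.
have lnQ2 := lnQc_le0 hp2 hq2 (_ : 0 <= al <= 1); rewrite (ltW al0) (ltW al1) in lnQ2.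
have {}lnQ2 := lnQ2 isT.
set L := ln (Qc al p q); set L2 := ln (Qc al p2 q2) in lnQ2 *; move=> he.
pose e := c0 * L2 - L - (1 - al) * (a - c0 * mu).
have e0 : 0 < e by rewrite subr_gt0.
have eD : c0 * L2 - L - (1 - al) * (a - c0 * mu) = e by [].
pose d := e / (4 * c0); have d0 : 0 < d by rewrite divr_gt0// mulr_gt0.
have dE : 4 * (d * c0) = e by rewrite /d; field; rewrite gt_eqF.
clearbody e d.
have win := copies_infty (window_mass (fun i => ln (p2 i / q2 i)) (tilt_pmf al hp2 hq2) d0).
rewrite -/(tmean al p2 q2) -/mu in win.
have e4 : 0 < e / 4 by rewrite divr_gt0.
near=> x t; rewrite /dominated /=.
have xa : `|a - x| < e / 4 by near: x; exact: (@nbhsx_ballx _ R a _ e4).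
have W : 2^-1 <= \sum_(i | `|vsum (fun i => ln (p2 i / q2 i)) (copies t) i - mu * (copies t)%:R|
    <= d * (copies t)%:R) vpow (tilt al p2 q2) (copies t) i by near: t; exact: win.
have t2 : 2 * (1 + `|mu|) / e <= t%:R by near: t; exact: nbhs_infty_ger.
have t0 : 0 <= t%:R :> R by [].
rewrite ler_pdivrMr// in t2.
have [ax xa'] : a - x < e / 4 /\ x - a < e / 4.
  by split; apply: le_lt_trans xa; rewrite ?ler_norm// distrC ler_norm.
have [hP hQ] := (vpow_pmf t hp, vpow_pmf t hq).
have [hP2 hQ2] := (vpow_pmf (copies t) hp2, vpow_pmf (copies t) hq2).
have al01 : 0 <= al <= 1 by rewrite !ltW.
apply: le_trans (overlap_upper _ hP hQ al01) _.
rewrite (Qc_vpow _ _ (proj1 hp) (proj1 hq)) lnXn ?Qc_gt0// -/L -[L *+ _]mulr_natl.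
set m := copies t in W hP2 hQ2 *.
have m1 : m%:R <= c0 * t%:R := copies_le t.
have m2 : c0 * t%:R - 1 < m%:R := copies_gt t.
pose th := x * t%:R.
(* Bounds both costs over the window; the term [|mu|] covers the rounding of c0 t to an integer
   number of copies. *)
pose K := (1 - al) * (a - c0 * mu) * t%:R + e / 2 * t%:R + `|mu|.
pose E := m%:R * L2 + (1 - al) * th - K.
have mmu : `|m%:R * mu - c0 * t%:R * mu| <= `|mu|.
  rewrite -mulrBl normrM ler_piMl ?normr_ge0// ler_norml; lra.
have [mmu1 mmu2] : m%:R * mu <= c0 * t%:R * mu + `|mu| /\ c0 * t%:R * mu - `|mu| <= m%:R * mu.
  by move: mmu; rewrite ler_norml => /andP[h1 h2]; split; lra.
have dm : d * m%:R <= e / 4 * t%:R.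
  apply: (@le_trans _ _ (d * (c0 * t%:R))); first by rewrite ler_wpM2l ?(ltW d0).
  by rewrite -dE; lra.
have xt1 : x * t%:R <= a * t%:R + e / 4 * t%:R by rewrite -mulrDl ler_wpM2r//; lra.
have xt2 : a * t%:R - e / 4 * t%:R <= x * t%:R by rewrite -mulrBl ler_wpM2r//; lra.
have gap0 : 0 <= (1 - al) * (a - c0 * mu) * t%:R by rewrite !mulr_ge0//; lra.
have mu0 := normr_ge0 mu.
have et0 : 0 <= e * t%:R by rewrite mulr_ge0// ltW.
apply: (@le_trans _ _ (2^-1 * expR E)).
  rewrite -[2^-1]lnK ?posrE ?invr_gt0// -expRD ler_expR.
  have l2 : -1 <= ln (2^-1 : R).
    rewrite -ler_expR lnK ?posrE ?invr_gt0// expRN lef_pV2 ?posrE ?expR_gt0//.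
    exact: expR_ge1Dx.
  have m3 : c0 * t%:R * L2 <= m%:R * L2 by rewrite ler_wnM2r.
  have eE : e * t%:R = c0 * t%:R * L2 - L * t%:R - (1 - al) * (a - c0 * mu) * t%:R.
    by rewrite -eD; ring.
  rewrite /E /K /th; lra.
apply: (@le_trans _ _ (\sum_(i | `|vsum (fun i => ln (p2 i / q2 i)) m i - mu * m%:R| <= d * m%:R)
   expR E * vpow (tilt al p2 q2) m i)).
  by rewrite -mulr_sumr [leLHS]mulrC ler_wpM2l ?expR_ge0.
rewrite /overlap [leRHS](bigID (fun i => `|vsum (fun i => ln (p2 i / q2 i)) m i - mu * m%:R| <= d * m%:R))/=.
rewrite ler_wpDr//.
  apply: sumr_ge0 => i _; rewrite le_min (ltW (proj1 hP2 i)) mulr_ge0 ?expR_ge0//.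
  by rewrite ltW// (proj1 hQ2).
apply: ler_sum => i; rewrite ler_norml => /andP[w1 w2].
set l := vsum _ m i in w1 w2.
have P0 := proj1 hP2 i; have Q0 := proj1 hQ2 i.
have lE : ln (vpow p2 m i / vpow q2 m i) = l.
  by apply: ln_vpow; [exact: (proj1 hp2)|exact: (proj1 hq2)].
have PE : vpow q2 m i = vpow p2 m i * expR (- l).
  by rewrite expRN -lE lnK ?posrE ?divr_gt0// invf_div mulrC divfK// gt_eqF.
have w0 : 0 <= vpow (tilt al p2 q2) m i.
  by apply/ltW/vpow_gt0 => j; case: (tilt_pmf al hp2 hq2).
rewrite PE mulrCA (vpow_tilt al i hp2 hq2) -/L2 -/l le_min; apply/andP; split.
  rewrite mulrC ler_wpM2l// ler_expR /E.
  have : (1 - al) * (th - l) <= K.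
    apply: (@le_trans _ _ ((1 - al) * ((a - c0 * mu) * t%:R + (e / 2 * t%:R + `|mu|)))).
      by rewrite ler_wpM2l ?subr_ge0 ?(ltW al1)//; rewrite /th; lra.
    rewrite mulrDr /K mulrA -addrA lerD2l ler_piMl ?gerBl ?(ltW al0)//.
    by rewrite addr_ge0// -mulrAC divr_ge0.
  by lra.
rewrite -mulrA [leLHS]mulrC ler_wpM2l// -!expRD ler_expR /E -/th.
have : al * (l - th) <= K.
  apply: (@le_trans _ _ (al * (e / 2 * t%:R + `|mu|))).
    rewrite ler_wpM2l ?(ltW al0)// /th.
    have : c0 * mu * t%:R <= a * t%:R by rewrite ler_wpM2r.
    lra.
  rewrite /K -addrA; apply: le_trans (_ : e / 2 * t%:R + `|mu| <= _); last by rewrite lerDr.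
  by rewrite ler_piMl ?(ltW al1)// addr_ge0// -mulrAC divr_ge0.
by lra.
Unshelve. all: by end_near.
Qed.

(** Beyond every target likelihood ratio the minimum is always the first argument, so the target
    overlap equals 1, the largest possible value. *)
Lemma dominated_outside x t : (forall y, c0 * ln (p2 y / q2 y) <= x) -> 0 <= x ->
  dominated x t.
Proof.
move=> hx x0; apply: le_trans (overlap_le1 _ _ (vpow_pmf t hp)) _.
have hP2 := vpow_pmf (copies t) hp2; have hQ2 := vpow_pmf (copies t) hq2.
rewrite -[X in X <= _](proj2 hP2); apply: ler_sum => i _; rewrite le_min lexx /=.
have P0 := proj1 hP2 i; have Q0 := proj1 hQ2 i.
rewrite -ler_pdivrMr// -[leLHS]lnK ?posrE ?divr_gt0// ler_expR.
rewrite ln_vpow; [|exact: (proj1 hp2)|exact: (proj1 hq2)].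
have h m j : vsum (fun y => ln (p2 y / q2 y)) m j <= x / c0 * m%:R.
  elim: m j => [|m IH] j /=; first by rewrite mulr0.
  rewrite -natr1 mulrDr mulr1 addrC lerD// ler_pdivlMr// mulrC; exact: hx.
apply: le_trans (h _ _) _.
apply: (@le_trans _ _ (x / c0 * (c0 * t%:R))).
  by rewrite ler_wpM2l ?copies_le// divr_ge0// ltW.
by rewrite mulrA divfK// gt_eqF.
Qed.

End Local.
End Overlap.

(** * Uniformity over all thresholds, and Blackwell's theorem *)

Section LargeSample.
Variable R : realType.

Lemma exists_left_of (x y : R) (P : R -> Prop) : y < x -> (\forall a \near dnbhs x, P a)%classic ->
  exists a, y < a < x /\ P a.
Proof.
move=> yx; rewrite near_withinE => /nbhs_ballP[d /= d0 hd].
pose e := Num.min d (x - y) / 2.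
have m0 : 0 < Num.min d (x - y) by rewrite lt_min d0 subr_gt0.
have e0 : 0 < e by rewrite divr_gt0.
have ed : e < d.
  by rewrite ltr_pdivrMr// (le_lt_trans (_ : _ <= d)) ?ge_min ?lexx// ltr_pMr// ltr1n.
have ey : e < x - y.
  rewrite ltr_pdivrMr// (le_lt_trans (_ : _ <= x - y)) ?ge_min ?lexx ?orbT// ltr_pMr ?subr_gt0//.
  by rewrite ltr1n.
exists (x - e); split; first by apply/andP; split; lra.
apply: hd; last by rewrite lt_eqF//; lra.
by rewrite /ball /= opprB addrC subrK ger0_norm// ltW.
Qed.

Lemma lnQcE (I : finType) a (p q : I -> R) : a != 1 -> ln (Qc a p q) = (a - 1) * cD a p q.
Proof. by move=> a1; rewrite /cD mulrA divff ?mul1r// subr_eq0. Qed.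

Lemma lnQc_ge_point (I : finType) a (p q : I -> R) y : pmf p -> pmf q ->
  ln (p y) + (a - 1) * ln (p y / q y) <= ln (Qc a p q).
Proof.
move=> hp hq; have p0 := proj1 hp y.
rewrite -ler_expR lnK ?posrE ?Qc_gt0// expRD lnK ?posrE// Qc_exp// (bigD1 y)//= lerDl.
by apply: sumr_ge0 => i _; rewrite mulr_ge0 ?expR_ge0// ltW// (proj1 hp).
Qed.

(* [exceeds c] : the Renyi divergences of order [a >= 1/2]; orders [a < 1/2] follow by
   exchanging the two arguments. *)
Definition exceeds n1 n2 (c : R) (p q : 'I_n1 -> R) (p2 q2 : 'I_n2 -> R) :=
  forall a, 2^-1 <= a -> a != 1 -> c * cD a p2 q2 <= cD a p q.

Section OneSide.
Variables (n1 n2 : nat) (p q : 'I_n1 -> R) (p2 q2 : 'I_n2 -> R) (c c0 : R).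
Hypotheses (hp : pmf p) (hq : pmf q) (hp2 : pmf p2) (hq2 : pmf q2).
Hypotheses (c00 : 0 < c0) (c0c : c0 < c) (Hex : exceeds c p q p2 q2).
Hypothesis K0 : 0 < cD 2^-1 p2 q2.

Let half1 : 2^-1 < 1 :> R. Proof. by rewrite invf_lt1// ltr1n. Qed.

Lemma cD_ge_half a : 2^-1 <= a -> a != 1 -> cD 2^-1 p2 q2 <= cD a p2 q2.
Proof. by move=> ha a1; apply: cD_mono => //; rewrite lt_eqF. Qed.

(** A slack independent of the order, because the target divergence is smallest at order 1/2. *)
Lemma cD_gap a : 2^-1 <= a -> a != 1 ->
  (c - c0) * cD 2^-1 p2 q2 <= cD a p q - c0 * cD a p2 q2.
Proof.
move=> ha a1; have := Hex ha a1; have := cD_ge_half ha a1; have : 0 <= c - c0 by rewrite subr_ge0 ltW.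
nra.
Qed.

Lemma KL_gap : c * KL p2 q2 <= KL p q.
Proof.
have h1 : ((fun a => c * cD a p2 q2) @ dnbhs (1 : R) --> c * KL p2 q2)%classic.
  by apply: cvgM; [exact: cvg_cst|exact: cD_cvg1].
apply: (ler_cvg_to h1 (cD_cvg1 hp hq)).
near=> a; apply: Hex; last by near: a; exact: nbhs_dnbhs_neq.
near: a; apply: nbhs_dnbhs; near=> a; apply/ltW.
by near: a; exact: lt_nbhsr.
Unshelve. all: by end_near.
Qed.

Lemma KL2_gt0 : 0 < KL p2 q2.
Proof. by apply: lt_le_trans K0 _; exact: cD_le_KL. Qed.

(** Either the slope exceeds all target ratios, or some order above 1 has a tilted mean just above
    the slope, found by the intermediate value theorem; then [dominated_above] applies. *)
Lemma dominated_high a : KL p q <= a ->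
  (\forall x \near a & t \near \oo, dominated p q p2 q2 c0 x t)%classic.
Proof.
move=> ha; have KLc := KL_gap; have K2 := KL2_gt0.
have a0 : 0 < a by apply: lt_le_trans ha; apply: lt_le_trans KLc; rewrite mulr_gt0// (lt_trans c00).
have [i0 _] := pmf_inh hp2.
case: (@arg_maxP _ _ _ i0 predT (fun y => ln (p2 y / q2 y)) isT) => y _ ymax.
have [ylt|yge] := ltP (c0 * ln (p2 y / q2 y)) a.
  near=> x t; apply: dominated_outside => //=.
    move=> z; apply: (@le_trans _ _ (c0 * ln (p2 y / q2 y))).
      by rewrite ler_wpM2l ?(ltW c00)//; exact: ymax.
    by apply/ltW; near: x; exact: lt_nbhsr.
  by apply/ltW; near: x; exact: lt_nbhsr.
set l := ln _ in yge ymax; have l0 : 0 < l by rewrite -(pmulr_rgt0 _ c00) (lt_le_trans a0).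
have c_0 : 0 < c by exact: lt_trans c0c.
have cc0 : 0 < c - c0 by rewrite subr_gt0.
(* At order 1 + u the target divergence is at least l + ln (p2 y) / u, and [u] is large enough for c
   times this to exceed c0 l, hence also the slope [a]. *)
pose u := 1 + c * `|ln (p2 y)| / ((c - c0) * l).
have u1 : 1 <= u by rewrite lerDl divr_ge0 ?mulr_ge0// ltW.
have u0 : 0 < u by exact: lt_le_trans u1.
pose a0' := 1 + u; have a0'1 : 1 < a0' by rewrite ltrDl.
have a0'h : 2^-1 <= a0' by rewrite ltW// (lt_trans half1).
have a0'n : a0' != 1 by rewrite gt_eqF.
have big : a < tmean a0' p q.
  apply: lt_le_trans (cD_le_tmean hp hq a0'1).
  apply: lt_le_trans (Hex a0'h a0'n); apply: le_lt_trans yge _.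
  have := lnQc_ge_point a0' y hp2 hq2; rewrite (lnQcE _ _ a0'n) -/l.
  rewrite (_ : a0' - 1 = u); last by rewrite /a0' addrC addKr.
  move=> h; have hl : - `|ln (p2 y)| <= ln (p2 y) by rewrite lerNl -normrN ler_norm.
  have h2 : u * ((c - c0) * l) = (c - c0) * l + c * `|ln (p2 y)|.
    by rewrite /u mulrDl mul1r divfK// gt_eqF// mulr_gt0.
  have h3 : 0 < (c - c0) * l by rewrite mulr_gt0.
  rewrite -(ltr_pM2l u0) mulrCA [ltRHS]mulrCA.
  have h4 := ler_wpM2l (ltW c_0) h.
  have h5 := ler_wpM2l (ltW c_0) hl.
  by apply: lt_le_trans h4; lra.
pose e := (c - c0) * cD 2^-1 p2 q2; have e0 : 0 < e by rewrite mulr_gt0.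
(* The tilted mean must exceed [a] strictly, yet by no more than half of the slack [e]; it must also
   stay below the mean reached at order [a0']. *)
pose b := a + Num.min (e / 2) ((tmean a0' p q - a) / 2).
have ba : a < b by rewrite ltrDl lt_min !divr_gt0// subr_gt0.
have be : b - a <= e / 2 by rewrite /b addrC addKr ge_min lexx.
have bt : b < tmean a0' p q.
  have : b - a <= (tmean a0' p q - a) / 2 by rewrite /b addrC addKr ge_min lexx orbT.
  lra.
have [al] : exists2 al, al \in `[1, a0']%R & tmean al p q = b.
  apply: IVT; first exact: ltW.
    by apply: continuous_subspaceT => z; exact: tmean_continuous.
  rewrite (tmean1 _ hp); have [_|] := leP (KL p q) (tmean a0' p q); first by rewrite (ltW bt) andbT; lra.
  by lra.
rewrite in_itv /= => /andP[al1 _] alb.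
have {}al1 : 1 < al.
  rewrite lt_neqAle al1 andbT; apply/eqP => al1'; move: alb; rewrite -al1' (tmean1 _ hp); lra.
have aln : al != 1 by rewrite gt_eqF.
have alh : 2^-1 <= al by rewrite ltW// (lt_trans half1).
have al10 : 0 < al - 1 by rewrite subr_gt0.
apply: (@dominated_above _ _ _ _ _ _ _ _ hp hq hp2 hq2 c00 al) => //.
- by rewrite alb.
- by rewrite lnQcE// mulr_ge0 ?(ltW al10)// (le_trans (ltW K0))// cD_ge_half.
- rewrite !lnQcE// alb [c0 * _]mulrCA -mulrBr ltr_pM2l//.
  by apply: lt_le_trans (cD_gap alh aln); rewrite -/e; lra.
Unshelve. all: by end_near.
Qed.

(** Divided by 1 - al, the condition of [dominated_below] tends to a < KL p q as al tends to 1, so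
    an order just below 1 works. *)
Lemma dominated_mid a : c0 * KL p2 q2 <= a < KL p q ->
  (\forall x \near a & t \near \oo, dominated p q p2 q2 c0 x t)%classic.
Proof.
move=> /andP[a1 a2].
have lim : ((fun al => cD al p q + c0 * tmean al p2 q2) @ dnbhs (1 : R) -->
    KL p q + c0 * KL p2 q2)%classic.
  apply: cvgD; first exact: cD_cvg1.
  apply: cvgM; first exact: cvg_cst.
  rewrite -(tmean1 q2 hp2); apply: cvg_trans (tmean_continuous hp2 hq2 (x := 1)).
  by apply: cvg_app; exact: nbhs_dnbhs.
have /(exists_left_of ltr01)[al [/andP[al0 al1] hal]] :
    (\forall al \near dnbhs (1 : R), a + c0 * KL p2 q2 < cD al p q + c0 * tmean al p2 q2)%classic.
  apply: (cvgr_gt _ lim); lra.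
have aln : al != 1 by rewrite lt_eqF.
have M2 := tmean_le_KL hp2 hq2 al1; have D2 := cD_le_KL hp2 hq2 al1.
apply: (@dominated_below _ _ _ _ _ _ _ _ hp hq hp2 hq2 c00 al); rewrite ?al0 ?al1//.
  by apply: le_trans a1; rewrite ler_wpM2l// ltW.
rewrite !lnQcE// [ltRHS](_ : _ = (1 - al) * (cD al p q - c0 * cD al p2 q2)); last by ring.
rewrite ltr_pM2l ?subr_gt0//.
have : c0 * cD al p2 q2 <= c0 * KL p2 q2 by rewrite ler_wpM2l// ltW.
lra.
Qed.

End OneSide.

Lemma dominated_sym n1 n2 (p q : 'I_n1 -> R) (p2 q2 : 'I_n2 -> R) (c0 x : R) t :
  dominated q p q2 p2 c0 (- x) t -> dominated p q p2 q2 c0 x t.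
Proof.
rewrite /dominated mulNr expRN => h.
by rewrite !(overlap_swap _ _ (expR_gt0 (x * t%:R))) ler_wpM2l ?expR_ge0.
Qed.

(** Slopes from c0 KL(p2, q2) upwards are covered by the previous lemmas, those up to -c0 KL(q2, p2)
    by the same after exchanging the laws. In between, some order in (0, 1) centres the tilted
    target law exactly at the slope, and the condition of [dominated_below] reduces to the uniform
    gap. *)
Lemma dominated_near n1 n2 (p q : 'I_n1 -> R) (p2 q2 : 'I_n2 -> R) (c c0 a : R) :
  pmf p -> pmf q -> pmf p2 -> pmf q2 -> 0 < c0 -> c0 < c ->
  exceeds c p q p2 q2 -> exceeds c q p q2 p2 -> 0 < cD 2^-1 p2 q2 ->
  (\forall x \near a & t \near \oo, dominated p q p2 q2 c0 x t)%classic.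
Proof.
move=> hp hq hp2 hq2 c00 c0c H1 H2 K0.
have h2 : 1 - 2^-1 = 2^-1 :> R by field.
have K0' : 0 < cD 2^-1 q2 p2 by move: K0; rewrite /cD -{2}h2 Qc_swap.
have up n n' (p' q' : 'I_n -> R) (p2' q2' : 'I_n' -> R) (a' : R) : pmf p' -> pmf q' -> pmf p2' -> pmf q2' ->
    exceeds c p' q' p2' q2' -> 0 < cD 2^-1 p2' q2' -> c0 * KL p2' q2' <= a' ->
    (\forall x \near a' & t \near \oo, dominated p' q' p2' q2' c0 x t)%classic.
  move=> hp' hq' hp2' hq2' H' K' a1'.
  have [h|h] := leP (KL p' q') a'; first exact: (@dominated_high _ _ _ _ _ _ c).
  by apply: dominated_mid => //; rewrite a1'.
have [a1|a1] := leP (c0 * KL p2 q2) a; first exact: up.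
have [a3|a3] := leP (c0 * KL q2 p2) (- a).
  have := up _ _ _ _ _ _ _ hq hp hq2 hp2 H2 K0' a3.
  move=> [[U V] [/= U1 V1] UV]; exists ([set x | U (- x)]%classic, V) => /=.
    split => //; have oc : ((fun x : R => - x) @ a --> - a)%classic by apply: cvgN; exact: cvg_id.
    exact: (oc U U1).
  by move=> -[x t] [/= Ux Vt]; apply: dominated_sym; exact: (UV (- x, t)).
have [al] : exists2 al, al \in `[0, 1]%R & tmean al p2 q2 = a / c0.
  apply: IVT => //.
    by apply: continuous_subspaceT => z; exact: tmean_continuous.
  have -> : tmean 0 p2 q2 = - KL q2 p2.
    by rewrite -(tmean1 _ hq2) -{1}(subrr 1) tmean_swap// opprK.
  rewrite (tmean1 _ hp2) ge_min le_max !ler_pdivlMr// !ler_pdivrMr// mulNr.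
  by apply/andP; split; apply/orP; [left|right]; rewrite mulrC; lra.
rewrite in_itv /= => /andP[al0 al1] alb.
have aE : c0 * tmean al p2 q2 = a by rewrite alb mulrC divfK// gt_eqF.
have {}al0 : 0 < al.
  rewrite lt_neqAle al0 andbT; apply/eqP => e; move: aE.
  rewrite -e -(subrr 1) tmean_swap// (tmean1 _ hq2); lra.
have {}al1 : al < 1.
  rewrite lt_neqAle al1 andbT; apply/eqP => e; move: aE.
  rewrite e (tmean1 _ hp2); lra.
apply: (@dominated_below _ _ _ _ _ _ _ _ hp hq hp2 hq2 c00 al); rewrite ?al0 ?al1 ?aE//.
rewrite subrr mulr0.
have cc : 0 < c - c0 by rewrite subr_gt0.
have [h|h] := leP 2^-1 al.
  have aln : al != 1 by rewrite lt_eqF.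
  have := cD_gap hp2 hq2 c0c H1 h aln; have e0 := mulr_gt0 cc K0.
  by rewrite !lnQcE//; nra.
have aln : 1 - al != 1 by rewrite lt_eqF// gtrBl.
have h' : 2^-1 <= 1 - al by lra.
have := cD_gap hq2 hp2 c0c H2 h' aln; have e0 := mulr_gt0 cc K0'.
by rewrite -!(Qc_swap al) !lnQcE//; nra.
Qed.

(** [B] bounds c0 times every target log-ratio in absolute value, so slopes outside [-B, B] are
    trivial; compactness of this interval gives one [t] for all the others. *)
Theorem large_sample n1 n2 (p q : 'I_n1 -> R) (p2 q2 : 'I_n2 -> R) (c c0 : R) :
  pmf p -> pmf q -> pmf p2 -> pmf q2 -> 0 < c0 -> c0 < c ->
  exceeds c p q p2 q2 -> exceeds c q p q2 p2 -> 0 < cD 2^-1 p2 q2 ->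
  (\forall t \near \oo, forall s, 0 < s ->
   overlap s (vpow p t) (vpow q t) <=
   overlap s (vpow p2 (copies c0 t)) (vpow q2 (copies c0 t)))%classic.
Proof.
move=> hp hq hp2 hq2 c00 c0c H1 H2 K0.
pose B : R := \sum_y `|c0 * ln (p2 y / q2 y)|.
have yB y : `|c0 * ln (p2 y / q2 y)| <= B.
  by rewrite /B (bigD1 y)//= lerDl sumr_ge0.
have B0 : 0 <= B by exact: sumr_ge0.
have near_cov := (compact_near_coveringP _).1 (@segment_compact R (- B) B).
have loc : (forall x : R, `[(- B), B] x -> \forall x' \near x & t \near \oo,
    dominated p q p2 q2 c0 x' t)%classic.
  by move=> x _; exact: (dominated_near _ hp hq hp2 hq2 c00 c0c H1 H2 K0).
have H := near_cov nat \oo%classic (fun t x => dominated p q p2 q2 c0 x t) _ loc.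
near=> t => s s0.
have t0 : 0 < t%:R :> R by near: t; exact: nbhs_infty_gtr.
pose x := ln s / t%:R.
have -> : s = expR (x * t%:R) by rewrite /x divfK ?gt_eqF// lnK.
suff : dominated p q p2 q2 c0 x t by [].
have [xB|Bx] := leP x B; last first.
  apply: dominated_outside => //; last by rewrite ltW// (le_lt_trans B0).
  by move=> y; rewrite (le_trans (ler_norm _))// (le_trans (yB y))// ltW.
have [xB'|Bx] := leP (- B) x; last first.
  apply: dominated_sym; apply: dominated_outside => //.
    move=> y; apply: (@le_trans _ _ B); last by rewrite lerNr ltW.
    apply: le_trans (yB y); rewrite -normrN -mulrN -lnV ?posrE ?divr_gt0 ?(proj1 hp2) ?(proj1 hq2)//.
    by rewrite invf_div ler_norm.
  by rewrite lerNr oppr0 ltW// (lt_le_trans Bx)// oppr_le0.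
have Ht : forall x, `[(- B), B]%classic x -> dominated p q p2 q2 c0 x t by near: t; exact: H.
by apply: Ht; rewrite /= in_itv /= xB' xB.
Unshelve. all: by end_near.
Qed.

(* Likelihood-ratio laws under [Q] and [Q'] are compared: a martingale coupling of
   them is exactly a stochastic map transporting both measures. *)
Lemma blackwell n1 n2 (P Q : 'I_n1 -> R) (P' Q' : 'I_n2 -> R) :
  pmf P -> pmf Q -> pmf P' -> pmf Q' ->
  (forall s, 0 < s -> overlap s P Q <= overlap s P' Q') ->
  exists W : 'I_n1 -> 'I_n2 -> R,
    [/\ (forall i j, 0 <= W i j), (forall i, \sum_j W i j = 1),
        (forall j, \sum_i W i j * P i = P' j) & (forall j, \sum_i W i j * Q i = Q' j)].
Proof.
move=> [P0 P1] [Q0 Q1] [P'0 P'1] [Q'0 Q'1] h.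
have QP n (A B : 'I_n -> R) s : (forall i, 0 < B i) ->
    \sum_i B i * pospart (A i / B i - s) = \sum_i pospart (A i - s * B i).
  move=> B0; apply: eq_bigr => i _; rewrite /pospart maxr_pMr ?ltW// mulr0.
  by rewrite mulrBr mulrCA divff ?gt_eqF// mulr1 [s * _]mulrC.
have tot n (A B : 'I_n -> R) : (forall i, 0 < B i) -> \sum_i B i * (A i / B i) = \sum_i A i.
  by move=> B0; apply: eq_bigr => i _; rewrite mulrCA divff ?gt_eqF// mulr1.
have [|T [T0 Tu Tv Tr]] := @coupling_exists R _ _ (fun i => P i / Q i) (fun j => P' j / Q' j) Q Q'.
  split => [i|j|||s]; [exact: ltW|exact: ltW|by rewrite Q1 Q'1|by rewrite !tot// P1 P'1|].
  rewrite !QP//; have [s0|s0] := ltP 0 s.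
    by rewrite !hockey_overlap P1 P'1; apply: lerB => //; exact: h.
  (* For s <= 0 the hinge is affine on positive ratios, so both sides coincide. *)
  have pos n (A B : 'I_n -> R) : (forall i, 0 < A i) -> (forall i, 0 < B i) ->
      \sum_i pospart (A i - s * B i) = \sum_i A i - s * \sum_i B i.
    move=> A0 B0; rewrite mulr_sumr -sumrB; apply: eq_bigr => i _.
    rewrite pospart_id// subr_ge0 (le_trans _ (ltW (A0 i)))//.
    by rewrite mulr_le0_ge0// ltW.
  by rewrite !pos// P1 P'1 Q1 Q'1.
exists (fun i j => T i j / Q i); split.
- by move=> i j; rewrite divr_ge0// ltW.
- by move=> i; rewrite -mulr_suml Tu divff// gt_eqF.
- move=> j; have := Tr j; rewrite mulrCA divff ?gt_eqF// mulr1 => <-.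
  by apply: eq_bigr => i _; rewrite mulrAC mulrA.
- by move=> j; rewrite -[RHS]Tv; apply: eq_bigr => i _; rewrite divfK// gt_eqF.
Qed.

End LargeSample.

(** * Spectral decompositions *)

Section Hermitian.
Variable R : realType.
Local Notation C := R[i].
Implicit Types (z : C) (x : R).

Lemma cconjE z : cconj z = (z^*)%R.
Proof. by case: z => a b. Qed.

Definition nsq z : R := complex.Re z ^+ 2 + complex.Im z ^+ 2.

Lemma nsq_ge0 z : 0 <= nsq z. Proof. by rewrite addr_ge0 ?sqr_ge0. Qed.

Lemma rC_nsq z : rC (nsq z) = z * cconj z.
Proof. by case: z => a b; rewrite /rC /nsq /= /cconj /=; congr Complex; ring. Qed.

Lemma nsqM z1 z2 : nsq (z1 * z2) = nsq z1 * nsq z2.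
Proof. by case: z1 z2 => a b [c d]; rewrite /nsq /=; ring. Qed.

Lemma nsq_rC x : nsq (rC x) = x ^+ 2.
Proof. by rewrite /nsq /rC /= expr0n addr0. Qed.

Lemma nsq_eq0 z : nsq z = 0 -> z = 0.
Proof.
case: z => a b /eqP; rewrite /nsq /= paddr_eq0 ?sqr_ge0// !sqrf_eq0.
by move=> /andP[/eqP-> /eqP->].
Qed.

Lemma rCE x : rC x = (x%:C)%C. Proof. by []. Qed.
Lemma rC0 : rC (0 : R) = 0. Proof. by []. Qed.
Lemma rC1 : rC (1 : R) = 1. Proof. by []. Qed.
Lemma rCM x y : rC (x * y) = rC x * rC y. Proof. by rewrite !rCE rmorphM. Qed.
Lemma rC_sum (I : finType) (f : I -> R) : rC (\sum_i f i) = \sum_i rC (f i).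
Proof. by rewrite rCE rmorph_sum. Qed.
Lemma rC_inj : injective (@rC R). Proof. by move=> x y []. Qed.
Lemma rC_ge0 x : (0 <= rC x) = (0 <= x). Proof. by rewrite rCE ler0c. Qed.
Lemma cconj_rC x : cconj (rC x) = rC x. Proof. by rewrite /cconj /= oppr0. Qed.
Lemma Re_rC x : complex.Re (rC x) = x. Proof. by []. Qed.
Lemma cconjK z : cconj (cconj z) = z. Proof. by rewrite !cconjE conjCK. Qed.

Lemma Re_sum (I : finType) (f : I -> C) : complex.Re (\sum_i f i) = \sum_i complex.Re (f i).
Proof.
have e (s : seq I) : complex.Re (\sum_(i <- s) f i) = \sum_(i <- s) complex.Re (f i).
  elim: s => [|a s IH]; first by rewrite !big_nil.
  by rewrite !big_cons -IH; case: (f a) (\sum_(_ <- _) _) => ? ? [].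
exact: e.
Qed.

Lemma Re_cconj z : complex.Re (cconj z) = complex.Re z. Proof. by []. Qed.
Lemma Re_rCM x z : complex.Re (rC x * z) = x * complex.Re z.
Proof. by case: z => a b; rewrite /= mul0r subr0. Qed.

Lemma adjE m n (A : 'M[C]_(m, n)) : adj A = (map_mx Num.conj A^T)%R.
Proof. by apply/matrixP => i j; rewrite !mxE cconjE. Qed.

Lemma adj_entry m n (A : 'M[C]_(m, n)) i j : adj A i j = cconj (A j i).
Proof. by rewrite !mxE. Qed.

Lemma adjK m n (A : 'M[C]_(m, n)) : adj (adj A) = A.
Proof. by apply/matrixP => i j; rewrite !adj_entry cconjK. Qed.

Lemma adjM m n p (A : 'M[C]_(m, n)) (B : 'M[C]_(n, p)) : adj (A *m B) = adj B *m adj A.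
Proof. by rewrite !adjE trmx_mul map_mxM. Qed.

Lemma adjD m n (A B : 'M[C]_(m, n)) : adj (A + B) = adj A + adj B.
Proof. by rewrite !adjE linearD map_mxD. Qed.

Lemma adjN m n (A : 'M[C]_(m, n)) : adj (- A) = - adj A.
Proof. by rewrite !adjE linearN map_mxN. Qed.

Lemma adjZ m n c (A : 'M[C]_(m, n)) : adj (c *: A) = cconj c *: adj A.
Proof. by rewrite !adjE linearZ map_mxZ cconjE. Qed.

Lemma adj1 n : adj (1%:M : 'M[C]_n) = 1%:M.
Proof. by rewrite adjE trmx1 map_mx1. Qed.

Lemma adj_sum m n (I : finType) (A : I -> 'M[C]_(m, n)) : adj (\sum_i A i) = \sum_i adj (A i).
Proof. by rewrite adjE linear_sum raddf_sum; apply: eq_bigr => i _; rewrite adjE. Qed.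

Lemma adj_tens m n p q (A : 'M[C]_(m, n)) (B : 'M[C]_(p, q)) : adj (A *t B) = adj A *t adj B.
Proof. by rewrite !adjE trmx_tens map_mxT. Qed.

Lemma unitary_adj n (U : 'M[C]_n) : unitary U -> adj U *m U = 1%:M.
Proof. exact: mulmx1C. Qed.

Lemma unitaryV n (U : 'M[C]_n) : unitary U -> unitary (adj U).
Proof. by move=> hU; rewrite /unitary adjK unitary_adj. Qed.

Lemma unitaryM n (U V : 'M[C]_n) : unitary U -> unitary V -> unitary (U *m V).
Proof.
move=> hU hV; rewrite /unitary adjM mulmxA -[U *m V *m _]mulmxA.
by rewrite (_ : V *m adj V = 1%:M)// mulmx1.
Qed.

Lemma unitary1 n : unitary (1%:M : 'M[C]_n).
Proof. by rewrite /unitary adj1 mulmx1. Qed.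

Definition rdiag n (p : 'I_n -> R) : 'M[C]_n := diag_mx (\row_i rC (p i)).
Definition sdiag n (U : 'M[C]_n) (p : 'I_n -> R) : 'M[C]_n := U *m rdiag p *m adj U.

Lemma rdiagE n (p : 'I_n -> R) i j : rdiag p i j = rC (p i) *+ (i == j).
Proof. by rewrite !mxE. Qed.

Lemma adj_rdiag n (p : 'I_n -> R) : adj (rdiag p) = rdiag p.
Proof.
apply/matrixP => i j; rewrite adj_entry !rdiagE eq_sym.
by case: eqVneq => [->|]; rewrite ?mulr1n ?mulr0n ?cconj_rC// -rC0 cconj_rC.
Qed.

Lemma mul_rdiag n (p q : 'I_n -> R) : rdiag p *m rdiag q = rdiag (fun i => p i * q i).
Proof.
rewrite mulmx_diag; congr diag_mx; apply/rowP => i.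
by rewrite !mxE rCM.
Qed.

Lemma rdiag_mulr n m (A : 'M[C]_(m, n)) p i j : (A *m rdiag p) i j = A i j * rC (p j).
Proof. by rewrite mul_mx_diag !mxE. Qed.

Lemma rdiag_mull n m (A : 'M[C]_(n, m)) p i j : (rdiag p *m A) i j = rC (p i) * A i j.
Proof. by rewrite mul_diag_mx !mxE. Qed.

Lemma eq_rdiag n (p q : 'I_n -> R) : p =1 q -> rdiag p = rdiag q.
Proof. by move=> e; congr rdiag; apply/funext. Qed.

Lemma rdiag1 n (p : 'I_n -> R) : p =1 (fun=> 1) -> rdiag p = 1%:M.
Proof.
by move=> e; apply/matrixP => i j; rewrite rdiagE e mxE rC1; case: eqP.
Qed.

Lemma adj_sdiag n (U : 'M[C]_n) p : adj (sdiag U p) = sdiag U p.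
Proof. by rewrite /sdiag !adjM adjK adj_rdiag mulmxA. Qed.

Lemma mul_sdiag n (U : 'M[C]_n) p q : unitary U ->
  sdiag U p *m sdiag U q = sdiag U (fun i => p i * q i).
Proof.
move=> hU; rewrite /sdiag !mulmxA -[_ *m adj U *m U]mulmxA (unitary_adj hU) mulmx1.
by rewrite -[U *m _ *m _]mulmxA mul_rdiag.
Qed.

Lemma sdiag1 n (U : 'M[C]_n) p : unitary U -> p =1 (fun=> 1) -> sdiag U p = 1%:M.
Proof. by move=> hU e; rewrite /sdiag rdiag1// mulmx1. Qed.

Lemma tr_sdiag n (U : 'M[C]_n) p : unitary U -> \tr (sdiag U p) = rC (\sum_i p i).
Proof.
move=> hU; rewrite /sdiag mxtrace_mulC mulmxA (unitary_adj hU) mul1mx.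
by rewrite mxtrace_diag rC_sum; apply: eq_bigr => i _; rewrite mxE.
Qed.

Lemma retr_sdiag n (U : 'M[C]_n) p : unitary U -> retr (sdiag U p) = \sum_i p i.
Proof. by move=> hU; rewrite /retr tr_sdiag. Qed.

(** The intertwiner [W] of the two diagonal forms couples only equal eigenvalues, hence intertwines
    their images under [f] as well. This makes [mfun], which picks some decomposition by choice,
    computable in any eigenbasis. *)
Lemma sdiag_fun_unique n (U V : 'M[C]_n) p q (f : R -> R) : unitary U -> unitary V ->
  sdiag U p = sdiag V q -> sdiag U (f \o p) = sdiag V (f \o q).
Proof.
move=> hU hV e; pose W := adj V *m U.
have UU := unitary_adj hU; have VV := unitary_adj hV.
have W1 : W *m rdiag p = rdiag q *m W.
  have := congr1 (fun X => adj V *m X *m U) e.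
  rewrite /sdiag !mulmxA VV mul1mx -[_ *m adj U *m U]mulmxA UU mulmx1 => h.
  by rewrite /W h -!mulmxA.
have W2 : W *m rdiag (f \o p) = rdiag (f \o q) *m W.
  apply/matrixP => i j; have := congr1 (fun X : 'M[C]_n => X i j) W1.
  rewrite !rdiag_mulr !rdiag_mull /=; have [->|W0] := eqVneq (W i j) 0.
    by rewrite !mulr0 !mul0r.
  by rewrite mulrC => /(mulIf W0)/rC_inj ->; rewrite mulrC.
have := congr1 (fun X => V *m X *m adj U) W2.
rewrite /sdiag /W !mulmxA (_ : V *m adj V = 1%:M)// mul1mx => ->.
by rewrite -!mulmxA (_ : U *m adj U = 1%:M)// mulmx1.
Qed.

Lemma sdecP n (U : 'M[C]_n) p : unitary U ->
  exists2 Vq, sdec (sdiag U p) = Some Vq & unitary Vq.1 /\ sdiag U p = sdiag Vq.1 Vq.2.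
Proof.
move=> hU; rewrite /sdec; case: pselect => [h|[]]; last by exists (U, p).
by eexists; [reflexivity|case: (cid h) => x []].
Qed.

Lemma mfun_sdiag n (U : 'M[C]_n) p (f : R -> R) : unitary U ->
  Defs.mfun f (sdiag U p) = sdiag U (fun i => f (p i)).
Proof.
move=> hU; rewrite /Defs.mfun; have [[V q] -> [/= hV e]] := sdecP p hU.
by symmetry; exact: (sdiag_fun_unique f hU hV e).
Qed.

Lemma spectral_normal n (A : 'M[C]_n) : A *m adj A = adj A *m A ->
  exists (U : 'M[C]_n) (z : 'rV[C]_n), unitary U /\ A = U *m diag_mx z *m adj U.
Proof.
move=> hA; have /orthomx_spectralP e : A \is normalmx by apply/normalmxP; rewrite -adjE.
have hP := spectral_unitarymx A; set P := spectralmx A in e hP.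
have hP' : P *m adj P = 1%:M by rewrite adjE; exact/unitarymxP.
exists (adj P), (spectral_diag A); split.
  by rewrite /unitary adjK; exact: mulmx1C.
by rewrite adjK {1}e (invmx_unitary hP) adjE.
Qed.

Lemma spectral_hermitian n (A : 'M[C]_n) : adj A = A ->
  exists (U : 'M[C]_n) (p : 'I_n -> R), unitary U /\ A = sdiag U p.
Proof.
move=> hA; have [|U [z [hU e]]] := @spectral_normal _ A; first by rewrite hA.
exists U, (fun i => complex.Re (z 0 i)); split => //.
have zE : diag_mx z = adj U *m A *m U.
  have UU := unitary_adj hU.
  by rewrite e !mulmxA UU mul1mx -mulmxA UU mulmx1.
have zr i : z 0 i = rC (complex.Re (z 0 i)).
  have : adj (diag_mx z) = diag_mx z by rewrite zE !adjM adjK hA mulmxA.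
  move=> /(congr1 (fun X : 'M[C]_n => X i i)); rewrite adj_entry !mxE eqxx mulr1n.
  by case: (z 0 i) => a b [] h; rewrite /rC /=; congr Complex; lra.
rewrite {1}e /sdiag; congr (_ *m _ *m _); rewrite /rdiag; congr diag_mx.
by apply/rowP => i; rewrite mxE.
Qed.

(* [A + 'i B] is normal when the Hermitian matrices [A], [B] commute. *)
Lemma spectral_commuting n (A B : 'M[C]_n) : adj A = A -> adj B = B -> A *m B = B *m A ->
  exists (U : 'M[C]_n) (p q : 'I_n -> R), [/\ unitary U, A = sdiag U p & B = sdiag U q].
Proof.
move=> hA hB AB; pose ii : C := Complex 0 1.
have iiE : cconj ii = - ii by rewrite /cconj /ii /=; congr Complex; rewrite oppr0.
have ii2 : ii * ii = -1 by rewrite /ii; congr Complex; rewrite /=; ring.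
pose Z := A + ii *: B.
have aZ : adj Z = A - ii *: B by rewrite adjD adjZ hA hB iiE scaleNr.
have [|U [z [hU e]]] := @spectral_normal _ Z.
  rewrite aZ /Z; set X := ii *: B.
  have AX : X *m A = A *m X by rewrite -scalemxAl -scalemxAr AB.
  by rewrite mulmxDl mulmxBl !mulmxBr !mulmxDr AX addrA subrK opprD addrA addrK.
have eZ : adj Z = U *m diag_mx (map_mx (@cconj R) z) *m adj U.
  rewrite e !adjM adjK mulmxA; congr (_ *m _ *m _).
  apply/matrixP => i j; rewrite adj_entry !mxE eq_sym.
  by case: eqVneq => [->|]; rewrite ?mulr1n ?mulr0n//; rewrite -rC0 cconj_rC.
have two : (2 : C) != 0 by rewrite pnatr_eq0.
exists U, (fun i => complex.Re (z 0 i)), (fun i => complex.Im (z 0 i)); split => //.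
- have : A = 2^-1 *: (Z + adj Z).
    by rewrite aZ /Z addrACA subrr addr0 -[A + A]mulr2n -[A *+ 2]scaler_nat scalerA mulVf// scale1r.
  rewrite eZ {1}e -mulmxDl -mulmxDr => ->; rewrite /sdiag scalemxAl scalemxAr.
  congr (_ *m _ *m _); apply/matrixP => i j; rewrite !mxE.
  case: eqVneq => [_|]; rewrite ?mulr1n ?mulr0n; last by rewrite addr0 mulr0.
  apply: (mulfI two); rewrite mulrA mulfV// mul1r; case: (z 0 i) => a b.
  rewrite /rC mulr_natl mulr2n /cconj /=; congr Complex; ring.
- have k : - ii * 2^-1 * (2 * ii) = 1.
    rewrite (_ : _ * _ = - (ii * ii) * (2^-1 * 2)); last by ring.
    by rewrite ii2 opprK mul1r mulVf.
  have : B = (- ii * 2^-1) *: (Z - adj Z).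
    have -> : Z - adj Z = (2 * ii) *: B.
      by rewrite aZ /Z opprB addrC addrA subrK -scalerDl mulr_natl mulr2n.
    by rewrite scalerA k scale1r.
  rewrite eZ {1}e -mulmxBl -mulmxBr => ->; rewrite /sdiag scalemxAl scalemxAr.
  congr (_ *m _ *m _); apply/matrixP => i j; rewrite !mxE.
  case: eqVneq => [_|]; rewrite ?mulr1n ?mulr0n; last by rewrite subrr mulr0.
  have -> : z 0 i - cconj (z 0 i) = 2 * ii * rC (complex.Im (z 0 i)).
    case: (z 0 i) => x y; rewrite -mulrA mulr_natl mulr2n /rC /cconj /ii /=.
    by congr Complex; ring.
  by rewrite mulrA k mul1r.
Qed.

Lemma sdiag_tens m n (U : 'M[C]_m) (V : 'M[C]_n) p q :
  sdiag U p *t sdiag V q =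
  sdiag (U *t V) (fun k => p (mxtens_unindex k).1 * q (mxtens_unindex k).2).
Proof.
rewrite /sdiag adj_tens -!tensmx_mul; congr (_ *m _ *m _).
apply/matrixP => i j; case: (mxtens_indexP i) => i1 i2; case: (mxtens_indexP j) => j1 j2.
rewrite tensmxE !rdiagE mxtens_indexK /= rCM.
rewrite (inj_eq (can_inj (@mxtens_indexK m n))) xpair_eqE.
by case: eqVneq; case: eqVneq; rewrite ?mulr1n ?mulr0n ?mulr0 ?mul0r.
Qed.

Lemma unitary_tens m n (U : 'M[C]_m) (V : 'M[C]_n) : unitary U -> unitary V -> unitary (U *t V).
Proof.
move=> hU hV; rewrite /unitary adj_tens tensmx_mul hU hV.
apply/matrixP => i j; case: (mxtens_indexP i) => i1 i2; case: (mxtens_indexP j) => j1 j2.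
rewrite tensmxE !mxE (inj_eq (can_inj (@mxtens_indexK m n))) xpair_eqE.
by case: eqVneq; case: eqVneq; rewrite ?mulr1n ?mulr0n ?mulr0 ?mul0r ?mulr1.
Qed.

Lemma unitary_tpow n (U : 'M[C]_n) k : unitary U -> unitary (tpow U k).
Proof. by move=> hU; elim: k => [|k IH] /=; [exact: unitary1|exact: unitary_tens]. Qed.

Lemma sdiag_tpow n (U : 'M[C]_n) p k : tpow (sdiag U p) k = sdiag (tpow U k) (vpow p k).
Proof.
elim: k => [|k IH] /=; last by rewrite IH sdiag_tens.
by rewrite /sdiag rdiag1// !mul1mx adj1.
Qed.

Lemma tpowM n (A B : 'M[C]_n) k : tpow (A *m B) k = tpow A k *m tpow B k.
Proof. by elim: k => [|k IH] /=; [rewrite mulmx1|rewrite IH tensmx_mul]. Qed.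

Lemma adj_tpow n (A : 'M[C]_n) k : adj (tpow A k) = tpow (adj A) k.
Proof. by elim: k => [|k IH] /=; [rewrite adj1|rewrite adj_tens IH]. Qed.

Lemma tr_tens m n (A : 'M[C]_m) (B : 'M[C]_n) : \tr (A *t B) = \tr A * \tr B.
Proof.
rewrite /mxtrace sum_mxtens mulr_suml; apply: eq_bigr => i _.
by rewrite mulr_sumr; apply: eq_bigr => j _; rewrite tensmxE.
Qed.

Lemma tpow_diag n (A : 'M[C]_n) (p : 'I_n -> R) k : (forall i, A i i = rC (p i)) ->
  forall i, tpow A k i i = rC (vpow p k i).
Proof.
move=> h; elim: k => [|k IH] i; first by rewrite mxE eqxx.
by case: (mxtens_indexP i) => i1 i2; rewrite tensmxE vpowS h IH rCM.
Qed.

End Hermitian.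

(** * Pinching and trace inequalities *)

Section QuadraticForms.
Variable R : realType.
Local Notation C := R[i].

Definition qf n (M : 'M[C]_n) (w : 'cV[C]_n) : R := complex.Re ((adj w *m M *m w) 0 0).

Lemma qf_ge0 n (M : 'M[C]_n) w : psd M -> 0 <= qf M w.
Proof. by move=> [_ /(_ w)]; rewrite lecE => /andP[_]. Qed.

Lemma adj_mul_self n (w : 'cV[C]_n) : (adj w *m w) 0 0 = rC (\sum_i nsq (w i 0)).
Proof. by rewrite mxE rC_sum; apply: eq_bigr => i _; rewrite adj_entry rC_nsq mulrC. Qed.

Lemma sdiag_form n (V : 'M[C]_n) x (w : 'cV[C]_n) :
  (adj w *m sdiag V x *m w) 0 0 = rC (\sum_k x k * nsq ((adj V *m w) k 0)).
Proof.
have -> : adj w *m sdiag V x *m w = adj (adj V *m w) *m rdiag x *m (adj V *m w).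
  by rewrite /sdiag adjM adjK !mulmxA.
rewrite mxE rC_sum; apply: eq_bigr => k _.
by rewrite rdiag_mulr adj_entry rCM rC_nsq; ring.
Qed.

Lemma qf_sdiag n (V : 'M[C]_n) x w : qf (sdiag V x) w = \sum_k x k * nsq ((adj V *m w) k 0).
Proof. by rewrite /qf sdiag_form. Qed.

Lemma psd_sdiag n (V : 'M[C]_n) x : (forall k, 0 <= x k) -> psd (sdiag V x).
Proof.
move=> x0; split; first exact: adj_sdiag.
move=> w; rewrite sdiag_form rC_ge0; apply: sumr_ge0 => k _.
by rewrite mulr_ge0 ?nsq_ge0.
Qed.

Lemma qf_col n (V : 'M[C]_n) x j : unitary V -> qf (sdiag V x) (col j V) = x j.
Proof.
move=> hV; rewrite qf_sdiag colE mulmxA (unitary_adj hV) mul1mx (bigD1 j)//= big1 => [|k kj].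
  by rewrite !mxE !eqxx /nsq /= expr0n expr1n !addr0 mulr1.
by rewrite !mxE (negPf kj) /nsq /= !expr0n addr0 mulr0.
Qed.

Lemma psd_spectral n (M : 'M[C]_n) : psd M ->
  exists (V : 'M[C]_n) x, [/\ unitary V, (forall k, 0 <= x k) & M = sdiag V x].
Proof.
move=> hM; have [V [x [hV e]]] := spectral_hermitian (proj1 hM).
exists V, x; split => // k.
by rewrite -(qf_col x k hV) -e qf_ge0.
Qed.

Lemma sqr_sum_le (T : finType) (f : T -> R) :
  (\sum_t f t) ^+ 2 <= #|T|%:R * \sum_t f t ^+ 2.
Proof.
pose S := \sum_t f t ^+ 2.
have -> : #|T|%:R * S = \sum_s \sum_t 2^-1 * (f s ^+ 2 + f t ^+ 2).
  have e s : \sum_t 2^-1 * (f s ^+ 2 + f t ^+ 2) = 2^-1 * (#|T|%:R * f s ^+ 2 + S).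
    by rewrite -mulr_sumr big_split /= sumr_const mulr_natl.
  rewrite (eq_bigr _ (fun s _ => e s)) -mulr_sumr big_split /= -mulr_sumr -/S.
  by rewrite sumr_const -[S *+ _]mulr_natl; field.
rewrite expr2 mulr_suml; apply: ler_sum => s _; rewrite mulr_sumr; apply: ler_sum => t _.
have := sqr_ge0 (f s - f t); nra.
Qed.

Lemma nsq_sum_le (T : finType) (z : T -> C) :
  nsq (\sum_t z t) <= #|T|%:R * \sum_t nsq (z t).
Proof.
rewrite /nsq Re_sum big_split /= mulrDr.
have -> : complex.Im (\sum_t z t) = \sum_t complex.Im (z t).
  have e (s : seq T) : complex.Im (\sum_(i <- s) z i) = \sum_(i <- s) complex.Im (z i).
    elim: s => [|a s IH]; first by rewrite !big_nil.
    by rewrite !big_cons -IH; case: (z a) (\sum_(_ <- _) _) => ? ? [].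
  exact: e.
by apply: lerD; exact: sqr_sum_le.
Qed.

Lemma qf_sum_le n (T : finType) (M : 'M[C]_n) (w : T -> 'cV[C]_n) : psd M ->
  qf M (\sum_t w t) <= #|T|%:R * \sum_t qf M (w t).
Proof.
move=> /psd_spectral[V [x [hV x0 ->]]].
rewrite qf_sdiag; under [X in _ * X]eq_bigr do rewrite qf_sdiag.
rewrite exchange_big /= mulr_sumr; apply: ler_sum => k _.
rewrite -mulr_sumr mulrCA ler_wpM2l// mulmx_sumr summxE.
exact: nsq_sum_le.
Qed.

(* The pinching inequality [M <= v P(M)], evaluated on a vector, in a basis where the
   pinched matrix is diagonal; [v = #|T|] bounds the number of eigenvalues [q i]. *)
Lemma pinching_le n (T : finType) (g : T -> R) (q : 'I_n -> R) (M : 'M[C]_n) (w : 'cV[C]_n) :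
  psd M -> (forall i, exists t, q i = g t) ->
  (forall i j, i != j -> q i = q j -> M i j = 0) ->
  qf M w <= #|T|%:R * \sum_i nsq (w i 0) * complex.Re (M i i).
Proof.
move=> hM /choice[b hb] hz.
(* The part of [w] supported on indices labelled [t]. Within one label [q] is constant, so [M] has
   no off-diagonal entries there; Cauchy-Schwarz over the labels costs the factor [#|T|]. *)
pose wt t : 'cV[C]_n := \col_i (w i 0 *+ (b i == t)).
have wE : w = \sum_t wt t.
  apply/matrixP => i j; rewrite ord1 summxE (bigD1 (b i))//= mxE eqxx mulr1n big1 ?addr0//.
  by move=> t /negPf bt; rewrite mxE eq_sym bt.
rewrite {1}wE; apply: le_trans (qf_sum_le _ hM) _; rewrite ler_wpM2l//.
have e t : qf M (wt t) = \sum_(i | b i == t) nsq (w i 0) * complex.Re (M i i).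
  rewrite /qf mxE Re_sum [RHS]big_mkcond; apply: eq_bigr => j _.
  rewrite mxE [wt t j 0]mxE; case: eqVneq => bj; last by rewrite mulr0n mulr0.
  rewrite (bigD1 j)//= big1 ?addr0 => [|i ij].
    by rewrite adj_entry mxE bj eqxx !mulr1n mulrAC [_ * w j 0]mulrC -rC_nsq Re_rCM.
  rewrite adj_entry mxE; case: eqVneq => bi; last by rewrite mulr0n -rC0 cconj_rC rC0 mul0r.
  by rewrite hz ?mulr0// !hb bi bj.
under eq_bigr do rewrite e.
by rewrite [leRHS](partition_big b xpredT).
Qed.

Lemma nsq_unitary_row n (V : 'M[C]_n) i : unitary V -> \sum_j nsq (V i j) = 1.
Proof.
move=> hV; apply: rC_inj; rewrite rC_sum rC1.
have := congr1 (fun X : 'M[C]_n => X i i) hV; rewrite !mxE eqxx mulr1n => <-.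
by apply: eq_bigr => j _; rewrite adj_entry rC_nsq.
Qed.

Lemma nsq_adj n m (V : 'M[C]_(n, m)) i j : nsq (adj V i j) = nsq (V j i).
Proof. by rewrite adj_entry /nsq /= sqrrN. Qed.

Lemma nsq_unitary_col n (V : 'M[C]_n) j : unitary V -> \sum_i nsq (V i j) = 1.
Proof.
move=> hV; rewrite -[RHS](nsq_unitary_row j (unitaryV hV)); apply: eq_bigr => i _.
by rewrite nsq_adj.
Qed.

Lemma sdiag_diagE n (V : 'M[C]_n) x i : sdiag V x i i = rC (\sum_j nsq (V i j) * x j).
Proof.
rewrite /sdiag mxE rC_sum; apply: eq_bigr => j _.
by rewrite rdiag_mulr adj_entry rCM rC_nsq; ring.
Qed.

Section TraceBounds.
Variables (n : nat) (V : 'M[C]_n) (x : 'I_n -> R).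
Hypotheses (hV : unitary V) (x0 : forall j, 0 < x j).
Let X := sdiag V x.
Let y i := complex.Re (X i i).

Lemma diag_gt0 i : 0 < y i.
Proof.
rewrite /y sdiag_diagE Re_rC; apply: sum_gt0 => //.
- by move=> j; exact: nsq_ge0.
- by rewrite nsq_unitary_row.
Qed.

(** Diagonal entries are averages of the eigenvalues with the doubly stochastic weights
    [nsq (V i j)]; Jensen's inequality does the rest. *)
Lemma peierls_ge a : 1 <= a -> \sum_i y i `^ a <= \sum_j x j `^ a.
Proof.
move=> a1; have -> : \sum_j x j `^ a = \sum_i \sum_j nsq (V i j) * x j `^ a.
  by rewrite exchange_big /=; apply: eq_bigr => j _; rewrite -mulr_suml nsq_unitary_col ?mul1r.
apply: ler_sum => i _; rewrite /y sdiag_diagE Re_rC.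
apply: jensen_ge => //; rewrite ?nsq_unitary_row ?a1//.
by move=> j; exact: nsq_ge0.
Qed.

Lemma peierls_le a : 0 <= a <= 1 -> \sum_j x j `^ a <= \sum_i y i `^ a.
Proof.
move=> a1; have -> : \sum_j x j `^ a = \sum_i \sum_j nsq (V i j) * x j `^ a.
  by rewrite exchange_big /=; apply: eq_bigr => j _; rewrite -mulr_suml nsq_unitary_col ?mul1r.
apply: ler_sum => i _; rewrite /y sdiag_diagE Re_rC.
apply: jensen_le => //; rewrite ?nsq_unitary_row//.
by move=> j; exact: nsq_ge0.
Qed.

Variable v : R.
Hypotheses (v0 : 0 < v) (hv : forall w, qf X w <= v * \sum_i nsq (w i 0) * y i).

(** Conversely, the hypothesis on an eigenvector bounds each eigenvalue by [v] times an average of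
    the diagonal entries, and Jensen applies with the transposed weights. *)
Lemma trace_le_diag a : 1 <= a -> \sum_j x j `^ a <= v `^ a * \sum_i y i `^ a.
Proof.
move=> a1; have a0 : 0 <= a by apply: le_trans a1.
apply: (@le_trans _ _ (\sum_j v `^ a * \sum_i nsq (V i j) * y i `^ a)).
  apply: ler_sum => j _.
  have xj : x j <= v * \sum_i nsq (V i j) * y i.
    rewrite -{1}(qf_col x j hV); apply: le_trans (hv _) _.
    by rewrite ler_wpM2l ?(ltW v0)//; apply: ler_sum => i _; rewrite mxE.
  have s0 : 0 < \sum_i nsq (V i j) * y i.
    apply: sum_gt0 => [i|i|]; [exact: nsq_ge0|exact: diag_gt0|].
    by rewrite nsq_unitary_col.
  apply: (@le_trans _ _ ((v * \sum_i nsq (V i j) * y i) `^ a)).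
    by rewrite ge0_ler_powR ?nnegrE ?(ltW (x0 j))// mulr_ge0 ?ltW.
  rewrite powRM ?(ltW v0) ?(ltW s0)// ler_wpM2l ?powR_ge0//.
  apply: jensen_ge; rewrite ?nsq_unitary_col ?a1//.
  - by move=> i; exact: nsq_ge0.
  - by move=> i; exact: diag_gt0.
rewrite -mulr_sumr ler_wpM2l ?powR_ge0// exchange_big /=.
by apply: ler_sum => i _; rewrite -mulr_suml nsq_unitary_row ?mul1r.
Qed.

(** X <= v D implies 1/D <= v/X, here tested on the j-th eigenvector of [X]. Evaluating the form at
    [w] = (1/D) V_j, and keeping only its component along V_j for the lower bound, avoids inverting
    operators. *)
Lemma diag_inv_le j : \sum_i nsq (V i j) / y i <= v / x j.
Proof.
set g := \sum_i _; pose w : 'cV[C]_n := \col_i (V i j * rC (y i)^-1).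
have g0 : 0 < g.
  apply: sum_gt0 => [i|i|]; [exact: nsq_ge0|by rewrite invr_gt0 diag_gt0|].
  by rewrite nsq_unitary_col.
have up : qf X w <= v * g.
  apply: le_trans (hv _) _; rewrite ler_wpM2l ?(ltW v0)//; apply: ler_sum => i _.
  rewrite mxE nsqM nsq_rC -mulrA ler_wpM2l ?nsq_ge0//.
  by rewrite expr2 -mulrA mulVf ?mulr1// gt_eqF ?diag_gt0.
have lo : x j * g ^+ 2 <= qf X w.
  rewrite qf_sdiag (bigD1 j)//= ler_wpDr//.
    by apply: sumr_ge0 => k _; rewrite mulr_ge0 ?nsq_ge0// ltW.
  rewrite (_ : (adj V *m w) j 0 = rC g) ?nsq_rC// mxE rC_sum.
  by apply: eq_bigr => i _; rewrite adj_entry mxE rCM rC_nsq; ring.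
have := le_trans lo up; rewrite expr2 mulrA ler_pM2r// => h.
by rewrite ler_pdivlMr// mulrC.
Qed.

(** In y^a = y y^(a-1) the first factor is expanded linearly in the eigenvalues; the sum over [i] of
    the second one is then controlled by concavity and [diag_inv_le]. *)
Lemma diag_le_trace a : 0 < a < 1 -> \sum_i y i `^ a <= v `^ (1 - a) * \sum_j x j `^ a.
Proof.
move=> /andP[a0 a1].
have b01 : 0 <= 1 - a <= 1 by apply/andP; split; lra.
have e i : y i `^ a = \sum_j nsq (V i j) * x j * (y i)^-1 `^ (1 - a).
  rewrite -mulr_suml; have -> : \sum_j nsq (V i j) * x j = y i by rewrite /y sdiag_diagE.
  rewrite powR_inv ?diag_gt0// -powRN -{2}[y i]powRr1 ?(ltW (diag_gt0 _))//.
  by rewrite -powRD ?(gt_eqF (diag_gt0 _)) ?implybT// opprB addrCA subrr addr0.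
under eq_bigr do rewrite e; rewrite exchange_big /= mulr_sumr.
apply: ler_sum => j _; have xj := x0 j.
apply: (@le_trans _ _ (x j * (\sum_i nsq (V i j) / y i) `^ (1 - a))).
  under eq_bigr do rewrite mulrAC mulrC.
  rewrite -mulr_sumr ler_wpM2l ?(ltW xj)//.
  apply: jensen_le; rewrite ?nsq_unitary_col//.
  - by move=> i; exact: nsq_ge0.
  - by move=> i; rewrite invr_gt0 diag_gt0.
apply: (@le_trans _ _ (x j * (v / x j) `^ (1 - a))).
  rewrite ler_wpM2l ?(ltW xj)// ge0_ler_powR ?diag_inv_le ?nnegrE//; last first.
  - by rewrite divr_ge0 ?ltW.
  - apply: sumr_ge0 => i _; rewrite divr_ge0 ?nsq_ge0// ltW//; exact: diag_gt0.
  - by case/andP: b01.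
rewrite powRM ?(ltW v0) ?invr_ge0 ?(ltW xj)// powR_inv//.
rewrite mulrCA ler_wpM2l ?powR_ge0// -powRN opprB -{1}[x j]powRr1 ?(ltW xj)//.
by rewrite -powRD ?(gt_eqF xj) ?implybT// addrCA subrr addr0.
Qed.

End TraceBounds.
End QuadraticForms.

(** * Data processing up to a constant *)

Section DataProcessing.
Variable R : realType.
Local Notation C := R[i].

Lemma form_col n m (N : 'M[C]_n) (Z : 'M[C]_(n, m)) j :
  (adj (col j Z) *m N *m col j Z) 0 0 = (adj Z *m N *m Z) j j.
Proof.
have -> : adj (col j Z) = row j (adj Z).
  by apply/matrixP => i k; rewrite adj_entry !mxE.
by rewrite -row_mul colE mulmxA -colE -row_mul !mxE.
Qed.

Section Level.
Variables (S : finType) (n n' : nat) (Z : S -> 'M[C]_(n, n')) (M : 'M[C]_n) (q : 'I_n -> R).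
Variable v : R.
Hypothesis hZ : \sum_s Z s *m adj (Z s) = 1%:M.
Hypothesis hM : psd M.
Hypothesis (v0 : 0 < v).
Let p i := complex.Re (M i i).
Hypothesis (p0 : forall i, 0 < p i) (q0 : forall i, 0 < q i).
Hypothesis hv : forall w, qf M w <= v * \sum_i nsq (w i 0) * p i.
Let p' j := \sum_s qf M (col j (Z s)).
Let q' j := \sum_s \sum_i nsq (Z s i j) * q i.
Hypothesis (p'0 : forall j, 0 < p' j) (q'0 : forall j, 0 < q' j).
Let W i j := \sum_s nsq (Z s i j).

Lemma kraus_weight_sum i : \sum_j W i j = 1.
Proof.
apply: rC_inj; rewrite /W exchange_big /= rC_sum rC1.
have := congr1 (fun X : 'M[C]_n => X i i) hZ; rewrite summxE [1%:M _ _]mxE eqxx mulr1n => <-.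
apply: eq_bigr => s _; rewrite mxE rC_sum.
by apply: eq_bigr => j _; rewrite adj_entry rC_nsq.
Qed.

Lemma kraus_weight_ge0 i j : 0 <= W i j.
Proof. by apply: sumr_ge0 => s _; exact: nsq_ge0. Qed.

Lemma kraus_output_q j : q' j = \sum_i W i j * q i.
Proof. by rewrite /q' exchange_big /=; apply: eq_bigr => i _; rewrite mulr_suml. Qed.

Lemma kraus_output_p j : p' j <= v * \sum_i W i j * p i.
Proof.
have -> : v * \sum_i W i j * p i = \sum_s v * \sum_i nsq (Z s i j) * p i.
  rewrite -mulr_sumr exchange_big /=; congr (_ * _).
  by apply: eq_bigr => i _; rewrite mulr_suml.
apply: ler_sum => s _; apply: le_trans (hv _) _.
by rewrite ler_wpM2l ?(ltW v0)//; apply: ler_sum => i _; rewrite mxE.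
Qed.

Lemma weight_col_gt0 j : 0 < \sum_i W i j.
Proof.
rewrite lt_neqAle eq_sym sumr_ge0 ?andbT; last by move=> i _; exact: kraus_weight_ge0.
apply/eqP => h; have := q'0 j; rewrite kraus_output_q big1 ?ltxx// => i _.
have /eqP := h; rewrite psumr_eq0; last by move=> k _; exact: kraus_weight_ge0.
by move=> /allP/(_ i (mem_index_enum i))/eqP ->; rewrite mul0r.
Qed.

(** [W] is a stochastic matrix sending [q] to [q'] exactly and [p] to an upper bound of [p'] up to
    the factor [v]. For a > 1 such a bound has the right direction, and joint convexity
    concludes. *)
Lemma dpi_level_gt1 a : 1 < a -> Qc a p' q' <= v `^ a * Qc a p q.
Proof.
move=> a1; have a0 : 0 <= a by apply/ltW/(lt_trans ltr01).
have -> : Qc a p q = \sum_j \sum_i W i j * (p i `^ a * q i `^ (1 - a)).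
  rewrite exchange_big /=; apply: eq_bigr => i _.
  by rewrite -mulr_suml kraus_weight_sum mul1r.
rewrite mulr_sumr; apply: ler_sum => j _.
have Wp : 0 < \sum_i W i j * p i by apply: sum_gt0; rewrite ?weight_col_gt0// => i; exact: kraus_weight_ge0.
apply: (@le_trans _ _ (v `^ a * ((\sum_i W i j * p i) `^ a * q' j `^ (1 - a)))).
  rewrite mulrA ler_wpM2r ?powR_ge0// -powRM ?(ltW v0) ?(ltW Wp)//.
  rewrite ge0_ler_powR ?nnegrE ?(ltW (p'0 j)) ?kraus_output_p// mulr_ge0// ltW//.
rewrite ler_wpM2l ?powR_ge0// kraus_output_q.
apply: perspective_ge; rewrite ?weight_col_gt0 ?(ltW a1)// => i; exact: kraus_weight_ge0.
Qed.

Section LowOrder.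
Variable om : 'I_n' -> R.
Hypothesis om0 : forall j, 0 < om j.
Let g i := \sum_j W i j / om j.

Lemma g_gt0 i : 0 < g i.
Proof.
apply: sum_gt0 => [j|j|]; rewrite ?invr_gt0//; first exact: kraus_weight_ge0.
by rewrite kraus_weight_sum.
Qed.

Let Dg : 'M[C]_n := rdiag (fun i => (g i)^-1).

Lemma qf_sub c (w u : 'cV[C]_n) : qf M (w - rC c *: u) =
  qf M w - 2 * c * complex.Re ((adj w *m M *m u) 0 0) + c ^+ 2 * qf M u.
Proof.
pose bf (x y : 'cV[C]_n) := (adj x *m M *m y) 0 0.
have bfBl x x' y : bf (x - x') y = bf x y - bf x' y.
  by rewrite /bf adjD adjN mulmxBl mulmxBl [LHS]mxE [X in _ + X]mxE.
have bfBr x y y' : bf x (y - y') = bf x y - bf x y'.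
  by rewrite /bf mulmxBr [LHS]mxE [X in _ + X]mxE.
have bfZl k x y : bf (rC k *: x) y = rC k * bf x y.
  by rewrite /bf adjZ cconj_rC -!scalemxAl [LHS]mxE.
have bfZr k x y : bf x (rC k *: y) = rC k * bf x y.
  by rewrite /bf -!scalemxAr [LHS]mxE.
have bfC x y : complex.Re (bf y x) = complex.Re (bf x y).
  rewrite /bf (_ : adj y *m M *m x = adj (adj x *m M *m y)) ?adj_entry ?Re_cconj//.
  by rewrite !adjM adjK (proj1 hM) mulmxA.
have ReB z1 z2 : complex.Re (z1 - z2) = complex.Re z1 - complex.Re z2 :> R.
  by case: z1 z2 => ? ? [].
have qfE x : qf M x = complex.Re (bf x x) by [].
rewrite !qfE -[(adj w *m M *m u) 0 0]/(bf w u); clearbody bf.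
rewrite bfBl !bfBr !bfZl !bfZr !ReB !Re_rCM bfC.
move: (complex.Re (bf w w)) (complex.Re (bf w u)) (complex.Re (bf u u)) => x y z.
ring.
Qed.

(* Expanding [0 <= sum_js om_j qf (w - (c / om_j) D w)] with [D = diag (1 / g)] and
   [c = 1 / v]: the resolution of identity turns the cross terms into [sum p / g], and
   the pinching inequality bounds the quadratic ones. *)
Lemma weighted_output_ge : v^-1 * \sum_i p i / g i <= \sum_j p' j * om j.
Proof.
pose w s j : 'cV[C]_n := col j (Z s).
have key s j : 0 <= om j * qf M (w s j) -
    2 * v^-1 * complex.Re ((adj (w s j) *m M *m (Dg *m w s j)) 0 0) +
    v^-1 ^+ 2 * (qf M (Dg *m w s j) / om j).
  have := qf_ge0 (w s j - rC (v^-1 / om j) *: (Dg *m w s j)) hM.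
  rewrite qf_sub => h; apply: le_trans (mulr_ge0 (ltW (om0 j)) h) _.
  move: (qf M _) (complex.Re _) (qf M _) => x y z.
  by rewrite le_eqVlt; apply/orP; left; apply/eqP; field; rewrite !gt_eqF.
have tot : 0 <= \sum_s \sum_j (om j * qf M (w s j) -
    2 * v^-1 * complex.Re ((adj (w s j) *m M *m (Dg *m w s j)) 0 0) +
    v^-1 ^+ 2 * (qf M (Dg *m w s j) / om j)).
  by apply: sumr_ge0 => s _; apply: sumr_ge0 => j _; exact: key.
have cross : \sum_s \sum_j complex.Re ((adj (w s j) *m M *m (Dg *m w s j)) 0 0) =
    \sum_i p i / g i.
  have e s : \sum_j complex.Re ((adj (w s j) *m M *m (Dg *m w s j)) 0 0) =
      complex.Re (\tr (adj (Z s) *m M *m Dg *m Z s)).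
    rewrite /mxtrace Re_sum; apply: eq_bigr => j _; congr complex.Re.
    by rewrite /w -[adj (Z s) *m M *m Dg]mulmxA -form_col !mulmxA.
  rewrite (eq_bigr _ (fun s _ => e s)) -Re_sum.
  have -> : \sum_s \tr (adj (Z s) *m M *m Dg *m Z s) = \tr (M *m Dg).
    under eq_bigr do rewrite -mulmxA -mulmxA mxtrace_mulC -mulmxA.
    rewrite -raddf_sum /= -mulmx_sumr.
    under eq_bigr do rewrite -mulmxA.
    by rewrite -mulmx_sumr hZ mulmx1.
  rewrite /mxtrace Re_sum; apply: eq_bigr => i _.
  by rewrite rdiag_mulr mulrC Re_rCM mulrC.
have quad : \sum_s \sum_j qf M (Dg *m w s j) / om j <= v * \sum_i p i / g i.
  have e i : p i / g i = \sum_s \sum_j nsq (Z s i j) / om j * (p i / g i ^+ 2).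
    have -> : \sum_s \sum_j nsq (Z s i j) / om j * (p i / g i ^+ 2) = g i * (p i / g i ^+ 2).
      rewrite exchange_big /= /g mulr_suml; apply: eq_bigr => j _.
      by rewrite /W -mulr_suml -mulr_suml.
    by field; rewrite gt_eqF// g_gt0.
  rewrite (eq_bigr _ (fun i _ => e i)) [X in v * X]exchange_big /= mulr_sumr; apply: ler_sum => s _.
  rewrite exchange_big /= mulr_sumr; apply: ler_sum => j _.
  rewrite ler_pdivrMr// mulrAC -mulrA; apply: le_trans (hv _) _.
  rewrite ler_wpM2l ?(ltW v0)// mulr_sumr; apply: ler_sum => i _.
  rewrite rdiag_mull nsqM nsq_rC mxE le_eqVlt; apply/orP; left; apply/eqP.
  by field; rewrite !gt_eqF ?g_gt0.
have split3 : \sum_s \sum_j (om j * qf M (w s j) -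
    2 * v^-1 * complex.Re ((adj (w s j) *m M *m (Dg *m w s j)) 0 0) +
    v^-1 ^+ 2 * (qf M (Dg *m w s j) / om j)) =
  \sum_j p' j * om j - 2 * v^-1 * (\sum_i p i / g i) +
  v^-1 ^+ 2 * \sum_s \sum_j qf M (Dg *m w s j) / om j.
  rewrite -cross; under eq_bigr do rewrite big_split /= sumrB -!mulr_sumr.
  rewrite big_split /= sumrB -!mulr_sumr; congr (_ - _ + _).
  rewrite exchange_big /=; apply: eq_bigr => j _.
  by rewrite /p' mulr_suml; apply: eq_bigr => s _; rewrite mulrC.
rewrite split3 in tot.
have vi : 0 < v^-1 by rewrite invr_gt0.
have := ler_wpM2l (exprn_ge0 2 (ltW vi)) quad.
rewrite [v^-1 ^+ 2 * (v * _)]mulrA (_ : v^-1 ^+ 2 * v = v^-1); last by field; rewrite gt_eqF.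
by lra.
Qed.

End LowOrder.

(** Here an upper bound on [p'] points the wrong way. With b = 1 - a and s = a/b, weights [om] are
    chosen so that a sum_j p'_j om_j + b sum_j q'_j om_j^(-s) equals [Qc a p' q']. Pulled back to
    the input, the first sum is bounded below by [weighted_output_ge] and the second by Jensen for
    t^s, where a >= 1/2 ensures s >= 1; Young's inequality then recovers [Qc a p q]. *)
Lemma dpi_level_lt1 a : 2^-1 <= a < 1 -> 1 <= v -> Qc a p q <= v * Qc a p' q'.
Proof.
move=> /andP[ah a1] v1; have a0 : 0 < a by apply: lt_le_trans ah; rewrite invr_gt0.
pose b := 1 - a; have b0 : 0 < b by rewrite subr_gt0.
pose om j := (q' j / p' j) `^ b.
have om0 j : 0 < om j by rewrite powR_gt0// divr_gt0.
pose s := a / b; have s1 : 1 <= s by rewrite /s ler_pdivlMr// mul1r /b; lra.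
have sb : s * b = a by rewrite /s divfK// gt_eqF.
pose g i := \sum_j W i j / om j.
have g0 i : 0 < g i by exact: g_gt0.
have e1 j : p' j * om j = p' j `^ a * q' j `^ (1 - a).
  rewrite /om [RHS]mulrC (_ : a = 1 - b); last by rewrite /b opprB addrCA subrr addr0.
  by rewrite (_ : 1 - (1 - b) = b) ?powR_split// opprB addrCA subrr addr0.
have e2 j : q' j * (om j)^-1 `^ s = p' j `^ a * q' j `^ (1 - a).
  rewrite powR_inv// /om -powRrM mulrC [b * s]mulrC sb powR_split//.
  by rewrite -powR_inv ?divr_gt0// invf_div mulrC.
have E : Qc a p' q' = a * (\sum_j p' j * om j) + b * (\sum_j q' j * (om j)^-1 `^ s).
  rewrite (eq_bigr _ (fun j _ => e1 j)) [X in b * X](eq_bigr _ (fun j _ => e2 j)).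
  by rewrite -mulrDl /b addrCA subrr addr0 mul1r.
have L2 : \sum_i q i * g i `^ s <= \sum_j q' j * (om j)^-1 `^ s.
  have -> : \sum_j q' j * (om j)^-1 `^ s = \sum_i q i * \sum_j W i j * (om j)^-1 `^ s.
    under eq_bigr do rewrite kraus_output_q mulr_suml.
    rewrite exchange_big /=; apply: eq_bigr => i _.
    by rewrite mulr_sumr; apply: eq_bigr => j _; ring.
  apply: ler_sum => i _; rewrite ler_wpM2l ?(ltW (q0 i))//.
  apply: jensen_ge; rewrite ?kraus_weight_sum ?s1// => j; first exact: kraus_weight_ge0.
  by rewrite invr_gt0.
have L1 := weighted_output_ge om0; rewrite -/g in L1.
have young i : p i `^ a * q i `^ (1 - a) <= a * (p i / g i) + b * (q i * g i `^ s).
  have x0 : 0 < p i / g i by rewrite divr_gt0.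
  have y0 : 0 < q i * g i `^ s by rewrite mulr_gt0 ?powR_gt0.
  have -> : p i `^ a * q i `^ (1 - a) = (p i / g i) `^ a * (q i * g i `^ s) `^ (1 - a).
    rewrite !powRM ?invr_ge0 ?powR_ge0 ?ltW// powR_inv// -powRrM -/b sb.
    by field; rewrite gt_eqF// powR_gt0.
  have a01 : 0 <= a <= 1 by rewrite !ltW.
  rewrite powR_split//; have := bernoulli_le (divr_gt0 x0 y0) a01.
  rewrite -(ler_pM2l y0) => /le_trans; apply.
  by rewrite le_eqVlt; apply/orP; left; apply/eqP; rewrite /b; field; rewrite !gt_eqF// powR_gt0.
apply: (@le_trans _ _ (a * (\sum_i p i / g i) + b * (\sum_i q i * g i `^ s))).
  by rewrite !mulr_sumr -big_split /=; apply: ler_sum => i _; exact: young.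
rewrite E mulrDr; apply: lerD.
  by rewrite mulrCA ler_wpM2l ?(ltW a0)// -ler_pdivrMl.
rewrite mulrCA ler_wpM2l ?(ltW b0)//; apply: le_trans L2 _.
by rewrite ler_peMl// sumr_ge0// => j _; rewrite mulr_ge0 ?powR_ge0// ltW.
Qed.

End Level.
End DataProcessing.

(** * Sandwiched traces *)

Section Sandwich.
Variable R : realType.
Local Notation C := R[i].

Lemma eq_sdiag n (U : 'M[C]_n) p q : p =1 q -> sdiag U p = sdiag U q.
Proof. by move=> /eq_rdiag e; rewrite /sdiag e. Qed.

Lemma conj_sdiag n (U : 'M[C]_n) p : unitary U -> adj U *m sdiag U p *m U = rdiag p.
Proof.
move=> hU; rewrite /sdiag !mulmxA (unitary_adj hU) mul1mx -mulmxA (unitary_adj hU).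
exact: mulmx1.
Qed.

Lemma sdiag_spec_sub n (U V : 'M[C]_n) p q : unitary U -> unitary V ->
  sdiag U p = sdiag V q -> forall i, exists j, p i = q j.
Proof.
move=> hU hV e i; pose W := adj V *m U.
have hW : unitary W by apply: unitaryM => //; exact: unitaryV.
have W1 : W *m rdiag p = rdiag q *m W.
  have := congr1 (fun X => adj V *m X *m U) e.
  rewrite /sdiag !mulmxA (unitary_adj hV) mul1mx -[_ *m adj U *m U]mulmxA (unitary_adj hU).
  by rewrite mulmx1 => h; rewrite /W h -!mulmxA.
have [j Wj] : exists j, W j i != 0.
  apply/not_existsP => h; have := nsq_unitary_col i hW; rewrite big1 => [/eqP|j _].
    by rewrite eq_sym oner_eq0.
  have /negP := h j; rewrite negbK => /eqP ->.
  by rewrite /nsq /= expr0n addr0.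
exists j; have := congr1 (fun X : 'M[C]_n => X j i) W1.
by rewrite rdiag_mulr rdiag_mull mulrC => /(mulIf Wj)/rC_inj.
Qed.

Lemma eigs_sdiag n (U : 'M[C]_n) q i : unitary U -> q i \in undup (eigs (sdiag U q)).
Proof.
move=> hU; rewrite mem_undup /eigs; have [[V r] -> [/= hV e]] := sdecP q hU.
have [j ->] := sdiag_spec_sub hU hV e i.
by apply: map_f; rewrite mem_enum.
Qed.

Lemma pinch_entry n (U : 'M[C]_n) q (X : 'M[C]_n) i j : unitary U ->
  (adj U *m pinch (sdiag U q) X *m U) i j =
  (adj U *m X *m U) i j *+ (q i == q j).
Proof.
move=> hU; rewrite /pinch mulmx_sumr mulmx_suml summxE; set M := adj U *m X *m U.
have e mu : (adj U *m (eigproj (sdiag U q) mu *m X *m eigproj (sdiag U q) mu) *m U) i j =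
    if q i == mu then M i j *+ (q j == mu) else 0.
  have -> : adj U *m (eigproj (sdiag U q) mu *m X *m eigproj (sdiag U q) mu) *m U =
    rdiag (fun k => if q k == mu then 1 else 0) *m M *m
    rdiag (fun k => if q k == mu then 1 else 0).
    rewrite /eigproj mfun_sdiag// /sdiag /M !mulmxA (unitary_adj hU) mul1mx.
    by rewrite -[_ *m adj U *m U]mulmxA (unitary_adj hU) mulmx1.
  rewrite rdiag_mulr rdiag_mull; case: eqP => _; last by rewrite rC0 !mul0r.
  by rewrite rC1 mul1r; case: eqP => _; rewrite ?rC1 ?rC0 ?mulr1 ?mulr0.
rewrite (eq_bigr _ (fun mu _ => e mu)).
rewrite (bigD1_seq (q i)) ?undup_uniq ?eigs_sdiag//= eqxx eq_sym big1 ?addr0// => mu.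
by rewrite eq_sym => /negPf ->.
Qed.

(* [p], [q] are the joint spectra of [pinch sigma rho] and [sigma]. *)
Definition pinched_pair n (rho sigma : 'M[C]_n) (U : 'M[C]_n) (p q : 'I_n -> R) :=
  [/\ unitary U, sigma = sdiag U q, pinch sigma rho = sdiag U p,
      forall i, (adj U *m rho *m U) i i = rC (p i) &
      forall i j, i != j -> q i = q j -> (adj U *m rho *m U) i j = 0].

Lemma adj_conj n (U X : 'M[C]_n) : adj X = X -> adj (adj U *m X *m U) = adj U *m X *m U.
Proof. by move=> hX; rewrite !adjM adjK hX mulmxA. Qed.

Lemma conj_inj n (U X Y : 'M[C]_n) : unitary U -> adj U *m X *m U = adj U *m Y *m U -> X = Y.
Proof.
move=> hU /(congr1 (fun Z => U *m Z *m adj U)).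
rewrite !mulmxA (_ : U *m adj U = 1%:M)// !mul1mx -!mulmxA (_ : U *m adj U = 1%:M)//.
by rewrite !mulmx1.
Qed.

Lemma pinched_pair_exists n (rho sigma : 'M[C]_n) : adj rho = rho -> adj sigma = sigma ->
  exists U p q, pinched_pair rho sigma U p q.
Proof.
move=> hr /spectral_hermitian[V [s [hV e]]]; set P := pinch sigma rho.
have aP : adj (adj V *m P *m V) = adj V *m P *m V.
  apply/matrixP => i j; rewrite adj_entry /P e !pinch_entry// eq_sym.
  by case: eqVneq => _; rewrite ?mulr1n ?mulr0n -?adj_entry ?adj_conj// -rC0 cconj_rC.
have hP : adj P = P by apply: (conj_inj hV); rewrite -[RHS]aP !adjM adjK mulmxA.
have cP : P *m sigma = sigma *m P.
  apply: (conj_inj hV).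
  have -> : adj V *m (P *m sigma) *m V = (adj V *m P *m V) *m rdiag s.
    by rewrite e /sdiag !mulmxA -[_ *m adj V *m V]mulmxA (unitary_adj hV) mulmx1.
  have -> : adj V *m (sigma *m P) *m V = rdiag s *m (adj V *m P *m V).
    by rewrite e /sdiag !mulmxA (unitary_adj hV) mul1mx.
  apply/matrixP => i j; rewrite rdiag_mulr rdiag_mull /P e pinch_entry//.
  by case: eqVneq => [->|_]; [rewrite mulr1n mulrC|rewrite mulr0n mulr0 mul0r].
have hs : adj sigma = sigma by rewrite e adj_sdiag.
have [U [p [q [hU eP es]]]] := spectral_commuting hP hs cP.
exists U, p, q; split; [exact: hU|exact: es|exact: eP| |].
  move=> i; have := pinch_entry q rho i i hU; rewrite -es -/P eqxx mulr1n => <-.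
  by rewrite eP conj_sdiag// rdiagE eqxx.
move=> i j ij qij; have := pinch_entry q rho i j hU; rewrite -es -/P qij eqxx mulr1n => <-.
by rewrite eP conj_sdiag// rdiagE (negPf ij).
Qed.

Definition pd n (A : 'M[C]_n) := exists (U : 'M[C]_n) p,
  [/\ unitary U, (forall i, 0 < p i) & A = sdiag U p].

Lemma pd_herm n (A : 'M[C]_n) : pd A -> adj A = A.
Proof. by move=> [U [p [_ _ ->]]]; exact: adj_sdiag. Qed.

Lemma pd_psd n (A : 'M[C]_n) : pd A -> psd A.
Proof. by move=> [U [p [_ p0 ->]]]; apply: psd_sdiag => i; exact: ltW. Qed.

Lemma pd_tpow n (A : 'M[C]_n) k : pd A -> pd (tpow A k).
Proof.
move=> [U [p [hU p0 ->]]]; exists (tpow U k), (vpow p k).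
by split; [exact: unitary_tpow|exact: vpow_gt0|exact: sdiag_tpow].
Qed.

Lemma pd_conj n (A U : 'M[C]_n) : pd A -> unitary U -> pd (adj U *m A *m U).
Proof.
move=> [V [p [hV p0 ->]]] hU; exists (adj U *m V), p; split => //.
  by apply: unitaryM => //; exact: unitaryV.
by rewrite /sdiag adjM adjK !mulmxA.
Qed.

Lemma pd_spectrum n (A U : 'M[C]_n) q : pd A -> unitary U -> A = sdiag U q -> forall i, 0 < q i.
Proof.
move=> [V [p [hV p0 ->]]] hU e i; have [j ->] := sdiag_spec_sub hU hV (esym e) i.
exact: p0.
Qed.

Lemma pd_diag_gt0 n (A : 'M[C]_n) i : pd A -> 0 < complex.Re (A i i).
Proof. by move=> [V [p [hV p0 ->]]]; exact: diag_gt0. Qed.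

Lemma density_pd n (A : 'M[C]_n) : density A -> full_rank A ->
  exists (U : 'M[C]_n) p, [/\ unitary U, pmf p & A = sdiag U p].
Proof.
move=> [/psd_spectral[U [p [hU p0 ->]]] tr1] fr; exists U, p; split => //; split; last first.
  by apply: rC_inj; rewrite -(tr_sdiag p hU) tr1.
move=> i; rewrite lt_neqAle p0 andbT; apply/eqP => pi.
have uA : sdiag U p \in unitmx by rewrite -row_free_unit -row_leq_rank fr.
have z : sdiag U p *m col i U = 0.
  rewrite /sdiag colE !mulmxA -[_ *m adj U *m U]mulmxA (unitary_adj hU) mulmx1 -mulmxA.
  have -> : rdiag p *m delta_mx i (0 : 'I_1) = 0.
    apply/matrixP => k l; rewrite rdiag_mull !mxE.
    by case: eqVneq => [->|_]; rewrite -?pi ?rC0 ?mul0r ?mulr0.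
  by rewrite mulmx0.
have cz : col i U = 0 by rewrite -(mulKmx uA (col i U)) z mulmx0.
have := nsq_unitary_col i hU; rewrite big1 => [/eqP|j _]; first by rewrite eq_sym oner_eq0.
have := congr1 (fun X : 'cV[C]_n => X j 0) cz; rewrite !mxE => ->.
by rewrite /nsq /= expr0n addr0.
Qed.

Definition sandwich a n (rho sigma : 'M[C]_n) :=
  msqrt rho *m mpow sigma ((1 - a) / a) *m msqrt rho.
Definition Qt a n (rho sigma : 'M[C]_n) : R := retr (mpow (sandwich a rho sigma) a).

Definition halfpow n (q : 'I_n -> R) a : 'M[C]_n := rdiag (fun i => q i `^ ((1 - a) / a / 2)).

(** With [A] the product of the root of [rho], [U] and [halfpow q a], the sandwich is A A^* while
    the second matrix is A^* A; they share their spectrum. The second form has the explicit diagonal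
    to which the pinching estimates apply. *)
Lemma sandwich_spectrum n (rho U : 'M[C]_n) q a : pd rho -> unitary U -> (forall i, 0 < q i) ->
  exists (T V : 'M[C]_n) x, [/\ unitary T, unitary V, forall i, 0 < x i,
    sandwich a rho (sdiag U q) = sdiag T x &
    halfpow q a *m (adj U *m rho *m U) *m halfpow q a = sdiag V x].
Proof.
move=> [Ur [r [hUr r0 ->]]] hU q0; set S := halfpow q a; pose t := (1 - a) / a.
have [sr srD] : exists sr, sr = msqrt (sdiag Ur r) by eexists.
have srE : sr = sdiag Ur (fun i => Num.sqrt (r i)) by rewrite srD; exact: mfun_sdiag.
have srH : adj sr = sr by rewrite srE adj_sdiag.
have sr2 : sr *m sr = sdiag Ur r.
  rewrite srE (mul_sdiag _ _ hUr); apply: eq_sdiag => i.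
  by rewrite -expr2 sqr_sqrtr// ltW.
have SH : adj S = S by exact: adj_rdiag.
have S2 : S *m S = rdiag (fun i => q i `^ t).
  rewrite mul_rdiag; apply: eq_rdiag => i.
  rewrite -powRD ?(gt_eqF (q0 i)) ?implybT//; congr (_ `^ _).
  by rewrite -splitr.
pose A := sr *m U *m S.
have AA : adj A *m A = S *m (adj U *m sdiag Ur r *m U) *m S.
  by rewrite /A !adjM SH srH -sr2 !mulmxA.
have AA' : A *m adj A = sandwich a (sdiag Ur r) (sdiag U q).
  rewrite /A !adjM SH srH /sandwich -srD -/t /mpow mfun_sdiag// /sdiag -S2.
  by rewrite !mulmxA.
have hX : adj (adj A *m A) = adj A *m A by rewrite adjM adjK.
have [V [x [hV eX]]] := spectral_hermitian hX.
have xE j : x j = \sum_i nsq ((A *m col j V) i 0).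
  rewrite -(qf_col x j hV) -eX /qf; have := adj_mul_self (A *m col j V).
  by rewrite adjM !mulmxA => ->.
have injA (w : 'cV[C]_n) : A *m w = 0 -> w = 0.
  have Sinv : rdiag (fun i => q i `^ (- (t / 2))) *m S = 1%:M.
    rewrite mul_rdiag rdiag1// => i.
    by rewrite -powRD ?(gt_eqF (q0 i)) ?implybT// addNr powRr0.
  have srinv : sdiag Ur (fun i => (Num.sqrt (r i))^-1) *m sr = 1%:M.
    rewrite srE (mul_sdiag _ _ hUr) sdiag1// => i.
    by rewrite mulVf// gt_eqF// sqrtr_gt0.
  have Ainv : rdiag (fun i => q i `^ (- (t / 2))) *m adj U *m
     sdiag Ur (fun i => (Num.sqrt (r i))^-1) *m A = 1%:M.
    rewrite /A -[sr *m U *m S]mulmxA mulmxA -[_ *m sr]mulmxA srinv mulmx1 mulmxA.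
    by rewrite -[_ *m adj U *m U]mulmxA (unitary_adj hU) mulmx1 Sinv.
  by move=> h; rewrite -[w]mul1mx -Ainv -mulmxA h mulmx0.
clearbody A.
have x0 j : 0 < x j.
  rewrite lt_neqAle xE sumr_ge0 ?andbT; last by move=> i _; exact: nsq_ge0.
  apply/eqP => /esym/eqP; rewrite psumr_eq0; last by move=> i _; exact: nsq_ge0.
  move=> /allP h; have /injA cz : A *m col j V = 0.
    apply/matrixP => i k; rewrite ord1 [RHS]mxE; apply: nsq_eq0; apply/eqP.
    exact: h (mem_index_enum i).
  have := nsq_unitary_col j hV; rewrite big1 => [/eqP|i _]; first by rewrite eq_sym oner_eq0.
  have := congr1 (fun X : 'cV[C]_n => X i 0) cz; rewrite !mxE => ->.
  by rewrite /nsq /= expr0n addr0.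
pose B := rdiag (fun i => (Num.sqrt (x i))^-1).
have BH : adj B = B by exact: adj_rdiag.
have BxB : B *m rdiag x *m B = 1%:M.
  rewrite !mul_rdiag rdiag1// => i; have sx : 0 < Num.sqrt (x i) by rewrite sqrtr_gt0.
  by rewrite -{2}(sqr_sqrtr (ltW (x0 i))); field; rewrite gt_eqF.
(* Normalizing the images under [A] of the eigenvectors of A^* A gives the eigenvectors of A A^*. *)
clearbody B; pose T := A *m V *m B.
have TT : adj T *m T = B *m (adj V *m (adj A *m A) *m V) *m B.
  by rewrite /T !adjM BH !mulmxA.
exists T, V, x; split; [|exact: hV|exact: x0| |by rewrite -AA].
  by apply: mulmx1C; rewrite TT eX conj_sdiag.
have VV : V *m adj V = 1%:M by [].
have e : A *m V *m B *m rdiag x *m B = A *m V.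
  by rewrite -[_ *m B *m rdiag x]mulmxA -[_ *m (B *m rdiag x) *m B]mulmxA BxB mulmx1.
rewrite -AA' /sdiag /T !adjM BH !mulmxA e.
by rewrite -[A *m V *m adj V]mulmxA VV mulmx1.
Qed.

Lemma Qt_sdiag n (T : 'M[C]_n) x a (rho sigma : 'M[C]_n) : unitary T ->
  sandwich a rho sigma = sdiag T x -> Qt a rho sigma = \sum_i x i `^ a.
Proof. by move=> hT e; rewrite /Qt e /mpow mfun_sdiag// retr_sdiag. Qed.

Lemma sandwich_tpow n a (rho sigma : 'M[C]_n) k : pd rho -> pd sigma ->
  sandwich a (tpow rho k) (tpow sigma k) = tpow (sandwich a rho sigma) k.
Proof.
move=> [U [p [hU p0 ->]]] [V [q [hV q0 ->]]].
have vs i : Num.sqrt (vpow p k i) = vpow (fun i => Num.sqrt (p i)) k i.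
  elim: k i => [|k IH] i /=; first by rewrite sqrtr1.
  by rewrite sqrtrM ?IH// ltW.
rewrite /sandwich /msqrt /mpow !sdiag_tpow !mfun_sdiag//; do ?exact: unitary_tpow.
have tp3 (X Y : 'M[C]_n) : tpow (X *m Y *m X) k = tpow X k *m tpow Y k *m tpow X k.
  by rewrite (tpowM (X *m Y)) (tpowM X).
have vq i : vpow q k i `^ ((1 - a) / a) = vpow (fun i => q i `^ ((1 - a) / a)) k i.
  by rewrite vpow_powR.
by rewrite tp3 !sdiag_tpow (eq_sdiag _ vs) (eq_sdiag _ vq).
Qed.

Lemma Qt_tpow n a (rho sigma : 'M[C]_n) k : pd rho -> pd sigma ->
  Qt a (tpow rho k) (tpow sigma k) = Qt a rho sigma ^+ k.
Proof.
move=> hr hs; rewrite /Qt sandwich_tpow//; case: (hs) => V [q [hV q0 e]].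
have [T [W [x [hT hW x0 eT _]]]] := sandwich_spectrum a hr hV q0.
rewrite e eT sdiag_tpow /mpow !mfun_sdiag//; last exact: unitary_tpow.
rewrite !retr_sdiag//; last exact: unitary_tpow.
by rewrite -sum_vpow; apply: eq_bigr => i _; rewrite vpow_powR.
Qed.

Section Bounds.
Variables (n : nat) (rho U : 'M[C]_n) (p q : 'I_n -> R).
Hypotheses (hr : pd rho) (hU : unitary U) (q0 : forall i, 0 < q i).
Let M := adj U *m rho *m U.
Hypothesis pE : forall i, M i i = rC (p i).

Lemma pair_p_gt0 i : 0 < p i.
Proof. by have := pd_diag_gt0 i (pd_conj hr hU); rewrite -/M pE. Qed.

Lemma sandwich_diag a i : a != 0 ->
  complex.Re ((halfpow q a *m M *m halfpow q a) i i) = q i `^ ((1 - a) / a) * p i.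
Proof.
move=> a0; rewrite rdiag_mulr rdiag_mull pE -!rCM Re_rC mulrAC -powRD; last first.
  by rewrite (gt_eqF (q0 i)) implybT.
by rewrite -splitr.
Qed.

Lemma sandwich_diag_powR a i : a != 0 ->
  (q i `^ ((1 - a) / a) * p i) `^ a = p i `^ a * q i `^ (1 - a).
Proof.
move=> a0; rewrite powRM ?powR_ge0 ?(ltW (pair_p_gt0 i))// -powRrM divfK//.
exact: mulrC.
Qed.

(** Peierls' inequality in the eigenbasis of [sdiag U q]: the a-th power of the diagonal entry
    q^((1-a)/a) p is p^a q^(1-a). *)
Lemma Qt_ge_diag a : 1 <= a -> Qc a p q <= Qt a rho (sdiag U q).
Proof.
move=> a1; have a0 : a != 0 by rewrite gt_eqF// (lt_le_trans ltr01).
have [T [V [x [hT hV x0 eT eV]]]] := sandwich_spectrum a hr hU q0.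
rewrite (Qt_sdiag hT eT); apply: le_trans (peierls_ge hV x0 a1).
apply: ler_sum => i _; rewrite -eV.
by rewrite sandwich_diag// sandwich_diag_powR.
Qed.

Lemma Qt_le_diag a : 0 < a <= 1 -> Qt a rho (sdiag U q) <= Qc a p q.
Proof.
move=> /andP[a0 a1]; have an : a != 0 by rewrite gt_eqF.
have [T [V [x [hT hV x0 eT eV]]]] := sandwich_spectrum a hr hU q0.
have a01 : 0 <= a <= 1 by rewrite ltW.
rewrite (Qt_sdiag hT eT); apply: le_trans (peierls_le hV x0 a01) _.
apply: ler_sum => i _; rewrite -eV.
by rewrite sandwich_diag// sandwich_diag_powR.
Qed.

Variables (v : R).
Hypotheses (v0 : 0 < v) (hv : forall w, qf M w <= v * \sum_i nsq (w i 0) * p i).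

Lemma sandwich_pinching a (w : 'cV[C]_n) : a != 0 ->
  qf (halfpow q a *m M *m halfpow q a) w <=
  v * \sum_i nsq (w i 0) * complex.Re ((halfpow q a *m M *m halfpow q a) i i).
Proof.
move=> a0; set S := halfpow q a; have -> : qf (S *m M *m S) w = qf M (S *m w).
  by rewrite /qf adjM adj_rdiag !mulmxA.
apply: le_trans (hv _) _; rewrite ler_wpM2l ?(ltW v0)//; apply: ler_sum => i _.
have e : q i `^ ((1 - a) / a / 2) ^+ 2 = q i `^ ((1 - a) / a).
  by rewrite expr2 -powRD ?(gt_eqF (q0 i)) ?implybT// -splitr.
by rewrite sandwich_diag// rdiag_mull nsqM nsq_rC e [leRHS]mulrCA mulrA.
Qed.

Lemma Qt_upper a : 1 <= a -> Qt a rho (sdiag U q) <= v `^ a * Qc a p q.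
Proof.
move=> a1; have a0 : a != 0 by rewrite gt_eqF// (lt_le_trans ltr01).
have [T [V [x [hT hV x0 eT eV]]]] := sandwich_spectrum a hr hU q0.
have h w : qf (sdiag V x) w <= v * \sum_i nsq (w i 0) * complex.Re (sdiag V x i i).
  by rewrite -eV; exact: (sandwich_pinching w a0).
rewrite (Qt_sdiag hT eT); apply: le_trans (trace_le_diag hV x0 v0 h a1) _.
rewrite ler_wpM2l ?powR_ge0//; apply: ler_sum => i _; rewrite -eV.
by rewrite sandwich_diag// sandwich_diag_powR.
Qed.

Lemma Qt_lower a : 0 < a < 1 -> Qc a p q <= v `^ (1 - a) * Qt a rho (sdiag U q).
Proof.
move=> ha; have a0 : a != 0 by case/andP: ha => a0 _; rewrite gt_eqF.
have [T [V [x [hT hV x0 eT eV]]]] := sandwich_spectrum a hr hU q0.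
have h w : qf (sdiag V x) w <= v * \sum_i nsq (w i 0) * complex.Re (sdiag V x i i).
  by rewrite -eV; exact: (sandwich_pinching w a0).
rewrite (Qt_sdiag hT eT); apply: le_trans (diag_le_trace hV x0 v0 h ha).
apply: ler_sum => i _; rewrite -eV.
by rewrite sandwich_diag// sandwich_diag_powR.
Qed.

End Bounds.
End Sandwich.

(** * Kraus operators and exact conversions *)

Section Kraus.
Variable R : realType.
Local Notation C := R[i].

Lemma cconjM (x y : C) : cconj (x * y) = cconj x * cconj y.
Proof. by rewrite !cconjE rmorphM. Qed.

Definition kraus (S : finType) a b (K : S -> 'M[C]_(b, a)) (X : 'M[C]_a) : 'M[C]_b :=
  \sum_s K s *m X *m adj (K s).
Definition tp (S : finType) a b (K : S -> 'M[C]_(b, a)) := \sum_s adj (K s) *m K s = 1%:M.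

Lemma psd_conj a b (A : 'M[C]_(b, a)) (X : 'M[C]_a) : psd X -> psd (A *m X *m adj A).
Proof.
move=> [hX pX]; split; first by rewrite !adjM adjK hX mulmxA.
by move=> v; have := pX (adj A *m v); rewrite adjM adjK !mulmxA.
Qed.

Lemma psd_sum n (S : finType) (X : S -> 'M[C]_n) : (forall s, psd (X s)) -> psd (\sum_s X s).
Proof.
move=> h; split; first by rewrite adj_sum; apply: eq_bigr => s _; case: (h s).
move=> v; rewrite mulmx_sumr mulmx_suml summxE; apply: sumr_ge0 => s _.
by case: (h s).
Qed.

Lemma ampl_entry r a b (E : 'M[C]_a -> 'M[C]_b) X i j k l :
  @ampl R r a b E X (mxtens_index (i, k)) (mxtens_index (j, l)) =
  E (\matrix_(k, l) X (mxtens_index (i, k)) (mxtens_index (j, l))) k l.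
Proof.
rewrite /ampl summxE (bigD1 i)//= summxE (bigD1 j)//= tensmxE mxE !eqxx mul1r.
rewrite big1 ?addr0 => [|j' jj]; last first.
  by rewrite tensmxE mxE eqxx eq_sym (negPf jj) mul0r.
rewrite big1 ?addr0// => i' ii; rewrite summxE big1// => j' _.
by rewrite tensmxE mxE eq_sym (negPf ii) mul0r.
Qed.

Lemma kraus_entry (S : finType) a b (K : S -> 'M[C]_(b, a)) X i j :
  kraus K X i j = \sum_s \sum_k \sum_l K s i k * X k l * cconj (K s j l).
Proof.
rewrite /kraus summxE; apply: eq_bigr => s _; rewrite mxE exchange_big /=.
apply: eq_bigr => l _; rewrite mxE mulr_suml; apply: eq_bigr => k _.
by rewrite adj_entry.
Qed.

Lemma ampl_kraus (S : finType) r a b (K : S -> 'M[C]_(b, a)) X :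
  @ampl R r a b (kraus K) X =
  \sum_s ((1%:M : 'M[C]_r) *t K s) *m X *m adj ((1%:M : 'M[C]_r) *t K s).
Proof.
apply/matrixP => x y; case: (mxtens_indexP x) => i k; case: (mxtens_indexP y) => j l.
rewrite ampl_entry kraus_entry -/(kraus _ _) kraus_entry; apply: eq_bigr => s _.
rewrite [RHS]sum_mxtens (bigD1 i)//= [X in _ = _ + X]big1 ?addr0 => [|i' ii]; last first.
  rewrite big1// => k' _; rewrite big1// => l' _.
  by rewrite tensmxE mxE eq_sym (negPf ii) !mul0r.
apply: eq_bigr => k' _.
rewrite [RHS]sum_mxtens (bigD1 j)//= [X in _ = _ + X]big1 ?addr0 => [|j' jj]; last first.
  rewrite big1// => l' _.
  by rewrite [X in cconj X]tensmxE [1%:M _ _]mxE eq_sym (negPf jj) mul0r -rC0 cconj_rC rC0 mulr0.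
apply: eq_bigr => l' _.
by rewrite !tensmxE !mxE !eqxx !mul1r.
Qed.

Lemma kraus_channel (S : finType) a b (K : S -> 'M[C]_(b, a)) : tp K -> channel (kraus K).
Proof.
move=> hK; split.
- move=> c X Y; rewrite /kraus scaler_sumr -big_split /=; apply: eq_bigr => s _.
  by rewrite mulmxDr mulmxDl -scalemxAr -scalemxAl.
- by move=> r X hX; rewrite ampl_kraus; apply: psd_sum => s; exact: psd_conj.
- move=> X; rewrite /kraus raddf_sum /=; under eq_bigr do rewrite mxtrace_mulC mulmxA.
  by rewrite -raddf_sum /= -mulmx_suml hK mul1mx.
Qed.

Lemma channel_linear_sum a b (E : 'M[C]_a -> 'M[C]_b) (I : finType) (c : I -> C)
    (X : I -> 'M[C]_a) : channel E -> E (\sum_i c i *: X i) = \sum_i c i *: E (X i).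
Proof.
move=> [lin _ _].
have E0 : E 0 = 0 by have := lin (-1) 0 0; rewrite scaleN1r oppr0 addr0 scaleN1r addNr.
have e (s : seq I) : E (\sum_(i <- s) c i *: X i) = \sum_(i <- s) c i *: E (X i).
  by elim: s => [|i s IH]; rewrite ?big_nil// !big_cons lin IH.
exact: e.
Qed.

(** Choi's theorem: [om] is the unnormalized maximally entangled vector, and the Kraus operators are
    the eigenvectors of the resulting Choi matrix, scaled by the roots of the eigenvalues and
    reshaped into matrices. *)
Lemma channel_kraus a b (E : 'M[C]_a -> 'M[C]_b) : channel E ->
  exists (S : finType) (K : S -> 'M[C]_(b, a)), tp K /\ E =1 kraus K.
Proof.
move=> hE; have [lin pos trc] := hE.
pose om : 'cV[C]_(a * a) := \col_i ((mxtens_unindex i).1 == (mxtens_unindex i).2)%:R.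
have psdO : psd (om *m 1%:M *m adj om).
  apply: psd_conj; rewrite -[1%:M](_ : sdiag 1%:M (fun=> 1) = _); last by apply: sdiag1 => //; exact: unitary1.
  by apply: psd_sdiag.
have block i j : \matrix_(k, l) (om *m 1%:M *m adj om) (mxtens_index (i, k)) (mxtens_index (j, l)) =
    delta_mx i j.
  apply/matrixP => k l; rewrite mxE mulmx1 mxE big_ord_recl big_ord0 addr0 adj_entry !mxE.
  have cn (c : bool) : cconj (c%:R : C) = c%:R by rewrite cconjE conjC_nat.
  by rewrite !mxtens_indexK /= cn -natrM mulnb eq_sym [j == l]eq_sym.
have [V [x [hV x0 eV]]] := psd_spectral (pos a _ psdO).
pose K s : 'M[C]_(b, a) := \matrix_(k, i) (rC (Num.sqrt (x s)) * V (mxtens_index (i, k)) s).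
have Ed i j : E (delta_mx i j) = kraus K (delta_mx i j).
  apply/matrixP => k l; have := ampl_entry E (om *m 1%:M *m adj om) i j k l.
  rewrite block => <-; rewrite eV /sdiag mxE kraus_entry; apply: eq_bigr => s _.
  rewrite (bigD1 i)//= [X in _ = _ + X]big1 ?addr0 => [|i' ii]; last first.
    by rewrite big1// => j' _; rewrite [delta_mx _ _ _ _]mxE (negPf ii) mulr0 mul0r.
  rewrite (bigD1 j)//= [X in _ = _ + X]big1 ?addr0 => [|j' jj]; last first.
    by rewrite [delta_mx _ _ _ _]mxE (negPf jj) andbF mulr0 mul0r.
  rewrite rdiag_mulr adj_entry !mxE !eqxx mulr1 cconjM cconj_rC.
  by rewrite -{1}(sqr_sqrtr (x0 s)) expr2 rCM; ring.
have EK X : E X = kraus K X.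
  have e (F : 'M[C]_a -> 'M[C]_b) : channel F \/ F = kraus K ->
     F X = \sum_(ij : 'I_a * 'I_a) X ij.1 ij.2 *: F (delta_mx ij.1 ij.2).
    have XE : X = \sum_(ij : 'I_a * 'I_a) X ij.1 ij.2 *: delta_mx ij.1 ij.2.
      by rewrite -(pair_bigA _ (fun i j => X i j *: delta_mx i j)) /= -matrix_sum_delta.
    case=> [hF|->]; first by rewrite {1}XE channel_linear_sum.
    rewrite {1}XE /kraus; under [RHS]eq_bigr do rewrite scaler_sumr.
    rewrite exchange_big /=; apply: eq_bigr => s _.
    rewrite mulmx_sumr mulmx_suml; apply: eq_bigr => ij _.
    by rewrite -scalemxAr -scalemxAl.
  rewrite (e E (or_introl hE)) (e (kraus K) (or_intror erefl)).
  by apply: eq_bigr => ij _; rewrite Ed.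
exists _, K; split => //.
apply/matrixP => i j.
(* Trace preservation, tested on matrix units, gives the completeness relation entry by entry. *)
have trK X : \tr (X *m \sum_s adj (K s) *m K s) = \tr X.
  rewrite -[RHS]trc EK /kraus mxtrace_mulC mulmx_suml !raddf_sum /=.
  by apply: eq_bigr => s _; rewrite [RHS]mxtrace_mulC mulmxA.
have trd (N : 'M[C]_a) : \tr (delta_mx j i *m N) = N i j.
  rewrite /mxtrace (bigD1 j)//= big1 => [|k kj]; last first.
    by rewrite mxE big1// => l _; rewrite mxE (negPf kj) mul0r.
  rewrite addr0 mxE (bigD1 i)//= big1 => [|l li]; last by rewrite mxE (negPf li) andbF mul0r.
  by rewrite mxE !eqxx mul1r addr0.
by rewrite -trd trK -[delta_mx j i]mulmx1 trd.
Qed.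

Definition kconv a b (rho sigma : 'M[C]_a) (rho' sigma' : 'M[C]_b) :=
  exists (S : finType) (K : S -> 'M[C]_(b, a)),
  [/\ tp K, kraus K rho = rho' & kraus K sigma = sigma'].

Lemma tdist0 n (A : 'M[C]_n) : tdist A A = 0.
Proof.
rewrite /tdist /tnorm subrr mulmx0 /msqrt.
have -> : (0 : 'M[C]_n) = sdiag 1%:M (fun=> 0).
  by rewrite /sdiag (_ : rdiag _ = 0) ?mulmx0 ?mul0mx//; apply/matrixP => i j; rewrite rdiagE mxE rC0 mul0rn.
rewrite mfun_sdiag ?retr_sdiag; do ?exact: unitary1.
by rewrite big1 ?mulr0// => i _; rewrite sqrtr0.
Qed.

Lemma tdist_le0 n (A B : 'M[C]_n) : tdist A B <= 0 -> A = B.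
Proof.
rewrite /tdist /tnorm; set X := A - B => h.
suff X0 : X = 0 by apply/eqP; rewrite -subr_eq0 -/X X0.
have hP : psd (adj X *m X).
  have := @psd_conj _ _ (adj X) 1%:M; rewrite mulmx1 adjK; apply.
  rewrite -[1%:M](_ : sdiag 1%:M (fun=> 1) = _); last by apply: sdiag1 => //; exact: unitary1.
  exact: psd_sdiag.
have [V [x [hV x0 e]]] := psd_spectral hP.
move: h; rewrite e /msqrt mfun_sdiag// retr_sdiag// pmulr_rle0 ?invr_gt0// => h.
have xz i : x i = 0.
  have /eqP : \sum_i Num.sqrt (x i) = 0.
    by apply/eqP; rewrite eq_le h sumr_ge0// => j _; exact: sqrtr_ge0.
  rewrite psumr_eq0; last by move=> j _; exact: sqrtr_ge0.
  move=> /allP/(_ i (mem_index_enum i))/=; rewrite sqrtr_eq0 => xi.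
  by apply/eqP; rewrite eq_le xi x0.
have XX : adj X *m X = 0.
  rewrite e /sdiag (_ : rdiag x = 0) ?mulmx0 ?mul0mx//.
  by apply/matrixP => i j; rewrite rdiagE mxE xz rC0 mul0rn.
apply/matrixP => i j; rewrite [RHS]mxE; apply: nsq_eq0.
have : \sum_k nsq (X k j) = 0.
  have XXj : (adj X *m X) j j = 0 by rewrite XX mxE.
  apply: rC_inj; rewrite rC0 -[RHS]XXj [RHS]mxE rC_sum; apply: eq_bigr => k _.
  by rewrite adj_entry rC_nsq mulrC.
move=> /eqP; rewrite psumr_eq0; last by move=> k _; exact: nsq_ge0.
by move=> /allP/(_ i (mem_index_enum i))/eqP.
Qed.

Lemma dconv_kconv a b (rho sigma : 'M[C]_a) (rho' sigma' : 'M[C]_b) :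
  dconv rho sigma rho' sigma' 0 0 <-> kconv rho sigma rho' sigma'.
Proof.
split=> [[E [hE [/tdist_le0 h1 /tdist_le0 h2]]]|[S [K [hK e1 e2]]]].
  have [S [K [hK EK]]] := channel_kraus hE.
  by exists S, K; split; rewrite -?EK.
exists (kraus K); split; first exact: kraus_channel.
by rewrite e1 e2 !tdist0.
Qed.

Lemma kconv_trans a b c (r s : 'M[C]_a) (r' s' : 'M[C]_b) (r'' s'' : 'M[C]_c) :
  kconv r s r' s' -> kconv r' s' r'' s'' -> kconv r s r'' s''.
Proof.
move=> [S [K [hK e1 e2]]] [S' [K' [hK' e1' e2']]].
have comp X : kraus (fun t : S' * S => K' t.1 *m K t.2) X = kraus K' (kraus K X).
  rewrite /kraus; under [RHS]eq_bigr do rewrite mulmx_sumr mulmx_suml.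
  by rewrite pair_bigA /=; apply: eq_bigr => t _; rewrite adjM !mulmxA.
exists (S' * S)%type, (fun t => K' t.1 *m K t.2); split; rewrite ?comp ?e1 ?e2//.
rewrite /tp -(pair_bigA _ (fun t' t => adj (K' t' *m K t) *m (K' t' *m K t))) /= exchange_big /=.
rewrite -hK; apply: eq_bigr => t _.
under eq_bigr do rewrite adjM mulmxA -[_ *m adj _ *m _]mulmxA.
by rewrite -mulmx_suml -mulmx_sumr hK' mulmx1.
Qed.

Lemma kconv_tens a b a' b' (r s : 'M[C]_a) (r' s' : 'M[C]_b) (u v : 'M[C]_a') (u' v' : 'M[C]_b') :
  kconv r s r' s' -> kconv u v u' v' -> kconv (r *t u) (s *t v) (r' *t u') (s' *t v').
Proof.
move=> [S [K [hK e1 e2]]] [S' [K' [hK' e1' e2']]].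
have sumt m n p q (A : S -> 'M[C]_(m, n)) (B : S' -> 'M[C]_(p, q)) :
    \sum_(t : S * S') A t.1 *t B t.2 = (\sum_s A s) *t (\sum_s B s).
  apply/matrixP => x y; case: (mxtens_indexP x) => i k; case: (mxtens_indexP y) => j l.
  rewrite summxE tensmxE !summxE mulr_suml.
  under [RHS]eq_bigr do rewrite mulr_sumr.
  by rewrite pair_bigA /=; apply: eq_bigr => t _; rewrite tensmxE.
have comp X Y : kraus (fun t : S * S' => K t.1 *t K' t.2) (X *t Y) = kraus K X *t kraus K' Y.
  rewrite /kraus -sumt; apply: eq_bigr => t _ /=.
  by rewrite adj_tens !tensmx_mul.
exists (S * S')%type, (fun t => K t.1 *t K' t.2); split; rewrite ?comp ?e1 ?e2 ?e1' ?e2'//.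
rewrite /tp; under eq_bigr do rewrite adj_tens tensmx_mul.
rewrite (sumt _ _ _ _ (fun s => adj (K s) *m K s) (fun s => adj (K' s) *m K' s)).
rewrite (hK : \sum_s adj (K s) *m K s = _) (hK' : \sum_s adj (K' s) *m K' s = _).
apply/matrixP => x y; case: (mxtens_indexP x) => i k; case: (mxtens_indexP y) => j l.
rewrite tensmxE !mxE (inj_eq (can_inj (@mxtens_indexK _ _))) xpair_eqE.
by case: eqVneq; case: eqVneq; rewrite ?mulr1n ?mulr0n ?mulr0 ?mul0r ?mulr1.
Qed.

Lemma kconv_isometry a b (J : 'M[C]_(b, a)) r s : adj J *m J = 1%:M ->
  kconv r s (J *m r *m adj J) (J *m s *m adj J).
Proof.
move=> hJ; exists unit, (fun=> J); split; rewrite /tp /kraus.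
- by rewrite (bigD1 tt)//= big1 ?addr0// => -[].
- by rewrite (bigD1 tt)//= big1 ?addr0// => -[].
- by rewrite (bigD1 tt)//= big1 ?addr0// => -[].
Qed.

Lemma kconv_refl a (r s : 'M[C]_a) : kconv r s r s.
Proof.
have := @kconv_isometry _ _ (1%:M : 'M[C]_a) r s.
by rewrite adj1 !mul1mx !mulmx1; apply.
Qed.

Lemma kconv_tpow a b (r s : 'M[C]_a) (r' s' : 'M[C]_b) k :
  kconv r s r' s' -> kconv (tpow r k) (tpow s k) (tpow r' k) (tpow s' k).
Proof. by move=> h; elim: k => [|k IH]; [exact: kconv_refl|exact: kconv_tens]. Qed.

(** Measure in the basis [U], draw j from the i-th row of [W], prepare the j-th column of [V]. Only
    the diagonals of [r] and [s] in the basis [U] matter, so neither input has to be diagonal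
    there. *)
Lemma kconv_prepare a b (r s : 'M[C]_a) (V : 'M[C]_b) p q (W : 'I_a -> 'I_b -> R)
    (U : 'M[C]_a) (r1 s1 : 'I_a -> R) :
  unitary U -> unitary V -> (forall i j, 0 <= W i j) -> (forall i, \sum_j W i j = 1) ->
  (forall i, (adj U *m r *m U) i i = rC (r1 i)) -> (forall i, (adj U *m s *m U) i i = rC (s1 i)) ->
  (forall j, \sum_i W i j * r1 i = p j) -> (forall j, \sum_i W i j * s1 i = q j) ->
  kconv r s (sdiag V p) (sdiag V q).
Proof.
move=> hU hV W0 W1 rE sE Wp Wq.
pose K (t : 'I_a * 'I_b) : 'M[C]_(b, a) :=
  rC (Num.sqrt (W t.1 t.2)) *: (V *m delta_mx t.2 t.1 *m adj U).
have sq i j : rC (Num.sqrt (W i j)) * rC (Num.sqrt (W i j)) = rC (W i j).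
  by rewrite -rCM -expr2 sqr_sqrtr.
have adjd m n (i : 'I_m) (j : 'I_n) : adj (delta_mx i j : 'M[C]_(m, n)) = delta_mx j i.
  by rewrite adjE trmx_delta map_delta_mx.
have dNd (N : 'M[C]_a) (i : 'I_a) (j : 'I_b) : delta_mx j i *m N *m delta_mx i j = N i i *: delta_mx j j.
  apply/matrixP => k l; rewrite mxE (bigD1 i)//= big1 => [|m mi]; last first.
    by rewrite [delta_mx _ _ _ _]mxE (negPf mi) mulr0.
  rewrite addr0 mxE (bigD1 i)//= big1 => [|m mi]; last by rewrite mxE (negPf mi) andbF mul0r.
  rewrite addr0 !mxE !eqxx !andbT /=.
  by case: (k == j); case: (l == j); rewrite ?mul1r ?mulr1 ?mul0r ?mulr0.
have out X (x1 : 'I_a -> R) y : (forall i, (adj U *m X *m U) i i = rC (x1 i)) ->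
    (forall j, \sum_i W i j * x1 i = y j) -> kraus K X = sdiag V y.
  move=> XE Wy.
  have e i j : K (i, j) *m X *m adj (K (i, j)) = V *m (rC (W i j * x1 i) *: delta_mx j j) *m adj V.
    transitivity (rC (W i j) *: (V *m (delta_mx j i *m (adj U *m X *m U) *m delta_mx i j) *m adj V)).
      rewrite /K /= adjZ cconj_rC !adjM adjK adjd -!scalemxAl -scalemxAr scalerA sq.
      by rewrite !mulmxA.
    by rewrite dNd XE rCM scalemxAl scalemxAr scalerA.
  rewrite /kraus -(pair_bigA _ (fun i j => K (i, j) *m X *m adj (K (i, j)))) /= exchange_big /=.
  under eq_bigr do under eq_bigr do rewrite e.
  under eq_bigr do rewrite -mulmx_suml -mulmx_sumr -scaler_suml -rC_sum Wy.
  rewrite -mulmx_suml -mulmx_sumr /sdiag; congr (_ *m _ *m _).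
  apply/matrixP => k l; rewrite rdiagE summxE (bigD1 k)//= big1 => [|j jk].
    by rewrite addr0 !mxE eqxx eq_sym mulr_natr.
  by rewrite !mxE eq_sym (negPf jk) mulr0.
exists ('I_a * 'I_b)%type, K; split; [|exact: out|exact: out].
have e i j : adj (K (i, j)) *m K (i, j) = U *m (rC (W i j) *: delta_mx i i) *m adj U.
  rewrite /K /= adjZ cconj_rC !adjM adjK adjd -!scalemxAl -!scalemxAr scalerA sq.
  rewrite -scalemxAl; congr (_ *: _); rewrite !mulmxA -[_ *m adj V *m V]mulmxA (unitary_adj hV) mulmx1.
  by rewrite -[U *m _ *m delta_mx j i]mulmxA mul_delta_mx.
rewrite /tp -(pair_bigA _ (fun i j => adj (K (i, j)) *m K (i, j))) /=.
under eq_bigr do under eq_bigr do rewrite e.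
under eq_bigr do rewrite -mulmx_suml -mulmx_sumr -scaler_suml -rC_sum W1 rC1 scale1r.
rewrite -mulmx_suml -mulmx_sumr.
have -> : \sum_(i < a) delta_mx i i = 1%:M :> 'M[C]_a.
  apply/matrixP => k l; rewrite summxE mxE (bigD1 k)//= big1 => [|i ik]; last first.
    by rewrite mxE eq_sym (negPf ik).
  by rewrite mxE eqxx addr0 eq_sym.
by rewrite mulmx1.
Qed.

End Kraus.

(** * Data processing *)

Section Asymptotics.
Variable R : realType.
Local Notation C := R[i].

Lemma ln_le_sub1 (x : R) : 0 < x -> ln x <= x - 1.
Proof.
by move=> x0; have := expR_ge1Dx (ln x); rewrite lnK ?posrE// => h; lra.
Qed.

(** Polynomial factors disappear under k-th roots. At k + 1 = n^2 one has k = (n - 1)(n + 1), and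
    the crude bound ln n <= n - 1 already gives a contradiction once n e exceeds 2 |D|, where [e] is
    ln x - ln y. *)
Lemma poly_growth_le (x y D : R) : 0 < x -> 0 < y ->
  (forall k, x ^+ k <= k.+1%:R `^ D * y ^+ k) -> x <= y.
Proof.
move=> x0 y0 h; rewrite leNgt; apply/negP => yx.
pose e := ln x - ln y; have e0 : 0 < e by rewrite subr_gt0 ltr_ln.
pose n := (Num.trunc (2 * `|D| / e)).+2.
have nR : 2 * `|D| < n%:R * e.
  by rewrite -ltr_pdivrMr//; apply: lt_trans (truncnS_gt _) _; rewrite ltr_nat.
have n1 : 1 < n%:R :> R by rewrite ltr1n.
have n0 : 0 < n%:R :> R by rewrite ltr0n.
clearbody n.
have [k kE] : exists k, k.+1 = (n * n)%N.
  by exists (n * n).-1; rewrite prednK// muln_gt0 -(ltr0n R) n0.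
have kR : k%:R = n%:R * n%:R - 1 :> R by rewrite -natrM -kE -natr1 addrK.
have := h k; rewrite kE natrM -ler_ln ?posrE ?mulr_gt0 ?powR_gt0 ?exprn_gt0 ?mulr_gt0//.
rewrite lnM ?posrE ?powR_gt0 ?exprn_gt0 ?mulr_gt0// !lnXn// ln_powR.
rewrite -[ln x *+ _]mulr_natl -[ln y *+ _]mulr_natl lnM ?posrE// kR => h1.
have l0 : 0 <= ln n%:R :> R by rewrite ln_ge0// ltW.
have l1 : ln n%:R <= n%:R - 1 :> R by exact: ln_le_sub1.
have h2 : D * (ln n%:R + ln n%:R) <= `|D| * (2 * (n%:R - 1)).
  apply: (@le_trans _ _ (`|D| * (ln n%:R + ln n%:R))).
    by rewrite ler_wpM2r ?ler_norm// addr_ge0.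
  by rewrite ler_wpM2l//; lra.
have h3 : (n%:R * n%:R - 1) * e <= `|D| * (2 * (n%:R - 1)) by rewrite /e mulrBr; lra.
have h4 : 0 < n%:R - 1 :> R by rewrite subr_gt0.
have : (n%:R - 1) * ((n%:R + 1) * e) <= (n%:R - 1) * (2 * `|D|).
  rewrite (_ : _ * _ = (n%:R * n%:R - 1) * e); last by ring.
  by apply: le_trans h3 _; rewrite le_eqVlt; apply/orP; left; apply/eqP; ring.
rewrite ler_pM2l// mulrDl mul1r => h5; lra.
Qed.

(** Method of types: an eigenvalue of a tensor power depends only on the multiplicities of the
    letters, each at most [k]. Hence there are at most (k+1)^d of them, the constant
    [type_count d k]. *)
Lemma vpow_type d (q : 'I_d -> R) k j :
  exists t : {ffun 'I_d -> 'I_k.+1}, vpow q k j = \prod_l q l ^+ t l.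
Proof.
suff [t [tk e]] : exists t : 'I_d -> nat,
    (forall l, (t l <= k)%N) /\ vpow q k j = \prod_l q l ^+ t l.
  exists [ffun l => inord (t l)]; rewrite e; apply: eq_bigr => l _.
  by rewrite ffunE inordK// ltnS.
elim: k j => [|k IH] j.
  by exists (fun=> 0%N); split => //; rewrite big1// => l _; rewrite expr0.
case: (mxtens_indexP j) => i j'; rewrite vpowS; have [t [tk ->]] := IH j'.
exists (fun l => (t l + (l == i))%N); split.
  by move=> l; rewrite (leq_trans (leq_add (tk l) (leq_b1 _)))// addn1.
rewrite [RHS](eq_bigr (fun l => q l ^+ t l * (if l == i then q l else 1))); last first.
  by move=> l _ /=; rewrite exprD; case: eqP; rewrite ?expr1 ?expr0.
by rewrite big_split /= -big_mkcond /= big_pred1_eq mulrC.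
Qed.

Definition type_count d k : R := (k.+1 ^ d)%:R.

Lemma type_count_gt0 d k : 0 < type_count d k. Proof. by rewrite ltr0n expn_gt0. Qed.
Lemma type_count_ge1 d k : 1 <= type_count d k. Proof. by rewrite ler1n expn_gt0. Qed.

Lemma type_countE d k : type_count d k = k.+1%:R `^ d%:R.
Proof. by rewrite /type_count natrX powR_mulrn. Qed.

Lemma pinching_tpow d (rho sigma : 'M[C]_d) k Uk p q : pd rho -> pd sigma ->
  pinched_pair (tpow rho k) (tpow sigma k) Uk p q ->
  forall w, qf (adj Uk *m tpow rho k *m Uk) w <=
    type_count d k * \sum_i nsq (w i 0) * p i.
Proof.
move=> hr [V [s [hV s0 eV]]] [hU eS _ pE off] w.
have hM := pd_psd (pd_conj (pd_tpow k hr) hU).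
have lab i : exists t : {ffun 'I_d -> 'I_k.+1}, q i = \prod_l s l ^+ t l.
  move: eS; rewrite eV sdiag_tpow => /esym eS.
  have [j ->] := sdiag_spec_sub hU (unitary_tpow k hV) eS i.
  exact: vpow_type.
have := pinching_le w hM lab off.
rewrite card_ffun !card_ord => /le_trans; apply.
rewrite ler_wpM2l ?ler0n//; apply: ler_sum => i _.
by rewrite pE.
Qed.

Lemma pinched_pair_q_gt0 d (rho sigma : 'M[C]_d) U p q : pd sigma ->
  pinched_pair rho sigma U p q -> forall i, 0 < q i.
Proof. by move=> hs [hU e _ _ _]; exact: pd_spectrum hs hU e. Qed.

Lemma pinched_pair_p_gt0 d (rho sigma : 'M[C]_d) U p q : pd rho ->
  pinched_pair rho sigma U p q -> forall i, 0 < p i.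
Proof. by move=> hr [hU _ _ pE _] i; exact: pair_p_gt0 hr hU pE i. Qed.

Section Level.
Variables (a b : nat) (r s U : 'M[C]_a) (r' s' U' : 'M[C]_b).
Variables (p q : 'I_a -> R) (p' q' : 'I_b -> R) (v : R).
Hypotheses (hr : pd r) (hs : pd s) (hr' : pd r') (hs' : pd s') (hK : kconv r s r' s').
Hypotheses (h : pinched_pair r s U p q) (h' : pinched_pair r' s' U' p' q').
Hypotheses (v1 : 1 <= v) (hv : forall w, qf (adj U *m r *m U) w <= v * \sum_i nsq (w i 0) * p i).

(* The Heisenberg image of the [j]-th basis effect of [U'], in the basis [U]; column [j] of
   [Z s] comes from the [s]-th Kraus operator. *)
Lemma kconv_vectors : exists (S : finType) (Z : S -> 'M[C]_(a, b)),
  [/\ \sum_s Z s *m adj (Z s) = 1%:M,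
      p' = (fun j => \sum_s qf (adj U *m r *m U) (col j (Z s))) &
      q' = (fun j => \sum_s \sum_i nsq (Z s i j) * q i)].
Proof.
have [hU eS _ pE _] := h; have [hU' eS' _ pE' _] := h'.
have UU : U *m adj U = 1%:M by [].
have UU' : U' *m adj U' = 1%:M by [].
have [S [K [tpK eR es]]] := hK; exists S, (fun t => adj U *m adj (K t) *m U').
have out (X : 'M[C]_a) t : adj (adj U *m adj (K t) *m U') *m (adj U *m X *m U) *m
    (adj U *m adj (K t) *m U') = adj U' *m (K t *m X *m adj (K t)) *m U'.
  rewrite !adjM !adjK !mulmxA; congr (_ *m _).
  rewrite -[_ *m U *m adj U]mulmxA UU mulmx1; congr (_ *m _).
  by rewrite -[_ *m U *m adj U]mulmxA UU mulmx1.
split.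
- have e t : adj U *m adj (K t) *m U' *m adj (adj U *m adj (K t) *m U') =
      adj U *m (adj (K t) *m K t) *m U.
    rewrite !adjM !adjK !mulmxA; congr (_ *m _ *m _).
    by rewrite -[_ *m U' *m adj U']mulmxA UU' mulmx1.
  rewrite (eq_bigr _ (fun t _ => e t)) -mulmx_suml -mulmx_sumr.
  by rewrite (tpK : \sum_t adj (K t) *m K t = _) mulmx1 (unitary_adj hU).
- apply/funext => j; apply: rC_inj; rewrite -pE' -eR /kraus mulmx_sumr mulmx_suml summxE rC_sum.
  apply: eq_bigr => t _; rewrite -out -form_col /qf; set N := adj U *m r *m U.
  set z := col j _; have : adj (adj z *m N *m z) = adj z *m N *m z.
    have aN : adj N = N by exact: adj_conj (pd_herm hr).
    by rewrite [LHS]adjM [adj (_ *m N)]adjM adjK aN mulmxA.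
  move=> /(congr1 (fun X : 'M[C]_1 => X 0 0)); rewrite adj_entry.
  by case: (_ 0 0) => x y [hy]; rewrite /rC /=; congr Complex; lra.
- apply/funext => j; apply: rC_inj.
  have -> : rC (q' j) = (adj U' *m s' *m U') j j by rewrite eS' conj_sdiag// rdiagE eqxx.
  rewrite -es /kraus mulmx_sumr mulmx_suml summxE rC_sum.
  apply: eq_bigr => t _; rewrite -out eS conj_sdiag// mxE rC_sum.
  by apply: eq_bigr => i _; rewrite rdiag_mulr adj_entry rCM rC_nsq; ring.
Qed.

Let p_eq : p = (fun i => complex.Re ((adj U *m r *m U) i i)).
Proof. by apply/funext => i; case: h => _ _ _ -> _. Qed.

Let hv' : forall w, qf (adj U *m r *m U) w <=
  v * \sum_i nsq (w i 0) * complex.Re ((adj U *m r *m U) i i).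
Proof. by move=> w; have := hv w; rewrite {1}p_eq. Qed.

Let v0 : 0 < v. Proof. exact: lt_le_trans v1. Qed.

Lemma level_gt1 x : 1 < x -> Qc x p' q' <= v `^ x * Qc x p q.
Proof.
move=> x1; have [S [Z [hZ ep eq]]] := kconv_vectors.
have hM := pd_psd (pd_conj hr (let: And5 hU _ _ _ _ := h in hU)).
have p0 := pinched_pair_p_gt0 hr h; have q0 := pinched_pair_q_gt0 hs h.
have p'0 := pinched_pair_p_gt0 hr' h'; have q'0 := pinched_pair_q_gt0 hs' h'.
move: p0 p'0 q'0; rewrite p_eq ep eq => p0 p'0 q'0.
exact: (dpi_level_gt1 hZ v0 p0 q0 hv' p'0 q'0 x1).
Qed.

Lemma level_lt1 x : 2^-1 <= x < 1 -> Qc x p q <= v * Qc x p' q'.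
Proof.
move=> x1; have [S [Z [hZ ep eq]]] := kconv_vectors.
have hM := pd_psd (pd_conj hr (let: And5 hU _ _ _ _ := h in hU)).
have p0 := pinched_pair_p_gt0 hr h; have q0 := pinched_pair_q_gt0 hs h.
have p'0 := pinched_pair_p_gt0 hr' h'; have q'0 := pinched_pair_q_gt0 hs' h'.
move: p0 p'0 q'0; rewrite p_eq ep eq => p0 p'0 q'0.
exact: (dpi_level_lt1 hZ hM v0 p0 q0 hv' p'0 q'0 x1 v1).
Qed.

End Level.

Lemma Qt_gt0 a d (rho sigma : 'M[C]_d) : (0 < d)%N -> pd rho -> pd sigma -> 0 < Qt a rho sigma.
Proof.
move=> d0 hr [V [q [hV q0 ->]]].
have [T [W [x [hT hW x0 eT _]]]] := sandwich_spectrum a hr hV q0.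
rewrite (Qt_sdiag hT eT) (bigD1 (Ordinal d0))//= ltr_wpDr ?powR_gt0// sumr_ge0// => i _.
exact: powR_ge0.
Qed.

Section DPI.
Variables (a b : nat) (r s : 'M[C]_a) (r' s' : 'M[C]_b).
Hypotheses (a0 : (0 < a)%N) (b0 : (0 < b)%N).
Hypotheses (hr : pd r) (hs : pd s) (hr' : pd r') (hs' : pd s') (hK : kconv r s r' s').

Let level k : exists U p q U' p' q',
  [/\ pinched_pair (tpow r k) (tpow s k) U p q, pinched_pair (tpow r' k) (tpow s' k) U' p' q',
      (forall w, qf (adj U *m tpow r k *m U) w <= type_count a k * \sum_i nsq (w i 0) * p i) &
      (forall w, qf (adj U' *m tpow r' k *m U') w <= type_count b k * \sum_i nsq (w i 0) * p' i)].
Proof.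
have [U [p [q h]]] := pinched_pair_exists (pd_herm (pd_tpow k hr)) (pd_herm (pd_tpow k hs)).
have [U' [p' [q' h']]] := pinched_pair_exists (pd_herm (pd_tpow k hr')) (pd_herm (pd_tpow k hs')).
exists U, p, q, U', p', q'; split => //.
  exact: pinching_tpow hr hs h.
exact: pinching_tpow hr' hs' h'.
Qed.

Lemma Qt_dpi_gt1 x : 1 < x -> Qt x r' s' <= Qt x r s.
Proof.
(* The exponent collects the type counts (k+1)^b and (k+1)^a of target and source, each raised to
   the power x. *)
move=> x1; apply: (@poly_growth_le _ _ (b%:R * x + a%:R * x)); do ?exact: Qt_gt0.
move=> k; have [U [p [q [U' [p' [q' [h h' hv hv']]]]]]] := level k.
have hrk := pd_tpow k hr; have hsk := pd_tpow k hs.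
have hrk' := pd_tpow k hr'; have hsk' := pd_tpow k hs'.
have q0 := pinched_pair_q_gt0 hsk h; have q0' := pinched_pair_q_gt0 hsk' h'.
have [hU eS _ pE _] := h; have [hU' eS' _ pE' _] := h'.
rewrite -!Qt_tpow//.
have up := Qt_upper hrk' hU' q0' pE' (type_count_gt0 _ _) hv' (ltW x1); rewrite -eS' in up.
have lo := Qt_ge_diag hrk hU q0 pE (ltW x1); rewrite -eS in lo.
have lv := level_gt1 hrk hsk hrk' hsk' (kconv_tpow k hK) h h' (type_count_ge1 _ _) hv x1.
have := le_trans lv (ler_wpM2l (powR_ge0 (type_count a k) x) lo).
move=> /(ler_wpM2l (powR_ge0 (type_count b k) x))/(le_trans up)/le_trans; apply.
rewrite mulrA ler_wpM2r//; first by rewrite Qt_tpow// exprn_ge0// ltW// Qt_gt0.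
by rewrite !type_countE -!powRrM powRD// pnatr_eq0 implybT.
Qed.

Lemma Qt_dpi_lt1 x : 2^-1 <= x < 1 -> Qt x r s <= Qt x r' s'.
Proof.
move=> hx; have [xh x1] := andP hx; have x0 : 0 < x by apply: lt_le_trans xh; rewrite invr_gt0.
(* The source type count enters with power 1, from [level_lt1], the target one with power 1 - x,
   from [Qt_lower]. *)
apply: (@poly_growth_le _ _ (a%:R + b%:R * (1 - x))); do ?exact: Qt_gt0.
move=> k; have [U [p [q [U' [p' [q' [h h' hv hv']]]]]]] := level k.
have hrk := pd_tpow k hr; have hsk := pd_tpow k hs.
have hrk' := pd_tpow k hr'; have hsk' := pd_tpow k hs'.
have q0 := pinched_pair_q_gt0 hsk h; have q0' := pinched_pair_q_gt0 hsk' h'.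
have [hU eS _ pE _] := h; have [hU' eS' _ pE' _] := h'.
have x01 : 0 < x <= 1 by rewrite x0 ltW.
have x01' : 0 < x < 1 by rewrite x0.
rewrite -!Qt_tpow//.
have up := Qt_le_diag hrk hU q0 pE x01; rewrite -eS in up.
have lo := Qt_lower hrk' hU' q0' pE' (type_count_gt0 _ _) hv' x01'; rewrite -eS' in lo.
have lv := level_lt1 hrk hsk hrk' hsk' (kconv_tpow k hK) h h' (type_count_ge1 _ _) hv hx.
have := le_trans (le_trans up lv) (ler_wpM2l (ltW (type_count_gt0 _ _)) lo).
move=> /le_trans; apply.
rewrite mulrA ler_wpM2r//; first by rewrite Qt_tpow// exprn_ge0// ltW// Qt_gt0.
by rewrite !type_countE -!powRrM powRD// pnatr_eq0 implybT.
Qed.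

End DPI.
End Asymptotics.

(** * The limit of order one *)

Section LimitAtOne.
Variable R : realType.
Local Notation C := R[i].

Lemma tr_two_sdiag n (U V : 'M[C]_n) A B : unitary U -> unitary V ->
  \tr (sdiag U A *m sdiag V B) = rC (\sum_i \sum_j nsq ((adj V *m U) i j) * A j * B i).
Proof.
move=> hU hV.
have gen (D E : 'M[C]_n) : \tr ((U *m D *m adj U) *m (V *m E *m adj V)) =
    \tr ((adj V *m U) *m D *m (adj U *m V) *m E).
  by rewrite mulmxA mxtrace_mulC !mulmxA.
rewrite /sdiag gen -[adj U *m V]adjK adjM adjK -/(sdiag (adj V *m U) A).
rewrite /mxtrace rC_sum; apply: eq_bigr => i _.
by rewrite rdiag_mulr sdiag_diagE -rCM mulr_suml.
Qed.

Lemma tr_tpow n (X : 'M[C]_n) k : \tr (tpow X k) = (\tr X) ^+ k.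
Proof. by elim: k => [|k IH]; rewrite /= ?mxtrace1// tr_tens IH exprS. Qed.

(** The trace of the Petz divergence: an explicit double sum over the two spectra, hence easy to
    differentiate at order one. *)
Definition petz a n (rho sigma : 'M[C]_n) : R := retr (mpow rho a *m mpow sigma (1 - a)).

Lemma mpow_sdiag n (U : 'M[C]_n) p a : unitary U -> mpow (sdiag U p) a = sdiag U (fun i => p i `^ a).
Proof. exact: mfun_sdiag. Qed.

Lemma petzE a n (U V : 'M[C]_n) r s : unitary U -> unitary V ->
  petz a (sdiag U r) (sdiag V s) =
  \sum_i \sum_j nsq ((adj V *m U) i j) * r j `^ a * s i `^ (1 - a).
Proof. by move=> hU hV; rewrite /petz /retr !mpow_sdiag// tr_two_sdiag. Qed.

Lemma mpow_tpow n (A : 'M[C]_n) a k : pd A -> mpow (tpow A k) a = tpow (mpow A a) k.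
Proof.
move=> [U [p [hU p0 ->]]]; rewrite sdiag_tpow !mpow_sdiag//; last exact: unitary_tpow.
by rewrite sdiag_tpow; apply: eq_sdiag => i; rewrite vpow_powR.
Qed.

Lemma petz_tpow a n (rho sigma : 'M[C]_n) k : pd rho -> pd sigma ->
  petz a (tpow rho k) (tpow sigma k) = petz a rho sigma ^+ k.
Proof.
move=> hr hs; rewrite /petz !mpow_tpow// -tpowM /retr tr_tpow.
have [U [r [hU r0 ->]]] := hr; have [V [s [hV s0 ->]]] := hs.
by rewrite !mpow_sdiag// tr_two_sdiag// rCE -rmorphXn.
Qed.

Lemma petz_gt0 a n (rho sigma : 'M[C]_n) : (0 < n)%N -> pd rho -> pd sigma -> 0 < petz a rho sigma.
Proof.
move=> n0 [U [r [hU r0 ->]]] [V [s [hV s0 ->]]]; rewrite petzE//.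
have hW : unitary (adj V *m U) by apply: unitaryM => //; exact: unitaryV.
rewrite (bigD1 (Ordinal n0))//= ltr_wpDr//.
  apply: sumr_ge0 => i _; apply: sumr_ge0 => j _.
  by rewrite !mulr_ge0 ?nsq_ge0 ?powR_ge0.
rewrite -mulr_suml mulr_gt0 ?powR_gt0//; apply: sum_gt0 => [j|j|]; rewrite ?powR_gt0//.
  exact: nsq_ge0.
by rewrite nsq_unitary_row.
Qed.

Lemma pair_diag n (U V : 'M[C]_n) (rho : 'M[C]_n) r p : rho = sdiag V r ->
  (forall i, (adj U *m rho *m U) i i = rC (p i)) ->
  forall i, p i = \sum_j nsq ((adj U *m V) i j) * r j.
Proof.
move=> -> pE i; apply: rC_inj; rewrite -pE -sdiag_diagE.
by rewrite /sdiag adjM adjK !mulmxA.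
Qed.

(* Convexity in the pinched basis compares the two divergences up to the number of types, a
   factor which disappears on tensor powers. *)
Section PetzBounds.
Variables (n : nat) (rho sigma : 'M[C]_n).
Hypotheses (n0 : (0 < n)%N) (hr : pd rho) (hs : pd sigma).

(** An instance of the Araki-Lieb-Thirring inequality. In the pinched basis the diagonal entries of
    [rho] are averages of its eigenvalues, and Jensen compares the two traces up to the type
    count. *)
Lemma Qt_le_petz a : 1 < a -> Qt a rho sigma <= petz a rho sigma.
Proof.
move=> a1; apply: (@poly_growth_le _ _ _ (n%:R * a)); rewrite ?Qt_gt0 ?petz_gt0// => k.
have hrk := pd_tpow k hr; have hsk := pd_tpow k hs.
have [U [p [q h]]] := pinched_pair_exists (pd_herm hrk) (pd_herm hsk).
have q0 := pinched_pair_q_gt0 hsk h; have [hU eS _ pE _] := h.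
have up := Qt_upper hrk hU q0 pE (type_count_gt0 _ _ _) (pinching_tpow hr hs h) (ltW a1).
rewrite -eS in up; rewrite -Qt_tpow// -petz_tpow//; apply: le_trans up _.
rewrite type_countE -powRrM ler_wpM2l ?powR_ge0//.
have [V [r [hV r0 eV]]] := hrk; rewrite eS eV petzE//.
have hW : unitary (adj U *m V) by apply: unitaryM => //; exact: unitaryV.
apply: ler_sum => i _; rewrite -mulr_suml ler_wpM2r ?powR_ge0// (pair_diag eV pE).
apply: jensen_ge; rewrite ?nsq_unitary_row ?(ltW a1)// => j; exact: nsq_ge0.
Qed.

Lemma petz_le_Qt a : 0 < a < 1 -> petz a rho sigma <= Qt a rho sigma.
Proof.
move=> ha; have [a0 a1] := andP ha.
apply: (@poly_growth_le _ _ _ (n%:R * (1 - a))); rewrite ?Qt_gt0 ?petz_gt0// => k.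
have hrk := pd_tpow k hr; have hsk := pd_tpow k hs.
have [U [p [q h]]] := pinched_pair_exists (pd_herm hrk) (pd_herm hsk).
have q0 := pinched_pair_q_gt0 hsk h; have [hU eS _ pE _] := h.
have up := Qt_lower hrk hU q0 pE (type_count_gt0 _ _ _) (pinching_tpow hr hs h) ha.
rewrite -eS in up; rewrite -Qt_tpow// -petz_tpow//.
rewrite powRrM -type_countE; apply: le_trans up.
have [V [r [hV r0 eV]]] := hrk; rewrite eS eV petzE//.
have hW : unitary (adj U *m V) by apply: unitaryM => //; exact: unitaryV.
apply: ler_sum => i _; rewrite -mulr_suml ler_wpM2r ?powR_ge0// (pair_diag eV pE).
apply: jensen_le; rewrite ?nsq_unitary_row ?(ltW a0) ?(ltW a1)// => j; exact: nsq_ge0.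
Qed.

End PetzBounds.

Lemma conj_sdiag_adj n (U T : 'M[C]_n) x : adj U *m sdiag T x *m U = sdiag (adj U *m T) x.
Proof.
have gen D : adj U *m (T *m D *m adj T) *m U = (adj U *m T) *m D *m adj (adj U *m T).
  by rewrite adjM adjK !mulmxA.
exact: gen.
Qed.

Lemma conj_prod3 n (U : 'M[C]_n) (hU : unitary U) S X :
  adj U *m (S *m X *m S) *m U = (adj U *m S *m U) *m (adj U *m X *m U) *m (adj U *m S *m U).
Proof.
have UU : U *m adj U = 1%:M := hU.
rewrite !mulmxA -[adj U *m S *m U *m adj U]mulmxA UU mulmx1.
by rewrite -[_ *m X *m U *m adj U]mulmxA UU mulmx1.
Qed.

Section Basis.
Variables (n : nat) (U V : 'M[C]_n) (r s : 'I_n -> R).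
Hypotheses (hU : unitary U) (hV : unitary V) (hr : pmf r) (hs : pmf s).
Let c i j : R := nsq ((adj V *m U) i j).

Let hW : unitary (adj V *m U). Proof. by apply: unitaryM => //; exact: unitaryV. Qed.
Let c0 i j : 0 <= c i j. Proof. exact: nsq_ge0. Qed.
Let c_col j : \sum_i c i j = 1. Proof. exact: nsq_unitary_col. Qed.

(* [basis_mean a] is the diagonal of the sandwich operator in the eigenbasis of [rho]; together
   with [petz] it squeezes [Qt], and both have derivative [relent] at [a = 1]. *)
Definition basis_mean a j : R := r j * \sum_i c i j * s i `^ ((1 - a) / a).
Definition basis_Q a : R := \sum_j basis_mean a j `^ a.

Lemma basis_mean_gt0 a j : 0 < basis_mean a j.
Proof.
rewrite mulr_gt0 ?(proj1 hr)//; apply: sum_gt0 => [i|i|]; rewrite ?c_col ?powR_gt0 ?(proj1 hs)//.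
Qed.

Lemma sandwich_basis a : exists (W : 'M[C]_n) x, [/\ unitary W, (forall i, 0 < x i),
  Qt a (sdiag U r) (sdiag V s) = \sum_i x i `^ a &
  forall j, complex.Re (sdiag W x j j) = basis_mean a j].
Proof.
have pr : pd (sdiag U r) by exists U, r; split => //; case: hr.
have [T [V' [x [hT hV' x0 eT _]]]] := sandwich_spectrum a pr hV (proj1 hs).
exists (adj U *m T), x; split => //.
- by apply: unitaryM => //; exact: unitaryV.
- exact: Qt_sdiag hT eT.
move=> j.
rewrite -conj_sdiag_adj -eT /sandwich mpow_sdiag// /msqrt mfun_sdiag//.
have -> := conj_prod3 hU (sdiag U (fun i => Num.sqrt (r i))) (sdiag V (fun i => s i `^ ((1 - a) / a))).
rewrite conj_sdiag// conj_sdiag_adj rdiag_mulr rdiag_mull.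
rewrite sdiag_diagE -!rCM Re_rC mulrAC -expr2 sqr_sqrtr ?(ltW (proj1 hr j))//.
congr (_ * _); apply: eq_bigr => i _; congr (_ * _).
by rewrite /c -nsq_adj adjM adjK.
Qed.

Lemma basis_Q_le a : 1 <= a -> basis_Q a <= Qt a (sdiag U r) (sdiag V s).
Proof.
move=> a1; have [W [x [hW' x0 -> e]]] := sandwich_basis a.
apply: le_trans (peierls_ge hW' x0 a1).
by apply: ler_sum => j _; rewrite -e.
Qed.

Lemma basis_Q_ge a : 0 <= a <= 1 -> Qt a (sdiag U r) (sdiag V s) <= basis_Q a.
Proof.
move=> a1; have [W [x [hW' x0 -> e]]] := sandwich_basis a.
apply: le_trans (peierls_le hW' x0 a1) _.
by apply: ler_sum => j _; rewrite -e.
Qed.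

(** Umegaki's relative entropy Tr rho (ln rho - ln sigma), expressed through the overlaps [c] of the
    two eigenbases. *)
Definition relent : R := \sum_i \sum_j c i j * r j * (ln (r j) - ln (s i)).

Lemma petz_cvg1 : ((fun a => (a - 1)^-1 * ln (petz a (sdiag U r) (sdiag V s))) @ dnbhs (1 : R)
  --> relent)%classic.
Proof.
apply: ln_quotient_cvg1.
  rewrite petzE// exchange_big /= -[RHS](proj2 hr); apply: eq_bigr => j _.
  under eq_bigr => i _ do rewrite subrr powRr0 mulr1 (powRr1 (ltW (proj1 hr j))).
  by rewrite -mulr_suml c_col mul1r.
have -> : (fun a => petz a (sdiag U r) (sdiag V s)) =
    \sum_(i < n) \sum_(j < n) (fun a => c i j * (r j `^ a * s i `^ (1 - a))).
  apply/funext => a; rewrite petzE// fct_sumE; apply: eq_bigr => i _.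
  by rewrite fct_sumE; apply: eq_bigr => j _; rewrite mulrA.
apply: is_derive_sum => i; apply: is_derive_sum => j.
have h : is_derive (1 : R) 1 (fun a => c i j * (r j `^ a * s i `^ (1 - a))) _ :=
  is_deriveZ (c i j) (is_deriveM (is_derive_powRr 1 (proj1 hr j)) (is_derive_powR_subr 1 (proj1 hs i))).
apply: (is_derive_eq h); rewrite /GRing.scale /= subrr powRr0 powRr1 ?(ltW (proj1 hr j))//; ring.
Qed.

Lemma basis_Q_cvg1 : ((fun a => (a - 1)^-1 * ln (basis_Q a)) @ dnbhs (1 : R) --> relent)%classic.
Proof.
have m1 j : basis_mean 1 j = r j.
  rewrite /basis_mean; under eq_bigr do rewrite subrr mul0r powRr0 mulr1.
  by rewrite c_col mulr1.
apply: ln_quotient_cvg1.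
  rewrite /basis_Q -[RHS](proj2 hr); apply: eq_bigr => j _.
  by rewrite m1 powRr1// ltW// (proj1 hr).
have -> : basis_Q = \sum_(j < n) (fun a => expR (a * ln (basis_mean a j))).
  apply/funext => a; rewrite fct_sumE; apply: eq_bigr => j _.
  by rewrite /powR gt_eqF// basis_mean_gt0.
have -> : relent = \sum_j r j * (ln (r j) - \sum_i c i j * ln (s i)).
  rewrite /relent exchange_big /=; apply: eq_bigr => j _.
  under eq_bigr do rewrite mulrAC mulrC mulrBr.
  by rewrite -mulr_sumr sumrB -mulr_suml c_col mul1r.
apply: is_derive_sum => j.
have dt : is_derive (1 : R) 1 (fun a : R => (1 - a) / a) (-1).
  have d1 : is_derive (1 : R) 1 (fun a : R => 1 - a) (-1).
    have -> : (fun a : R => 1 - a) = cst 1 - id by apply/funext.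
    by apply: is_derive_eq; rewrite sub0r.
  have d2 : is_derive (1 : R) 1 (fun a : R => a^-1) (-1).
    have := @is_deriveV R id 1 1 1 (oner_neq0 _) (is_derive_id _ _).
    by move=> h; apply: (is_derive_eq h); rewrite expr1n invr1 /GRing.scale /= mulr1.
  have h : is_derive (1 : R) 1 (fun a : R => (1 - a) / a) _ := is_deriveM d1 d2.
  by apply: (is_derive_eq h); rewrite /GRing.scale /= subrr mul0r add0r invr1 mul1r.
have dm : is_derive (1 : R) 1 (fun a => basis_mean a j) (- (r j * \sum_i c i j * ln (s i))).
  have -> : (fun a => basis_mean a j) =
      r j \*: \sum_(i < n) (fun a => c i j * s i `^ ((1 - a) / a)).
    by apply/funext => a; rewrite /= fct_sumE.
  have h : is_derive (1 : R) 1 (\sum_(i < n) (fun a => c i j * s i `^ ((1 - a) / a)))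
      (\sum_(i < n) (- (c i j * ln (s i)))).
    apply: is_derive_sum => i.
    have h1 := @is_derive1_comp _ (powR (s i)) (fun a : R => (1 - a) / a) 1 _ _
      (is_derive_powRr _ (proj1 hs i)) dt.
    have h2 : is_derive (1 : R) 1 (fun a => c i j * s i `^ ((1 - a) / a)) _ := is_deriveZ (c i j) h1.
    by apply: (is_derive_eq h2); rewrite /GRing.scale /= subrr mul0r powRr0 mul1r mulrN1 mulrN.
  apply: (is_derive_eq (is_deriveZ (r j) h)).
  by rewrite sumrN /GRing.scale /= mulrN.
have dl : is_derive (1 : R) 1 (fun a => ln (basis_mean a j)) (- \sum_i c i j * ln (s i)).
  have h1 := @is_derive1_comp _ (@ln R) (fun a => basis_mean a j) 1 _ _
    (is_derive1_ln (basis_mean_gt0 1 j)) dm.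
  apply: (is_derive_eq h1); rewrite m1 mulrN mulrA mulVf ?mul1r// gt_eqF//.
  exact: (proj1 hr).
have dp : is_derive (1 : R) 1 (fun a => a * ln (basis_mean a j)) (ln (r j) - \sum_i c i j * ln (s i)).
  have h1 : is_derive (1 : R) 1 (fun a => a * ln (basis_mean a j)) _ :=
    is_deriveM (is_derive_id (1 : R) 1) dl.
  by apply: (is_derive_eq h1); rewrite /GRing.scale /= m1 mul1r mulr1 addrC.
have h1 := @is_derive1_comp _ expR (fun a => a * ln (basis_mean a j)) 1 _ _ (is_derive_expR _) dp.
by apply: (is_derive_eq h1); rewrite m1 mul1r lnK// posrE (proj1 hr).
Qed.

End Basis.

Lemma Dform_ge_half n (rho sigma : 'M[C]_n) a : 2^-1 <= a ->
  Dform rho sigma a = (a - 1)^-1 * ln (Qt a rho sigma).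
Proof. by move=> ha; rewrite /Dform ha. Qed.

Lemma near1_half : (\forall a \near dnbhs (1 : R), 2^-1 <= a /\ a != 1)%classic.
Proof.
near=> a; split; last by near: a; exact: nbhs_dnbhs_neq.
near: a; apply: nbhs_dnbhs; near=> a; apply/ltW.
by near: a; apply: lt_nbhsr; rewrite invf_lt1// ltr1n.
Unshelve. all: by end_near.
Qed.

(** Above order one [basis_Q] <= [Qt] <= [petz]; below, these inequalities and the sign of a - 1 are
    both reversed. The divergences are therefore squeezed in the same order on the two sides. *)
Lemma Dform_cvg1 n (U V : 'M[C]_n) r s : (0 < n)%N -> unitary U -> unitary V -> pmf r -> pmf s ->
  (Dform (sdiag U r) (sdiag V s) @ dnbhs (1 : R) --> relent U V r s)%classic.
Proof.
move=> n0 hU hV hr hs.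
have pr : pd (sdiag U r) by exists U, r; split => //; case: hr.
have ps : pd (sdiag V s) by exists V, s; split => //; case: hs.
apply: (squeeze_cvgr _ (basis_Q_cvg1 hU hV hr hs) (petz_cvg1 hU hV hr hs)).
near=> a.
have [ah an] : 2^-1 <= a /\ a != 1 by near: a; exact: near1_half.
have a0 : 0 < a by apply: lt_le_trans ah; rewrite invr_gt0.
rewrite Dform_ge_half//.
have Q0 := Qt_gt0 a n0 pr ps; have P0 := petz_gt0 a n0 pr ps.
have B0 : 0 < basis_Q U V r s a.
  rewrite /basis_Q (bigD1 (Ordinal n0))//= ltr_wpDr ?powR_gt0 ?basis_mean_gt0//.
  by apply: sumr_ge0 => i _; exact: powR_ge0.
have [a1|a1|a1] := ltgtP a 1; last by rewrite a1 eqxx in an.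
  rewrite !(ler_nM2l _) ?invr_lt0 ?subr_lt0// !ler_ln ?posrE//.
  by rewrite basis_Q_ge ?petz_le_Qt ?a0 ?(ltW a0) ?(ltW a1).
rewrite !(ler_pM2l _) ?invr_gt0 ?subr_gt0// !ler_ln ?posrE//.
by rewrite basis_Q_le ?Qt_le_petz// ltW.
Unshelve. all: by end_near.
Qed.

End LimitAtOne.

(** * Upper bound on the rate *)

Section UpperBound.
Variable R : realType.
Local Notation C := R[i].

Definition fstate n (A : 'M[C]_n) := exists (U : 'M[C]_n) p, [/\ unitary U, pmf p & A = sdiag U p].

Lemma fstate_pd n (A : 'M[C]_n) : fstate A -> pd A.
Proof. by move=> [U [p [hU [p0 _] ->]]]; exists U, p. Qed.

Lemma fstate_tr n (A : 'M[C]_n) : fstate A -> \tr A = 1.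
Proof. by move=> [U [p [hU [_ p1] ->]]]; rewrite tr_sdiag// p1. Qed.

Lemma fstate_inh n (A : 'M[C]_n) : fstate A -> (0 < n)%N.
Proof.
move=> [U [p [_ hp _]]]; have [i _] := pmf_inh hp.
exact: leq_ltn_trans (leq0n i) (ltn_ord i).
Qed.

Lemma fstate_tpow n (A : 'M[C]_n) k : fstate A -> fstate (tpow A k).
Proof.
move=> [U [p [hU hp ->]]]; exists (tpow U k), (vpow p k).
by split; [exact: unitary_tpow|exact: vpow_pmf|exact: sdiag_tpow].
Qed.

Lemma kconv_trace a (r s : 'M[C]_a) : \tr r = 1 -> \tr s = 1 ->
  kconv r s (1%:M : 'M[C]_1) (1%:M : 'M[C]_1).
Proof.
move=> hr hs.
have K X : kraus (fun i : 'I_a => delta_mx 0 i : 'M[C]_(1, a)) X = (\tr X)%:M.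
  apply/matrixP => i j; rewrite !ord1 /kraus summxE [RHS]mxE eqxx mulr1n.
  apply: eq_bigr => l _; rewrite -rowE mxE (bigD1 l)//= adj_entry !mxE !eqxx /=.
  rewrite big1 => [|t tl]; last first.
    by rewrite adj_entry !mxE (negPf tl) cconjE conjC0 mulr0.
  by rewrite cconjE conjC1 mulr1 addr0.
exists 'I_a, (fun i => delta_mx 0 i); split; rewrite ?K ?hr ?hs// /tp.
apply/matrixP => i j; rewrite summxE (bigD1 i)//= big1 ?addr0 => [|l li].
  by rewrite mxE big_ord1 adj_entry !mxE !eqxx cconjE conjC1 mul1r eq_sym.
by rewrite mxE big_ord1 adj_entry !mxE [i == l]eq_sym (negPf li) andbF cconjE conjC0 mul0r.
Qed.

Lemma Dform_dpi x a b (r s : 'M[C]_a) (r' s' : 'M[C]_b) : 2^-1 <= x -> x != 1 ->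
  fstate r -> fstate s -> fstate r' -> fstate s' -> kconv r s r' s' ->
  Dform r' s' x <= Dform r s x.
Proof.
move=> xh x1 hr hs hr' hs' hK; rewrite !Dform_ge_half//.
have Q0 := Qt_gt0 x (fstate_inh hr) (fstate_pd hr) (fstate_pd hs).
have Q0' := Qt_gt0 x (fstate_inh hr') (fstate_pd hr') (fstate_pd hs').
have [x1'|x1'|e] := ltgtP x 1; last by rewrite e eqxx in x1.
  rewrite ler_nM2l ?invr_lt0 ?subr_lt0// ler_ln ?posrE//.
  by apply: Qt_dpi_lt1 hK _ _; rewrite ?(fstate_inh hr) ?(fstate_inh hr') ?xh//; exact: fstate_pd.
rewrite ler_pM2l ?invr_gt0 ?subr_gt0// ler_ln ?posrE//.
by apply: Qt_dpi_gt1 hK _ _; rewrite ?(fstate_inh hr) ?(fstate_inh hr')//; exact: fstate_pd.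
Qed.

Lemma Dform_tpow x a (r s : 'M[C]_a) k : 2^-1 <= x -> fstate r -> fstate s ->
  Dform (tpow r k) (tpow s k) x = k%:R * Dform r s x.
Proof.
move=> xh hr hs; rewrite !Dform_ge_half// Qt_tpow; do ?exact: fstate_pd.
rewrite lnXn ?Qt_gt0 ?(fstate_inh hr)//; do ?exact: fstate_pd.
by rewrite -[_ *+ k]mulr_natl mulrCA.
Qed.

(** Data processing under the trace map, whose output is the zeroth tensor power, of divergence
    0. *)
Lemma Dform_ge0 x a (r s : 'M[C]_a) : 2^-1 <= x -> x != 1 -> fstate r -> fstate s ->
  0 <= Dform r s x.
Proof.
move=> xh x1 hr hs; have := Dform_tpow 0 xh hr hs; rewrite mul0r => <-.
apply: Dform_dpi => //; do ?exact: fstate_tpow.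
exact: kconv_trace (fstate_tr hr) (fstate_tr hs).
Qed.

Lemma Dform_swap x a (r s : 'M[C]_a) : x < 2^-1 ->
  Dform r s x = (x - 1)^-1 * ln (Qt (1 - x) s r).
Proof.
move=> xh; rewrite /Dform leNgt xh /= /Qt /sandwich.
by rewrite subKr.
Qed.

(** The factor is the same for source and target and cancels in [eratio], even when it is
    negative. *)
Lemma Dform_swap_scale x a (r s : 'M[C]_a) : x < 2^-1 -> x != 0 ->
  Dform r s x = x / (1 - x) * Dform s r (1 - x).
Proof.
move=> xh x0; rewrite Dform_swap// Dform_ge_half; last by lra.
have -> : 1 - x - 1 = - x by ring.
have x1 : 1 - x != 0 by rewrite subr_eq0 gt_eqF//; lra.
have x2 : x - 1 != 0 by rewrite subr_eq0 lt_eqF//; lra.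
by field; rewrite x0 x2 x1.
Qed.

Lemma Qt1 a (r s : 'M[C]_a) : fstate r -> fstate s -> Qt 1 r s = 1.
Proof.
move=> hr [V [q [hV [q0 _] ->]]].
have [T [W [x [hT hW x0 eT _]]]] := sandwich_spectrum 1 (fstate_pd hr) hV q0.
rewrite (Qt_sdiag hT eT); under eq_bigr do rewrite powRr1 ?(ltW (x0 _))//.
apply: rC_inj; rewrite -(tr_sdiag x hT) -eT /sandwich subrr mul0r mpow_sdiag//.
rewrite sdiag1//; last by move=> i; rewrite powRr0.
have [U [p [hU [p0 p1] ->]]] := hr; rewrite /msqrt mfun_sdiag// mulmx1 mul_sdiag//.
rewrite tr_sdiag//; congr rC; rewrite -[RHS]p1; apply: eq_bigr => i _.
by rewrite -expr2 sqr_sqrtr// ltW.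
Qed.

Lemma Dform0 a (r s : 'M[C]_a) : fstate r -> fstate s -> Dform r s 0 = 0.
Proof. by move=> hr hs; rewrite Dform_swap ?invr_gt0// subr0 Qt1// ln1 mulr0. Qed.

Lemma eratio_scale (c x y : R) : c != 0 -> eratio (c * x) (c * y) = eratio x y.
Proof.
move=> c0; rewrite /eratio mulf_eq0 (negPf c0) /=; case: eqP => // _.
by congr _%:E; rewrite -mulf_div divff// mul1r.
Qed.

Lemma Rstar0_le d1 d2 (r1 s1 : 'M[C]_d1) (r2 s2 : 'M[C]_d2) n (x y : R) :
  (0 < n)%N -> 0 <= y ->
  (forall m, kconv (tpow r1 n) (tpow s1 n) (tpow r2 m) (tpow s2 m) -> m%:R * y <= n%:R * x) ->
  (Rstar0 r1 s1 r2 s2 n <= eratio x y)%E.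
Proof.
move=> n0 y0 h; apply: ge_ereal_sup => _ [m /dconv_kconv/h hm <-].
rewrite /eratio; case: eqP => [_|/eqP y1]; first exact: leey.
have yp : 0 < y by rewrite lt_neqAle eq_sym y1.
by rewrite lee_fin ler_pdivrMr ?ltr0n// mulrAC ler_pdivlMr// [x * _]mulrC.
Qed.

Lemma foldr_max_ge (x0 : R) s y : y \in s -> y <= foldr Num.max x0 s.
Proof.
elim: s => //= z s IH; rewrite inE => /orP[/eqP ->|/IH h]; first by rewrite le_max lexx.
by rewrite le_max h orbT.
Qed.

Lemma foldr_max_mem (x0 : R) s : foldr Num.max x0 s \in x0 :: s.
Proof.
elim: s => [|z s IH] /=; first by rewrite inE eqxx.
rewrite maxEle; case: ifP => _; last by rewrite !inE eqxx orbT.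
by move: IH; rewrite !inE => /orP[->|->]; rewrite ?orbT.
Qed.

Lemma lmax_sdiag n (T : 'M[C]_n) x : (0 < n)%N -> unitary T ->
  (forall i, x i <= lmax (sdiag T x)) /\ exists i, lmax (sdiag T x) = x i.
Proof.
move=> n0 hT; rewrite /lmax /eigs; have [[V q] -> [/= hV e]] := sdecP x hT.
split=> [i|].
  have [j ->] := sdiag_spec_sub hT hV e i; apply: foldr_max_ge.
  by apply: map_f; rewrite mem_enum.
set s := map _ _; have hs : (0 < size s)%N by rewrite size_map size_enum_ord.
have : foldr Num.max (head 0 s) s \in s.
  have := foldr_max_mem (head 0 s) s; rewrite inE => /orP[/eqP ->|//].
  by case: s hs => //= z s _; rewrite inE eqxx.
move=> /mapP[j _ ->]; have [i ->] := sdiag_spec_sub hV hT (esym e) j.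
by exists i.
Qed.

Lemma vpow_le n (x : 'I_n -> R) l k j : (forall i, 0 <= x i <= l) -> 0 <= vpow x k j <= l ^+ k.
Proof.
move=> h; elim: k j => [|k IH] j /=; first by rewrite expr0 ler01 lexx.
have /andP[h1 h2] := h (mxtens_unindex j).1; have /andP[h3 h4] := IH (mxtens_unindex j).2.
by rewrite exprS mulr_ge0// ler_pM.
Qed.

Lemma vpow_diag n (x : 'I_n -> R) i k : exists j, vpow x k j = x i ^+ k.
Proof.
elim: k => [|k [j IH]]; first by exists ord0.
by exists (mxtens_index (i, j)); rewrite vpowS exprS IH.
Qed.

Lemma lmax_tpow n (M : 'M[C]_n) k : (0 < n)%N -> psd M -> lmax (tpow M k) = lmax M ^+ k.
Proof.
move=> n0 /psd_spectral[T [x [hT x0 ->]]]; rewrite sdiag_tpow.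
have [h1 [i h2]] := lmax_sdiag x n0 hT.
have nk : (0 < pw n k)%N by elim: k => //= k IH; rewrite muln_gt0 n0.
have [h3 [j h4]] := lmax_sdiag (vpow x k) nk (unitary_tpow k hT).
apply/eqP; rewrite eq_le; apply/andP; split.
  by rewrite h4; case/andP: (@vpow_le n x (lmax (sdiag T x)) k j (fun i => introT andP (conj (x0 i) (h1 i)))).
have [j' e] := vpow_diag x i k.
by rewrite h2 -e.
Qed.

Definition dominates (l : R) n (r s : 'M[C]_n) := forall w, qf r w <= l * qf s w.
Definition maxrel n (r s : 'M[C]_n) := mpow s (- 2^-1) *m r *m mpow s (- 2^-1).

Lemma qf_conj a b (A : 'M[C]_(b, a)) X w : qf (A *m X *m adj A) w = qf X (adj A *m w).
Proof. by rewrite /qf adjM adjK !mulmxA. Qed.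

Lemma dominates_kconv l a b (r s : 'M[C]_a) (r' s' : 'M[C]_b) :
  kconv r s r' s' -> dominates l r s -> dominates l r' s'.
Proof.
move=> [S [K [hK <- <-]]] h w.
have e X : qf (kraus K X) w = \sum_t qf X (adj (K t) *m w).
  rewrite /qf /kraus mulmx_sumr mulmx_suml summxE Re_sum; apply: eq_bigr => t _.
  exact: qf_conj.
by rewrite !e mulr_sumr; apply: ler_sum.
Qed.

Section MaxRel.
Variables (n : nat) (r s : 'M[C]_n).
Hypotheses (hr : fstate r) (hs : fstate s).

Let halves : exists S H : 'M[C]_n, [/\ S = mpow s (- 2^-1), adj S = S, adj H = H,
  S *m H = 1%:M /\ H *m S = 1%:M & s = H *m H].
Proof.
have [V [q [hV [q0 _] e]]] := hs.
exists (sdiag V (fun i => q i `^ (- 2^-1))), (sdiag V (fun i => q i `^ 2^-1)).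
rewrite !adj_sdiag !mul_sdiag// e mpow_sdiag//; split=> //; first split.
- by apply: sdiag1 => // i; rewrite -powRD ?addNr ?powRr0// (gt_eqF (q0 i)) implybT.
- by apply: sdiag1 => // i; rewrite -powRD ?subrr ?powRr0// (gt_eqF (q0 i)) implybT.
apply: eq_sdiag => i; rewrite -powRD ?(gt_eqF (q0 i)) ?implybT// -mulr2n -[_ *+ 2]mulr_natr mulVf ?pnatr_eq0//.
by rewrite powRr1// ltW.
Qed.

Lemma maxrel_psd : psd (maxrel r s).
Proof.
have [S [H [e aS _ _ _]]] := halves; rewrite /maxrel -e -{2}aS.
exact/psd_conj/pd_psd/fstate_pd.
Qed.

(* [lmax (s^(-1/2) r s^(-1/2)) <= l] iff [r <= l s] in the Loewner order. *)
Lemma lmax_maxrelP l : lmax (maxrel r s) <= l <-> dominates l r s.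
Proof.
have [S [H [e aS aH [SH HS] sH]]] := halves; have n0 := fstate_inh hr.
have [T [x [hT x0 eT]]] := psd_spectral maxrel_psd.
have [h1 [i h2]] := lmax_sdiag x n0 hT.
have q1 w : qf s w = \sum_j nsq ((H *m w) j 0).
  have -> : s = H *m 1%:M *m adj H by rewrite mulmx1 aH.
  by rewrite qf_conj aH /qf mulmx1 adj_mul_self.
have q2 w : qf r w = \sum_j x j * nsq ((adj T *m (H *m w)) j 0).
  have -> : r = H *m maxrel r s *m adj H.
    by rewrite aH /maxrel -e !mulmxA HS mul1mx -mulmxA SH mulmx1.
  by rewrite qf_conj aH eT qf_sdiag.
have nT (w : 'cV[C]_n) : \sum_j nsq (w j 0) = \sum_j nsq ((adj T *m w) j 0).
  apply: rC_inj; rewrite -!adj_mul_self adjM adjK !mulmxA -[_ *m T *m adj T]mulmxA.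
  by rewrite (_ : T *m adj T = 1%:M)// mulmx1.
split=> [hl w|hl].
  rewrite q1 q2 nT mulr_sumr; apply: ler_sum => j _; apply: ler_wpM2r; first exact: nsq_ge0.
  by apply: le_trans hl; rewrite eT.
rewrite eT h2; have := hl (S *m col i T).
rewrite q1 q2 nT.
have Hw : H *m (S *m col i T) = col i T by rewrite mulmxA HS mul1mx.
have Tw j : (adj T *m col i T) j 0 = (j == i)%:R.
  by rewrite colE mulmxA (unitary_adj hT) mul1mx mxE eqxx andbT.
rewrite Hw; under eq_bigr do rewrite Tw; under [X in _ <= _ * X]eq_bigr do rewrite Tw.
have e1 (f : 'I_n -> R) : \sum_j f j * nsq ((j == i)%:R : C) = f i.
  rewrite (bigD1 i)//= eqxx big1 ?addr0 => [|j ji]; last first.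
    by rewrite (negPf ji) mulr0n -rC0 nsq_rC expr0n mulr0.
  by rewrite mulr1n -rC1 nsq_rC expr1n mulr1.
under [X in _ <= _ * X]eq_bigr do rewrite -[nsq _]mul1r.
by rewrite !e1 mulr1.
Qed.

(** Take traces in r <= l s, with l the largest eigenvalue of [maxrel r s]. *)
Lemma lmax_maxrel_ge1 : 1 <= lmax (maxrel r s).
Proof.
have h : dominates (lmax (maxrel r s)) r s by apply/lmax_maxrelP.
have e (X : 'M[C]_n) : retr X = \sum_i qf X (delta_mx i 0).
  rewrite /retr /mxtrace Re_sum; apply: eq_bigr => i _; congr complex.Re.
  by rewrite adjE trmx_delta map_delta_mx -mulmxA -rowE -colE !mxE.
have one X : fstate X -> retr X = 1 by move=> hX; rewrite /retr fstate_tr.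
by rewrite -[X in X <= _](one _ r hr) -[leRHS]mulr1 -(one _ s hs) !e mulr_sumr; apply: ler_sum.
Qed.

End MaxRel.

Lemma maxrel_tpow n (r s : 'M[C]_n) k : fstate s -> maxrel (tpow r k) (tpow s k) = tpow (maxrel r s) k.
Proof. by move=> hs; rewrite /maxrel mpow_tpow -?tpowM//; exact: fstate_pd. Qed.

Section Bound.
Variables (d1 d2 : nat) (rho1 sigma1 : 'M[C]_d1) (rho2 sigma2 : 'M[C]_d2).

Lemma Rstar0_swap n : Rstar0 rho1 sigma1 rho2 sigma2 n = Rstar0 sigma1 rho1 sigma2 rho2 n.
Proof.
congr ereal_sup; apply/seteqP; split=> _ [m /dconv_kconv[S [K [h1 h2 h3]]] <-]; exists m => //;
by apply/dconv_kconv; exists S, K.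
Qed.

Hypotheses (hr1 : fstate rho1) (hs1 : fstate sigma1) (hr2 : fstate rho2) (hs2 : fstate sigma2).
Variables (n : nat) (n0 : (0 < n)%N).

Lemma Rstar0_le_Dform a : 2^-1 <= a -> a != 1 ->
  (Rstar0 rho1 sigma1 rho2 sigma2 n <= eratio (Dform rho1 sigma1 a) (Dform rho2 sigma2 a))%E.
Proof.
move=> ah a1; apply: Rstar0_le => // [|m hm]; first exact: Dform_ge0.
by rewrite -!Dform_tpow//; apply: Dform_dpi hm => //; exact: fstate_tpow.
Qed.

(** [Dmin] at order 1 is a [lim], so its convergence is established first; data processing and
    nonnegativity at nearby orders then pass to the limit. *)
Lemma Rstar0_le_limit :
  (Rstar0 rho1 sigma1 rho2 sigma2 n <= eratio (Dmin 1%:E rho1 sigma1) (Dmin 1%:E rho2 sigma2))%E.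
Proof.
have cv d (r s : 'M[C]_d) : fstate r -> fstate s ->
    (Dform r s @ dnbhs (1 : R) --> Dmin 1%:E r s)%classic.
  move=> hr hs; rewrite /Dmin eqxx; have d0 := fstate_inh hr.
  case: hr => U [p [hU hp ->]]; case: hs => V [q [hV hq ->]].
  apply: cvgP; exact: Dform_cvg1.
have c1 := cv _ _ _ hr1 hs1; have c2 := cv _ _ _ hr2 hs2.
apply: Rstar0_le => // [|m hm].
  apply: (ler_cvg_to (cvg_cst (0 : R)) c2); near=> a.
  have [ah an] : 2^-1 <= a /\ a != 1 by near: a; exact: near1_half.
  exact: Dform_ge0.
have k2 := @cvgMl_tmp _ _ _ _ _ m%:R _ c2; have k1 := @cvgMl_tmp _ _ _ _ _ n%:R _ c1.
apply: (ler_cvg_to (k2 _) (k1 _)); near=> a.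
have [ah an] : 2^-1 <= a /\ a != 1 by near: a; exact: near1_half.
by rewrite -!Dform_tpow//; apply: Dform_dpi hm => //; exact: fstate_tpow.
Unshelve. all: by end_near.
Qed.

Lemma Rstar0_le_max :
  (Rstar0 rho1 sigma1 rho2 sigma2 n <= eratio (Dmin +oo%E rho1 sigma1) (Dmin +oo%E rho2 sigma2))%E.
Proof.
rewrite /Dmin -!/(maxrel _ _).
have l1 := lmax_maxrel_ge1 hr1 hs1; have l2 := lmax_maxrel_ge1 hr2 hs2.
apply: Rstar0_le => // [|m hm]; first exact: ln_ge0.
have := lmax_tpow m (fstate_inh hr2) (maxrel_psd hr2 hs2).
have := lmax_tpow n (fstate_inh hr1) (maxrel_psd hr1 hs1).
rewrite -!maxrel_tpow// => e1 e2.
have p1 := lt_le_trans ltr01 l1; have p2 := lt_le_trans ltr01 l2.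
rewrite !mulr_natl -!lnXn// ler_ln ?posrE ?exprn_gt0// -e1 -e2.
apply/lmax_maxrelP; do ?exact: fstate_tpow.
by apply: dominates_kconv hm _; apply/lmax_maxrelP => //; exact: fstate_tpow.
Qed.

End Bound.

Lemma eratio_opp (x y : R) : eratio (- x) (- y) = eratio x y.
Proof. by rewrite -[- x]mulN1r -[- y]mulN1r eratio_scale// oppr_eq0 oner_eq0. Qed.

Theorem Rstar0_upper d1 d2 (rho1 sigma1 : 'M[C]_d1) (rho2 sigma2 : 'M[C]_d2) :
  fstate rho1 -> fstate sigma1 -> fstate rho2 -> fstate sigma2 ->
  forall n : nat, (0 < n)%N -> forall a : \bar R,
  (Rstar0 rho1 sigma1 rho2 sigma2 n <= eratio (Dmin a rho1 sigma1) (Dmin a rho2 sigma2))%E.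
Proof.
move=> hr1 hs1 hr2 hs2 n n0 [a||]; last 2 first.
- exact: Rstar0_le_max.
(* Order -oo is order +oo of the exchanged states up to a sign, which cancels in the ratio. *)
- by rewrite Rstar0_swap /Dmin eratio_opp; exact: (Rstar0_le_max hs1 hr1 hs2 hr2).
have [->|a1] := eqVneq a 1; first exact: Rstar0_le_limit.
rewrite /Dmin (negPf a1).
have [ah|ah] := leP 2^-1 a; first exact: Rstar0_le_Dform.
(* Both divergences vanish at order 0, where [eratio] takes its default value +oo. *)
have [->|a0] := eqVneq a 0; first by rewrite !Dform0// /eratio eqxx leey.
rewrite (Dform_swap_scale rho1 sigma1 ah a0) (Dform_swap_scale rho2 sigma2 ah a0) eratio_scale; last first.
  by rewrite mulf_neq0// invr_eq0 subr_eq0 eq_sym.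
rewrite Rstar0_swap; apply: Rstar0_le_Dform => //; first by lra.
by rewrite subr_eq -subr_eq0 opprD addNKr oppr_eq0.
Qed.

End UpperBound.

(** * Pinched divergences of tensor powers *)

Section Regroup.
Variable R : realType.
Local Notation C := R[i].

Lemma castmx_tensA m n p (A : 'M[C]_m) (B : 'M[C]_n) (D : 'M[C]_p) (e : (m * (n * p) = m * n * p)%N) :
  castmx (e, e) (A *t (B *t D)) = (A *t B) *t D.
Proof.
have idx i j k : cast_ord (esym e) (mxtens_index (mxtens_index (i, j), k)) =
    mxtens_index (i, mxtens_index (j, k)).
  by apply: val_inj; rewrite /= mulnDl mulnA addnA.
apply/matrixP => x y; rewrite castmxE /=.
case: (mxtens_indexP x) => {}x k; case: (mxtens_indexP x) => i j.
case: (mxtens_indexP y) => {}y k'; case: (mxtens_indexP y) => i' j'.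
by rewrite !idx !tensmxE mulrA.
Qed.

Lemma castmx_tens_congr m n n' (A : 'M[C]_m) (B : 'M[C]_n) (e : n = n') (e' : (m * n = m * n')%N) :
  castmx (e', e') (A *t B) = A *t castmx (e, e) B.
Proof. by case: n' / e e' => e'; rewrite !castmx_id. Qed.

Lemma tpow_add d (A : 'M[C]_d) k l (e : (pw d k * pw d l = pw d (k + l))%N) :
  castmx (e, e) (tpow A k *t tpow A l) = tpow A (k + l).
Proof.
elim: k e => [|k IH] e.
  by rewrite /= tens_scalar1mx castmx_comp castmx_id.
have e1 : (pw d k * pw d l = pw d (k + l))%N.
  by elim: (k) => [|m IHm]; rewrite ?mul1n//= -mulnA IHm.
rewrite [RHS]/= -(IH e1) /=.
have e2 : (d * (pw d k * pw d l) = d * pw d k * pw d l)%N by rewrite mulnA.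
rewrite -(castmx_tensA _ _ _ e2) castmx_comp -(castmx_tens_congr _ _ _ (etrans e2 e)).
by congr castmx; congr pair; exact: eq_irrelevance.
Qed.

Lemma pw_add d k l : (pw d k * pw d l = pw d (k + l))%N.
Proof. by elim: k => [|m IHm]; rewrite ?mul1n//= -mulnA IHm. Qed.

Lemma kconv_cast m n (e : m = n) (r s : 'M[C]_m) : kconv (castmx (e, e) r) (castmx (e, e) s) r s.
Proof. by case: n / e; rewrite !castmx_id; exact: kconv_refl. Qed.

Lemma kconv_split d (r s : 'M[C]_d) k l :
  kconv (tpow r (k + l)) (tpow s (k + l)) (tpow r k *t tpow r l) (tpow s k *t tpow s l).
Proof. by rewrite -!(tpow_add _ (pw_add d k l)); exact: kconv_cast. Qed.

(** Serves to drop the copies left over when [n] is not a multiple of the block length. *)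
Lemma kconv_discard d (r s : 'M[C]_d) k l : fstate r -> fstate s ->
  kconv (tpow r (k + l)) (tpow s (k + l)) (tpow r l) (tpow s l).
Proof.
move=> hr hs; apply: kconv_trans (kconv_split r s k l) _.
have h : kconv (tpow r k) (tpow s k) (1%:M : 'M[C]_1) 1%:M.
  by apply: kconv_trace; exact/fstate_tr/fstate_tpow.
apply: kconv_trans (kconv_tens h (kconv_refl (tpow r l) (tpow s l))) _.
by rewrite !tens_scalar1mx; exact: kconv_cast.
Qed.

Lemma kconv_blocks d (r s : 'M[C]_d) k t :
  kconv (tpow r (k * t)) (tpow s (k * t)) (tpow (tpow r k) t) (tpow (tpow s k) t).
Proof.
elim: t => [|t IH]; first by rewrite muln0; exact: kconv_refl.
rewrite mulnS; apply: kconv_trans (kconv_split r s k (k * t)) _.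
exact: kconv_tens (kconv_refl _ _) IH.
Qed.

End Regroup.

(** * Pinched laws: comparison of eigenbases, superadditivity, linear growth *)

Section JointDiagonal.
Variable R : realType.
Local Notation C := R[i].

Lemma Qt_joint n (U : 'M[C]_n) p q a : unitary U -> (forall i, 0 < p i) -> (forall i, 0 < q i) ->
  a != 0 -> Qt a (sdiag U p) (sdiag U q) = Qc a p q.
Proof.
move=> hU p0 q0 a0.
have e : sandwich a (sdiag U p) (sdiag U q) = sdiag U (fun i => p i * q i `^ ((1 - a) / a)).
  rewrite /sandwich mpow_sdiag// /msqrt mfun_sdiag// !mul_sdiag//; apply: eq_sdiag => i.
  by rewrite mulrAC -expr2 sqr_sqrtr// ltW.
rewrite (Qt_sdiag hU e); apply: eq_bigr => i _.
by rewrite powRM ?powR_ge0 ?(ltW (p0 i))// -powRrM divfK.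
Qed.

Lemma Dcl_joint n (U : 'M[C]_n) p q a : unitary U -> (forall i, 0 < p i) -> (forall i, 0 < q i) ->
  a != 1 -> Dcl a (sdiag U p) (sdiag U q) = cD a p q.
Proof.
move=> hU p0 q0 a1; rewrite /Dcl /Dmin (negPf a1).
have [ah|ah] := leP 2^-1 a.
  by rewrite Dform_ge_half// Qt_joint// gt_eqF// (lt_le_trans _ ah)// invr_gt0.
by rewrite Dform_swap// Qt_joint// ?Qc_swap// subr_eq0 eq_sym.
Qed.

(* [W] is any eigenbasis of [s], in general not diagonalizing [pinch s r]: the diagonal of [r]
   in [W] is a doubly stochastic average of the spectrum [p] of the pinched state. *)
Section BasisComparison.
Variables (n : nat) (r s U W : 'M[C]_n) (p q p' q' : 'I_n -> R).
Hypotheses (hr : pd r) (h : pinched_pair r s U p q) (hW : unitary W).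
Hypotheses (es : s = sdiag W q') (pE : forall i, (adj W *m r *m W) i i = rC (p' i)).

Let p0 := pinched_pair_p_gt0 hr h.

Let QcE a : Qc a p q = \sum_i (\sum_j nsq ((adj W *m U) i j) * p j `^ a) * q' i `^ (1 - a).
Proof.
have [hU es' eP _ _] := h.
have -> : Qc a p q = petz a (pinch s r) s.
  rewrite eP {1}es' petzE//.
  have hUU : adj U *m U = 1%:M := unitary_adj hU.
  apply: eq_bigr => i _; rewrite hUU (bigD1 i)//= mxE eqxx big1 ?addr0 => [|j ji].
    by rewrite mulr1n -rC1 nsq_rC expr1n mul1r.
  by rewrite mxE eq_sym (negPf ji) mulr0n -rC0 nsq_rC expr0n !mul0r.
by rewrite eP {1}es petzE//; apply: eq_bigr => i _; rewrite mulr_suml.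
Qed.

Let p'E i : p' i = \sum_j nsq ((adj W *m U) i j) * p j.
Proof.
have [_ _ eP _ _] := h; apply: rC_inj.
have := pinch_entry q' r i i hW; rewrite -es eqxx mulr1n pE eP conj_sdiag_adj => <-.
exact: sdiag_diagE.
Qed.

Let hWU : unitary (adj W *m U).
Proof. by apply: unitaryM; [exact: unitaryV|case: h]. Qed.

Lemma Qc_basis_le a : (1 <= a) || (a <= 0) -> Qc a p' q' <= Qc a p q.
Proof.
move=> ha; rewrite QcE; apply: ler_sum => i _; rewrite ler_wpM2r ?powR_ge0// p'E.
by apply: jensen_ge; rewrite ?nsq_unitary_row// => j; exact: nsq_ge0.
Qed.

Lemma Qc_basis_ge a : 0 <= a <= 1 -> Qc a p q <= Qc a p' q'.
Proof.
move=> ha; rewrite QcE; apply: ler_sum => i _; rewrite ler_wpM2r ?powR_ge0// p'E.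
by apply: jensen_le; rewrite ?nsq_unitary_row// => j; exact: nsq_ge0.
Qed.

Hypotheses (pmf_p : pmf p) (pmf_q : pmf q) (pmf_p' : pmf p') (pmf_q' : pmf q').

Lemma cD_basis_le a : 0 < a -> a != 1 -> cD a p' q' <= cD a p q.
Proof.
move=> a0 a1; have Q0 := Qc_gt0 a pmf_p pmf_q; have Q0' := Qc_gt0 a pmf_p' pmf_q'.
rewrite /cD; have [a1'|a1'|e] := ltgtP a 1; last by rewrite e eqxx in a1.
  by rewrite ler_nM2l ?invr_lt0 ?subr_lt0// ler_ln ?posrE// Qc_basis_ge ?(ltW a0) ?(ltW a1').
by rewrite ler_pM2l ?invr_gt0 ?subr_gt0// ler_ln ?posrE// Qc_basis_le ?(ltW a1').
Qed.

Lemma cD_basis_le_swap a : 0 < a -> a != 1 -> cD a q' p' <= cD a q p.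
Proof.
move=> a0 a1; have Q0 := Qc_gt0 a pmf_q pmf_p; have Q0' := Qc_gt0 a pmf_q' pmf_p'.
rewrite /cD; have [a1'|a1'|e] := ltgtP a 1; last by rewrite e eqxx in a1.
  rewrite ler_nM2l ?invr_lt0 ?subr_lt0// ler_ln ?posrE// -[Qc a q p]Qc_swap -[leRHS]Qc_swap.
  by apply: Qc_basis_ge; apply/andP; split; lra.
rewrite ler_pM2l ?invr_gt0 ?subr_gt0// ler_ln ?posrE// -[leLHS]Qc_swap -[leRHS]Qc_swap.
by apply: Qc_basis_le; apply/orP; right; lra.
Qed.

End BasisComparison.

Lemma pinched_pair_pmf n (r s U : 'M[C]_n) p q : fstate r -> fstate s -> pinched_pair r s U p q ->
  pmf p /\ pmf q.
Proof.
move=> hr hs h; have [hU es _ pE _] := h; split; split.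
- exact: pinched_pair_p_gt0 (fstate_pd hr) h.
- apply: rC_inj; rewrite rC_sum; under eq_bigr do rewrite -pE.
  rewrite -[LHS]/(\tr _) mxtrace_mulC mulmxA (_ : U *m adj U = 1%:M)// mul1mx.
  by rewrite fstate_tr.
- exact: pinched_pair_q_gt0 (fstate_pd hs) h.
by apply: rC_inj; rewrite -(tr_sdiag q hU) -es fstate_tr.
Qed.

(** The product basis lives on a space of dimension [m] that is equal to [n] only propositionally.
    Eliminating [e] with every object generalized transfers the basis comparison across the cast. *)
Lemma pinched_pair_sup m n (e : m = n) (r s W : 'M[C]_m) p' q' (r1 s1 U : 'M[C]_n) p q a :
  castmx (e, e) r = r1 -> castmx (e, e) s = s1 ->
  fstate r1 -> fstate s1 -> pinched_pair r1 s1 U p q ->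
  unitary W -> s = sdiag W q' -> (forall i, (adj W *m r *m W) i i = rC (p' i)) ->
  pmf p' -> pmf q' -> 0 < a -> a != 1 ->
  cD a p' q' <= cD a p q /\ cD a q' p' <= cD a q p.
Proof.
case: n / e r1 s1 U p q => r1 s1 U p q; rewrite !castmx_id => <- <- hr hs h hW es pE hp hq a0 a1.
have [hp1 hq1] := pinched_pair_pmf hr hs h.
by split; [exact: (cD_basis_le (fstate_pd hr) h hW es pE)|
  exact: (cD_basis_le_swap (fstate_pd hr) h hW es pE)].
Qed.

Definition ptens m n (p : 'I_m -> R) (q : 'I_n -> R) k := p (mxtens_unindex k).1 * q (mxtens_unindex k).2.

Lemma ptensE m n (p : 'I_m -> R) (q : 'I_n -> R) i j : ptens p q (mxtens_index (i, j)) = p i * q j.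
Proof. by rewrite /ptens mxtens_indexK. Qed.

Lemma ptens_pmf m n (p : 'I_m -> R) (q : 'I_n -> R) : pmf p -> pmf q -> pmf (ptens p q).
Proof.
move=> [p0 p1] [q0 q1]; split=> [i|]; first exact: mulr_gt0.
rewrite sum_mxtens -p1; apply: eq_bigr => i _; rewrite -[RHS]mulr1 -q1 mulr_sumr.
by apply: eq_bigr => j _; rewrite ptensE.
Qed.

Lemma cD_ptens m n (p q : 'I_m -> R) (p2 q2 : 'I_n -> R) a : pmf p -> pmf q -> pmf p2 -> pmf q2 ->
  cD a (ptens p p2) (ptens q q2) = cD a p q + cD a p2 q2.
Proof.
move=> hp hq hp2 hq2; rewrite /cD -mulrDr -lnM ?posrE ?Qc_gt0//; congr (_ * ln _).
rewrite /Qc sum_mxtens mulr_suml; apply: eq_bigr => i _; rewrite mulr_sumr; apply: eq_bigr => j _.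
by rewrite !ptensE !powRM ?ltW ?(proj1 hp) ?(proj1 hq) ?(proj1 hp2) ?(proj1 hq2)// mulrACA.
Qed.

Section Family.
Variables (d : nat) (rho sigma : 'M[C]_d).
Hypotheses (hr : fstate rho) (hs : fstate sigma).

Definition pinched_at k U p q := pinched_pair (tpow rho k) (tpow sigma k) U p q.

(* The tensor product of the bases at levels [k] and [l] is an eigenbasis at level [k + l]. *)
Lemma pinched_at_sup k l U p q U1 p1 q1 U2 p2 q2 a :
  @pinched_at (k + l) U p q -> @pinched_at k U1 p1 q1 -> @pinched_at l U2 p2 q2 ->
  0 < a -> a != 1 ->
  cD a p1 q1 + cD a p2 q2 <= cD a p q /\ cD a q1 p1 + cD a q2 p2 <= cD a q p.
Proof.
move=> h h1 h2 a0 a1.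
have [hp1 hq1] := pinched_pair_pmf (fstate_tpow k hr) (fstate_tpow k hs) h1.
have [hp2 hq2] := pinched_pair_pmf (fstate_tpow l hr) (fstate_tpow l hs) h2.
have [hU1 es1 _ pE1 _] := h1; have [hU2 es2 _ pE2 _] := h2.
rewrite -!cD_ptens//.
apply: (pinched_pair_sup (tpow_add rho (pw_add d k l)) (tpow_add sigma (pw_add d k l))
  (fstate_tpow _ hr) (fstate_tpow _ hs) h (unitary_tens hU1 hU2)) => //.
- by rewrite es1 es2 sdiag_tens.
- move=> i; rewrite adj_tens !tensmx_mul; case: (mxtens_indexP i) => i1 i2.
  by rewrite tensmxE pE1 pE2 -rCM ptensE.
- exact: ptens_pmf.
- exact: ptens_pmf.
Qed.

Lemma cD_ratio_le (I : finType) (p q : I -> R) M a : pmf p -> pmf q -> a != 1 ->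
  (forall i, ln (p i / q i) <= M) -> cD a p q <= M.
Proof.
move=> hp hq a1 hM.
have gt1 b : 1 < b -> cD b p q <= M.
  move=> b1; rewrite /cD mulrC ler_pdivrMr ?subr_gt0// -ler_expR lnK ?posrE ?Qc_gt0//.
  rewrite Qc_exp// -[leRHS]mul1r -[X in _ <= X * _](proj2 hp) mulr_suml; apply: ler_sum => i _.
  by rewrite ler_pM2l ?(proj1 hp)// ler_expR mulrC ler_pM2r ?subr_gt0.
have [a2|a2] := leP a 2; last by apply: gt1; apply: lt_trans a2; rewrite ltr1n.
have n2 : (2 : R) != 1 by rewrite gt_eqF// ltr1n.
by apply: le_trans (cD_mono hp hq a1 n2 a2) _; apply: gt1; rewrite ltr1n.
Qed.

(** With -M a lower bound for every log-eigenvalue of both states, all eigenvalues of the k-th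
    powers lie between exp(-kM) and 1. So do the pinched probabilities, which are averages of them,
    and all log-ratios are at most kM. *)
Lemma pinched_at_bound : exists2 M, 0 <= M & forall k U p q a, @pinched_at k U p q -> a != 1 ->
  cD a p q <= k%:R * M /\ cD a q p <= k%:R * M.
Proof.
have [Ur [r [hUr [r0 r1] er]]] := hr; have [Us [s [hUs [s0 s1] eS]]] := hs.
pose M := \sum_i - ln (r i) + \sum_i - ln (s i).
have le1 (f : 'I_d -> R) i : (forall i, 0 < f i) -> \sum_i f i = 1 -> f i <= 1.
  by move=> f0 <-; rewrite (bigD1 i)//= lerDl sumr_ge0// => j _; exact: ltW.
have nl (f : 'I_d -> R) i : (forall i, 0 < f i) -> \sum_i f i = 1 -> 0 <= - ln (f i).
  by move=> f0 f1; rewrite oppr_ge0 ln_le0// le1.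
have n0 : 0 <= M by rewrite addr_ge0// sumr_ge0// => i _; exact: nl.
have rM i : expR (- M) <= r i.
  rewrite -[leRHS]lnK ?posrE// ler_expR lerNl /M (bigD1 i)//= -addrA lerDl.
  by rewrite addr_ge0// sumr_ge0// => j _; exact: nl.
have sM i : expR (- M) <= s i.
  rewrite -[leRHS]lnK ?posrE// ler_expR lerNl /M addrC (bigD1 i)//= -addrA lerDl.
  by rewrite addr_ge0// sumr_ge0// => j _; exact: nl.
have vM (f : 'I_d -> R) k i : (forall i, expR (- M) <= f i) -> expR (- (k%:R * M)) <= vpow f k i.
  move=> hf; elim: k i => [|k IH] i /=; first by rewrite mul0r oppr0 expR0.
  rewrite -[k.+1%:R]natr1 mulrDl mul1r opprD expRD mulrC.
  by apply: ler_pM; rewrite ?expR_ge0 ?hf ?IH.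
exists M => // k U p q a h a1.
have [hp hq] := pinched_pair_pmf (fstate_tpow k hr) (fstate_tpow k hs) h.
have [hU eq _ pE _] := h.
have qM i : expR (- (k%:R * M)) <= q i.
  have e2 : sdiag U q = sdiag (tpow Us k) (vpow s k) by rewrite -eq eS sdiag_tpow.
  by have [j ->] := sdiag_spec_sub hU (unitary_tpow k hUs) e2 i; exact: vM.
have pM i : expR (- (k%:R * M)) <= p i.
  have e2 : tpow rho k = sdiag (tpow Ur k) (vpow r k) by rewrite er sdiag_tpow.
  have hW : unitary (adj U *m tpow Ur k).
    by apply: unitaryM; [exact: unitaryV|exact: unitary_tpow].
  rewrite (pair_diag e2 pE) -[leLHS]mul1r -[X in X * _ <= _](nsq_unitary_row i hW) mulr_suml.
  by apply: ler_sum => j _; rewrite ler_wpM2l ?nsq_ge0// vM.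
have le1' (f : 'I_(pw d k) -> R) i : pmf f -> f i <= 1.
  by move=> [f0 <-]; rewrite (bigD1 i)//= lerDl sumr_ge0// => j _; exact: ltW.
have fin (f g : 'I_(pw d k) -> R) i : pmf f -> pmf g -> expR (- (k%:R * M)) <= g i ->
    ln (f i / g i) <= k%:R * M.
  move=> hf hg gM; have f0 := proj1 hf i; have g0 := proj1 hg i.
  rewrite -ler_expR lnK ?posrE ?divr_gt0// ler_pdivrMr//.
  apply: le_trans (le1' f i hf) _; rewrite -[leLHS](expR0) -(subrr (k%:R * M)) expRD.
  by rewrite ler_wpM2l ?expR_ge0.
by split; apply: cD_ratio_le => // i; apply: fin.
Qed.

End Family.

End JointDiagonal.

(** * Uniform convergence in the order *)

Section UniformLimits.
Variable R : realType.

(** Fekete's lemma: the limit is the supremum [sup E] over k > 0. Writing n = q m + r with r < m,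
    superadditivity gives F n >= q F m, and the remainder costs at most m M. *)
Lemma superadditive_cvg (F : nat -> R) M : (forall k l, F k + F l <= F (k + l)%N) ->
  (forall k, 0 <= F k) -> (forall k, F k <= k%:R * M) -> cvgn (fun k => k%:R^-1 * F k).
Proof.
move=> sa F0 FM.
pose E : set R := [set k%:R^-1 * F k | k in [set k : nat | (0 < k)%N]]%classic.
have EM : ubound E M.
  move=> _ [k k0 <-]; have kp : 0 < k%:R :> R by rewrite ltr0n.
  by rewrite mulrC ler_pdivrMr// mulrC.
have hE : has_sup E by split; [exists (1%:R^-1 * F 1%N), 1%N|exists M].
have M0 : 0 <= M by have := le_trans (F0 1%N) (FM 1%N); rewrite mul1r.
have mulF m q : q%:R * F m <= F (q * m)%N.
  elim: q => [|q IH]; first by rewrite mul0r.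
  by rewrite -natr1 mulrDl mul1r mulSn addrC (le_trans _ (sa _ _))// lerD.
apply/cvg_ex; exists (sup E); apply/cvgrPdist_le => /= e e0.
have [_ [m /= m0 <-] hm] := sup_adherent (divr_gt0 e0 (ltr0Sn _ 1) : 0 < e / 2) hE.
have mp : 0 < m%:R :> R by rewrite ltr0n.
near=> n.
have np : 0 < n%:R :> R by near: n; exact: nbhs_infty_gtr.
have nE : n%:R^-1 * F n <= sup E.
  by apply: sup_upper_bound => //; exists n => //=; rewrite -(ltr_nat R).
rewrite ger0_norm ?subr_ge0//.
set x := m%:R^-1 * F m in hm.
have x0 : 0 <= x by rewrite mulr_ge0// invr_ge0 ltW.
have xM : x <= M by apply: EM; exists m.
have Fx : F m = m%:R * x by rewrite /x mulrA divff ?mul1r// gt_eqF.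
clearbody x.
have h1 : (n%:R - m%:R) * x <= F n.
  have hn := divn_eq n m.
  have h2 : F (n %/ m * m)%N <= F n.
    by rewrite [X in _ <= F X]hn (le_trans _ (sa _ _))// lerDl.
  apply: le_trans h2; apply: le_trans (mulF _ _); rewrite Fx mulrA; apply: ler_wpM2r => //.
  rewrite lerBlDr -natrM -natrD ler_nat {1}hn leq_add2l ltnW// ltn_pmod//.
have h3 : 2 * m%:R * M / e <= n%:R by near: n; exact: nbhs_infty_ger.
rewrite ler_pdivrMr// in h3.
have h4 : m%:R * x <= m%:R * M by rewrite ler_pM2l.
have h5 : (sup E - e) * n%:R <= F n.
  apply: le_trans h1; rewrite mulrBl [(n%:R - _) * x]mulrBl.
  have : (sup E - e / 2) * n%:R <= x * n%:R by apply: ler_wpM2r; exact: ltW.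
  rewrite mulrBl [n%:R * x]mulrC.
  lra.
have : sup E - e <= n%:R^-1 * F n by rewrite mulrC ler_pdivlMr.
by rewrite lerBlDr => h; rewrite lerBlDl.
Unshelve. all: by end_near.
Qed.

Lemma cD_ge0 n a (p q : 'I_n -> R) : pmf p -> pmf q -> 0 < a -> a != 1 -> 0 <= cD a p q.
Proof.
move=> hp hq a0 a1.
have lt1 b : 0 < b < 1 -> 0 <= cD b p q.
  move=> /andP[b0 b1]; rewrite /cD mulr_le0 ?invr_le0 ?subr_le0 ?(ltW b1)//.
  by rewrite lnQc_le0// (ltW b0) (ltW b1).
have [a1'|a1'|e] := ltgtP a 1; [by apply: lt1; rewrite a0| |by rewrite e eqxx in a1].
have h : (2^-1 : R) < 1 by rewrite invf_lt1// ltr1n.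
have h0 : (0 : R) < 2^-1 by rewrite invr_gt0.
apply: le_trans (lt1 2^-1 _) (cD_mono hp hq _ a1 _); rewrite ?h0 ?(lt_eqF h)//.
exact: ltW (lt_trans h a1').
Qed.

(** [cD 1 p q] is 0, since the inverse of 0 is 0; order 1 is therefore seen only through a punctured
    limit, equal to [KL]. *)
Lemma cD_cvg_dnbhs n a (p q : 'I_n -> R) : pmf p -> pmf q ->
  exists2 G, ((fun a => cD a p q) @ dnbhs a --> G)%classic & a != 1 -> G = cD a p q.
Proof.
move=> hp hq; have [->|a1] := eqVneq a 1.
  by exists (KL p q) => //; exact: cD_cvg1.
exists (cD a p q) => //.
have c : ((fun a => cD a p q) @ a --> cD a p q)%classic.
  apply: cvgM.
    apply: cvgV; first by rewrite subr_eq0.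
    by apply: cvgB; [exact: cvg_id|exact: cvg_cst].
  have [df _] := is_derive_Qc a hp hq.
  have cQ : {for a, continuous (fun a => Qc a p q)}.
    by apply: differentiable_continuous; rewrite -derivable1_diffP.
  apply: (@continuous_comp _ _ _ (fun a => Qc a p q) (@ln R)) => //.
  exact: continuous_ln (Qc_gt0 a hp hq).
by apply: cvg_trans c; apply: cvg_app; exact: nbhs_dnbhs.
Qed.

Section UniformRate.
Variables (n : nat) (p q : 'I_n -> R).
Hypotheses (hp : pmf p) (hq : pmf q) (K0 : 0 < cD 2^-1 p q).
Let g a := cD a p q.
Let D a := (2^-1 : R) <= a /\ a != 1.

Let half1 : (2^-1 : R) != 1.
Proof. by rewrite lt_eqF// invf_lt1// ltr1n. Qed.

Let g_half a : D a -> g 2^-1 <= g a.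
Proof. by move=> [ah a1]; exact: cD_mono. Qed.

Let g_gt0 a : D a -> 0 < g a.
Proof. by move=> /g_half; exact: lt_le_trans. Qed.

(** Provides, around each order x, one order [a] whose estimate serves all [b] near x: as f is
    increasing in the order, f k b >= f k a >= r g a >= r g b / mu. At the left end x = 1/2 the
    order [a] is x itself. *)
Lemma left_witness (x mu : R) : 2^-1 <= x -> 1 < mu -> exists2 a, D a &
  (\forall b \near x, D b -> a <= b /\ g b <= mu * g a)%classic.
Proof.
move=> xh mu1; have mu0 := lt_trans ltr01 mu1.
have [G cG GE] := cD_cvg_dnbhs x hp hq.
have G0 : 0 < G.
  have [x1|x1] := eqVneq x 1; last by rewrite GE//; exact: g_gt0.
  have e : G = KL p q.
    by move: cG; rewrite x1 => /cvg_unique; apply => //; exact: cD_cvg1.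
  by rewrite e; apply: lt_le_trans K0 _; apply: cD_le_KL => //; rewrite invf_lt1// ltr1n.
(* Splits the factor [mu]: [nu] for the upper bound of [g] near the point, mu / nu for the lower
   bound at the witness. *)
pose nu := (1 + mu) / 2.
have nu1 : 1 < nu by rewrite /nu; lra.
have nu0 : 0 < nu by exact: lt_trans nu1.
have numu : nu < mu by rewrite /nu; lra.
have lo : (\forall b \near dnbhs x, nu / mu * G < g b)%classic.
  apply: (cvgr_gt _ cG); rewrite -[ltRHS]mul1r ltr_pM2r// ltr_pdivrMr// mul1r.
  exact: numu.
have hi : (\forall b \near dnbhs x, g b < nu * G)%classic.
  by apply: (cvgr_lt _ cG); rewrite -[ltLHS]mul1r ltr_pM2r.
have hi' : (\forall b \near x, D b -> g b < nu * G)%classic.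
  move: hi; rewrite near_withinE; apply: filterS => b hb [bh b1].
  have [e|bx] := eqVneq b x; last exact: hb.
  have gx : G = g x by apply: GE; rewrite -e.
  by rewrite e -gx -[X in X < _]mul1r ltr_pM2r.
have [xe|xe] := eqVneq x 2^-1.
  exists 2^-1; first by split.
  move: hi'; apply: filterS => b hb Db; split; first by case: Db.
  have -> : g 2^-1 = G by rewrite /g -xe GE// xe.
  by apply: ltW; apply: lt_trans (hb Db) _; rewrite ltr_pM2r.
have xh' : 2^-1 < x by rewrite lt_neqAle eq_sym xe.
have lo1 : (\forall b \near dnbhs x, nu / mu * G < g b /\ b != 1)%classic.
  have n1 : (\forall b \near dnbhs x, b != 1)%classic.
    have [x1|x1|x1] := ltgtP x 1.
    - by apply: nbhs_dnbhs; near=> b; rewrite lt_eqF//; near: b; exact: lt_nbhsl.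
    - by apply: nbhs_dnbhs; near=> b; rewrite gt_eqF//; near: b; exact: lt_nbhsr.
    by rewrite {1}x1; near=> b; near: b; exact: nbhs_dnbhs_neq.
  by apply: filterS2 lo n1 => b.
have [a [/andP[a1 a2] [a3 a4]]] := exists_left_of xh' lo1.
exists a; first by split => //; exact: ltW.
have na : (\forall b \near x, a < b)%classic by exact: lt_nbhsr.
apply: filterS2 na hi' => b ab hb Db; split; first exact: ltW.
apply: ltW; apply: lt_trans (hb Db) _.
have e : mu * (nu / mu * G) = nu * G by field; rewrite gt_eqF.
by rewrite -e ltr_pM2l.
Unshelve. all: by end_near.
Qed.

(** [g] is bounded on the orders above 1, and some [B] comes within the factor [mu] of its supremum
    there, so this one order controls all larger ones. *)
Lemma level_at_infinity (mu : R) : 1 < mu -> exists B, 1 < B /\ forall b, B <= b -> g b <= mu * g B.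
Proof.
move=> mu1; have mu0 := lt_trans ltr01 mu1.
pose E : set R := [set g a | a in [set a : R | 1 < a]]%classic.
have Dgt a : 1 < a -> D a.
  by move=> a1; split; rewrite ?gt_eqF// ltW// (lt_trans _ a1)// invf_lt1// ltr1n.
have EM : ubound E (\sum_i `|ln (p i / q i)|).
  move=> _ [a /= a1 <-]; apply: cD_ratio_le => //; first by rewrite gt_eqF.
  by move=> i; rewrite (le_trans (ler_norm _))// (bigD1 i)//= lerDl sumr_ge0.
have E2 : E (g 2) by exists 2 => //=; rewrite ltr1n.
have hE : has_sup E by split; [exists (g 2)|exists (\sum_i `|ln (p i / q i)|)].
have s0 : 0 < sup E.
  by apply: lt_le_trans (sup_upper_bound hE E2); apply/g_gt0/Dgt; rewrite ltr1n.
have e0 : 0 < sup E - sup E / mu by rewrite subr_gt0 ltr_pdivrMr// ltr_pMr.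
have [_ [B /= B1 <-]] := sup_adherent e0 hE; rewrite opprB addrC subrK ltr_pdivrMr// mulrC => hB.
exists B; split => // b Bb; apply: ltW; apply: le_lt_trans hB.
by apply: sup_upper_bound => //; exists b => //=; exact: lt_le_trans Bb.
Qed.

(* Monotonicity in the order and compactness of [[1/2, B]] reduce the bound to finitely many
   orders, so that a single block length serves all of them. *)
Lemma uniform_rate (f : nat -> R -> R) (r mu : R) : 0 < r -> 1 < mu ->
  (forall k a b, D a -> D b -> a <= b -> f k a <= f k b) ->
  (forall a, D a -> (\forall k \near \oo, r * g a <= f k a)%classic) ->
  (\forall k \near \oo, forall a, D a -> r * g a <= mu * f k a)%classic.
Proof.
move=> r0 mu1 fmono fr; have mu0 := lt_trans ltr01 mu1.
have [B [B1 hB]] := level_at_infinity mu1.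
have DB : D B by split; rewrite ?gt_eqF// ltW// (lt_trans _ B1)// invf_lt1// ltr1n.
have step k a b : D a -> D b -> a <= b -> g b <= mu * g a -> r * g a <= f k a -> r * g b <= mu * f k b.
  move=> Da Db ab h1 h2; apply: le_trans (_ : mu * (r * g a) <= _).
    by rewrite [leRHS]mulrCA ler_pM2l.
  by rewrite ler_pM2l// (le_trans h2)// fmono.
have near_cov := (compact_near_coveringP _).1 (@segment_compact R 2^-1 B).
have loc : (forall x : R, `[2^-1, B] x -> \forall b \near x & k \near \oo,
    D b -> r * g b <= mu * f k b)%classic.
  move=> x; rewrite /= in_itv /= => /andP[xh _].
  have [a Da ha] := left_witness xh mu1.
  exists ([set b | D b -> a <= b /\ g b <= mu * g a], [set k | r * g a <= f k a])%classic.
    by split => //=; exact: fr.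
  by move=> [b k] /= [h1 h2] Db; have [ab gb] := h1 Db; exact: (step k a b).
have H := near_cov nat \oo%classic (fun k b => D b -> r * g b <= mu * f k b) _ loc.
have HB := fr _ DB.
near=> k => a Da.
have [aB|Ba] := leP a B.
  have Hk : forall b, `[2^-1, B]%classic b -> D b -> r * g b <= mu * f k b by near: k; exact: H.
  by apply: Hk => //; rewrite /= in_itv /= aB; case: Da => ->.
apply: (step k B a) => //; [exact: ltW|exact/hB/ltW|].
by near: k; exact: HB.
Unshelve. all: by end_near.
Qed.

End UniformRate.

End UniformLimits.

(** * Achievability *)

Section Achievability.
Variable R : realType.
Local Notation C := R[i].

Lemma swap_factor_neq0 (a : R) : a != 0 -> a != 1 -> a / (1 - a) != 0.
Proof. by move=> a0 a1; rewrite mulf_neq0// invr_eq0 subr_eq0 eq_sym. Qed.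

Lemma swap_factorK (a : R) : a != 0 -> a != 1 -> a / (1 - a) * ((1 - a) / a) = 1.
Proof. by move=> a0 a1; rewrite mulrA divfK ?divff// subr_eq0 eq_sym. Qed.

Lemma eratio_swap (a x y : R) : a != 0 -> a != 1 ->
  eratio x ((1 - a) / a * y) = eratio (a / (1 - a) * x) y.
Proof.
move=> a0 a1; rewrite -[LHS](eratio_scale _ _ (swap_factor_neq0 a0 a1)).
by rewrite [_ * (_ * y)]mulrA swap_factorK// mul1r.
Qed.

Lemma cvgn_scale (u : nat -> R) c : cvgn u -> limn (fun k => c * u k) = c * limn u.
Proof. move=> cu; apply: cvg_lim; [exact: norm_hausdorff|exact: cvgMl_tmp]. Qed.

Section PinchedLimits.
Variables (d : nat) (rho sigma : 'M[C]_d).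
Hypotheses (hr : fstate rho) (hs : fstate sigma).

Lemma pinched_family : exists (U : forall k, 'M[C]_(pw d k)) (p q : forall k, 'I_(pw d k) -> R),
  forall k, pinched_at rho sigma (U k) (p k) (q k).
Proof.
have ex k : exists t : 'M[C]_(pw d k) * ('I_(pw d k) -> R) * ('I_(pw d k) -> R),
    pinched_at rho sigma t.1.1 t.1.2 t.2.
  have [U [p [q h]]] := pinched_pair_exists (pd_herm (fstate_pd (fstate_tpow k hr)))
    (pd_herm (fstate_pd (fstate_tpow k hs))).
  by exists (U, p, q).
pose w k := sval (cid (ex k)).
exists (fun k => (w k).1.1), (fun k => (w k).1.2), (fun k => (w k).2) => k.
exact: svalP (cid (ex k)).
Qed.

Variables (U : forall k, 'M[C]_(pw d k)) (p q : forall k, 'I_(pw d k) -> R).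
Arguments p : clear implicits.
Arguments q : clear implicits.
Hypothesis hw : forall k, pinched_at rho sigma (U k) (p k) (q k).

Lemma family_pmf k : pmf (p k) /\ pmf (q k).
Proof. exact: pinched_pair_pmf (fstate_tpow k hr) (fstate_tpow k hs) (hw k). Qed.

Lemma DpinLE a : a != 1 -> DpinL a rho sigma = limn (fun k => k%:R^-1 * cD a (p k) (q k)).
Proof.
move=> a1; rewrite /DpinL; apply: (congr1 (fun u : nat -> R => limn u)); apply/funext => k.
have [[p0 _] [q0 _]] := family_pmf k; have [hU es eP _ _] := hw k.
by congr (_ * _); rewrite eP [X in Dcl _ _ X]es; exact: Dcl_joint.
Qed.

Lemma family_cvg a : 0 < a -> a != 1 ->
  cvgn (fun k => k%:R^-1 * cD a (p k) (q k)) /\ cvgn (fun k => k%:R^-1 * cD a (q k) (p k)).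
Proof.
move=> a0 a1; have [M M0 hM] := pinched_at_bound hr hs.
split; apply: (@superadditive_cvg _ _ M) => [k l|k|k].
- by case: (pinched_at_sup hr hs (hw (k + l)) (hw k) (hw l) a0 a1).
- by have [hp hq] := family_pmf k; exact: cD_ge0.
- by case: (hM _ _ _ _ a (hw k) a1).
- by case: (pinched_at_sup hr hs (hw (k + l)) (hw k) (hw l) a0 a1).
- by have [hp hq] := family_pmf k; exact: cD_ge0.
- by case: (hM _ _ _ _ a (hw k) a1).
Qed.

Lemma DpinL_cvg a : 0 < a -> a != 1 ->
  ((fun k => k%:R^-1 * cD a (p k) (q k)) @ \oo --> DpinL a rho sigma)%classic.
Proof. move=> a0 a1; rewrite (DpinLE a1); exact: (proj1 (family_cvg a0 a1)). Qed.

Lemma family_swap a k : a != 0 -> a != 1 ->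
  k%:R^-1 * cD a (p k) (q k) = a / (1 - a) * (k%:R^-1 * cD (1 - a) (q k) (p k)).
Proof. by move=> a0 a1; rewrite cD_swap// mulrCA. Qed.

(** At least one of a and 1 - a is positive, and [family_cvg] gives convergence at that order; the
    sequence at the other one is a scalar multiple. *)
Lemma DpinL_swap a : a != 0 -> a != 1 ->
  DpinL a rho sigma = a / (1 - a) * limn (fun k => k%:R^-1 * cD (1 - a) (q k) (p k)).
Proof.
move=> a0 a1; rewrite (DpinLE a1).
have e : (fun k => k%:R^-1 * cD a (p k) (q k)) =
    (fun k => a / (1 - a) * (k%:R^-1 * cD (1 - a) (q k) (p k))).
  by apply/funext => k; exact: family_swap.
have b0 : 1 - a != 0 by rewrite subr_eq0 eq_sym.
have b1 : 1 - a != 1 by rewrite -subr_eq0 addrAC subrr sub0r oppr_eq0.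
have [b|b] := ltP 0 (1 - a).
  by rewrite e (cvgn_scale _ (proj2 (family_cvg b b1))).
have a2 : 0 < a by lra.
have e' : (fun k => k%:R^-1 * cD (1 - a) (q k) (p k)) =
    (fun k => (a / (1 - a))^-1 * (k%:R^-1 * cD a (p k) (q k))).
  by apply/funext => k; rewrite family_swap// mulKf// swap_factor_neq0.
rewrite e' (cvgn_scale _ (proj1 (family_cvg a2 a1))).
by rewrite mulVKf// swap_factor_neq0.
Qed.

Lemma DpinL_swap_cvg a : 0 < a -> a != 1 ->
  ((fun k => k%:R^-1 * cD a (q k) (p k)) @ \oo --> a / (1 - a) * DpinL (1 - a) rho sigma)%classic.
Proof.
move=> a0 a1; have an : a != 0 by rewrite gt_eqF.
have b0 : 1 - a != 0 by rewrite subr_eq0 eq_sym.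
have b1 : 1 - a != 1 by rewrite -subr_eq0 addrAC subrr sub0r oppr_eq0.
rewrite (DpinL_swap b0 b1) !subKr mulrA swap_factorK//.
rewrite mul1r; exact: (proj2 (family_cvg a0 a1)).
Qed.

End PinchedLimits.

Lemma DpinR_swap d (rho sigma : 'M[C]_d) a : fstate rho -> fstate sigma -> a != 0 -> a != 1 ->
  DpinR a rho sigma = a / (1 - a) * DpinL (1 - a) sigma rho.
Proof.
move=> hr hs a0 a1; have [U [p [q hw]]] := pinched_family hs hr.
have b0 : 1 - a != 0 by rewrite subr_eq0 eq_sym.
have b1 : 1 - a != 1 by rewrite -subr_eq0 addrAC subrr sub0r oppr_eq0.
rewrite (DpinL_swap hs hr hw b0 b1) !subKr mulrA swap_factorK//.
rewrite mul1r /DpinR; apply: (congr1 (fun u : nat -> R => limn u)); apply/funext => k.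
have [[p0 _] [q0 _]] := family_pmf hs hr hw k; have [hU es eP _ _] := hw k.
by congr (_ * _); rewrite eP [X in Dcl _ X _]es; exact: Dcl_joint.
Qed.

Lemma lee_limn_einf (u : nat -> \bar R) (x : \bar R) :
  (forall c : R, (c%:E < x)%E -> (\forall n \near \oo, (c%:E <= u n)%E)%classic) ->
  (x <= limn_einf u)%E.
Proof.
move=> h; have low c : (c%:E < x)%E -> (c%:E <= limn_einf u)%E.
  move=> /h[N _ hN]; rewrite limn_einf_lim.
  have -> : limn (einfs u) = ereal_sup (range (einfs u)).
    by apply: cvg_lim => //; exact: cvg_einfs_sup.
  apply: (@le_trans _ _ (einfs u N)); last by apply: ereal_sup_ubound; exists N.
  by apply: le_ereal_inf_tmp => _ [n /= Nn <-]; exact: hN.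
rewrite leNgt; apply/negP.
case: (limn_einf u) low => [l||] low; case: x {h} low => [x||] low //=; rewrite ?lte_fin => lx.
- have := low ((l + x) / 2); rewrite lte_fin lee_fin => hl.
  have /hl : (l + x) / 2 < x by lra.
  by lra.
- by have := low (l + 1) (ltry _); rewrite lee_fin; lra.
- by have := low (x - 1); rewrite lte_fin => hl; have /hl : x - 1 < x by lra.
- by have := low 0 (ltry _).
Qed.

Section Target.
Variables (d1 d2 : nat) (rho1 sigma1 : 'M[C]_d1) (rho2 sigma2 V : 'M[C]_d2) (p2 q2 : 'I_d2 -> R).
Hypotheses (hr1 : fstate rho1) (hs1 : fstate sigma1) (hV : unitary V) (hp2 : pmf p2) (hq2 : pmf q2).
Hypotheses (er2 : rho2 = sdiag V p2) (es2 : sigma2 = sdiag V q2).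

Let Rstar := Rstar0 rho1 sigma1 rho2 sigma2.

Lemma Rstar0_ge m n : kconv (tpow rho1 n) (tpow sigma1 n) (tpow rho2 m) (tpow sigma2 m) ->
  ((m%:R / n%:R)%:E <= Rstar n)%E.
Proof. by move=> h; apply: ereal_sup_ubound; exists m => //=; exact/dconv_kconv. Qed.

Lemma Rstar0_ge0 n : (0 <= Rstar n)%E.
Proof.
rewrite -[0%E]/((0 : R)%:E) -(mul0r (n%:R^-1)) -[X in X * _]/(0%:R); apply: Rstar0_ge.
by apply: kconv_trace; exact/fstate_tr/fstate_tpow.
Qed.

Lemma block_conversion k U p q c c0 : @pinched_at _ _ rho1 sigma1 k U p q -> 0 < c0 -> c0 < c ->
  exceeds c p q p2 q2 -> exceeds c q p q2 p2 -> 0 < cD 2^-1 p2 q2 ->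
  (\forall t \near \oo, kconv (tpow (tpow rho1 k) t) (tpow (tpow sigma1 k) t)
     (tpow rho2 (copies c0 t)) (tpow sigma2 (copies c0 t)))%classic.
Proof.
move=> h c00 c0c H1 H2 K0.
have [hp hq] := pinched_pair_pmf (fstate_tpow k hr1) (fstate_tpow k hs1) h.
have := large_sample hp hq hp2 hq2 c00 c0c H1 H2 K0; apply: filterS => t ov.
have [W [W0 W1 Wp Wq]] := blackwell (vpow_pmf t hp) (vpow_pmf t hq)
  (vpow_pmf (copies c0 t) hp2) (vpow_pmf (copies c0 t) hq2) ov.
have [hU es _ pE _] := h.
have qE i : (adj U *m tpow sigma1 k *m U) i i = rC (q i).
  by rewrite es conj_sdiag// rdiagE eqxx.
have diag X f : (forall i, (adj U *m X *m U) i i = rC (f i)) ->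
    forall i, (adj (tpow U t) *m tpow X t *m tpow U t) i i = rC (vpow f t i).
  by move=> hf; rewrite adj_tpow -!tpowM; exact: tpow_diag.
rewrite er2 es2 !sdiag_tpow.
exact: (kconv_prepare (unitary_tpow t hU) (unitary_tpow _ hV) W0 W1 (diag _ _ pE) (diag _ _ qE) Wp Wq).
Qed.

(** With n = t k + r, the r remaining copies are discarded; this loss and the rounding in [copies]
    are bounded, so a strictly smaller rate absorbs them. *)
Lemma block_rate k c0 c : (0 < k)%N -> 0 < c0 -> c < c0 / k%:R ->
  (\forall t \near \oo, kconv (tpow (tpow rho1 k) t) (tpow (tpow sigma1 k) t)
     (tpow rho2 (copies c0 t)) (tpow sigma2 (copies c0 t)))%classic ->
  (\forall n \near \oo, (c%:E <= Rstar n)%E)%classic.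
Proof.
move=> k0 c00 cc0 [N _ hN]; near=> n.
have kp : 0 < k%:R :> R by rewrite ltr0n.
have np : 0 < n%:R :> R by near: n; exact: nbhs_infty_gtr.
have hn := divn_eq n k; set t := (n %/ k)%N in hn.
have tN : (N <= t)%N.
  by rewrite leq_divRL//; near: n; exact: nbhs_infty_ge.
have conv : kconv (tpow rho1 n) (tpow sigma1 n)
    (tpow rho2 (copies c0 t)) (tpow sigma2 (copies c0 t)).
  rewrite hn addnC [(t * k)%N]mulnC; apply: kconv_trans (kconv_discard _ _ hr1 hs1) _.
  by apply: kconv_trans (kconv_blocks _ _ _ _) _; exact: hN.
apply: le_trans (Rstar0_ge conv); rewrite lee_fin ler_pdivlMr//.
have h1 := copies_gt c0 t.
have h2 : n%:R <= k%:R * (t%:R + 1) :> R.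
  by rewrite natr1 -natrM ler_nat {1}hn mulnS mulnC addnC leq_add2r ltnW// ltn_pmod.
(* c0 for the incomplete block, 1 for the truncation in [copies]. *)
have h3 : (c0 + 1) / (c0 / k%:R - c) <= n%:R by near: n; exact: nbhs_infty_ger.
rewrite ler_pdivrMr ?subr_gt0// mulrBr in h3.
have h4 : n%:R * (c0 / k%:R) <= c0 * (t%:R + 1).
  by rewrite mulrCA ler_pM2l// ler_pdivrMr// mulrC.
lra.
Unshelve. all: by end_near.
Qed.

Lemma rate_lt c r : 0 < c -> c < r -> 0 < cD 2^-1 p2 q2 ->
  (forall a, 2^-1 <= a -> a != 1 -> r * cD a p2 q2 < DpinL a rho1 sigma1) ->
  (forall a, 2^-1 <= a -> a != 1 -> r * cD a q2 p2 < a / (1 - a) * DpinL (1 - a) rho1 sigma1) ->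
  (\forall n \near \oo, (c%:E <= Rstar n)%E)%classic.
Proof.
move=> c0 cr K0 H1 H2; have r0 := lt_trans c0 cr.
have K0' : 0 < cD 2^-1 q2 p2.
  have h2 : 1 - 2^-1 = 2^-1 :> R by field.
  by move: K0; rewrite /cD -{2}h2 Qc_swap.
have [U [p [q hw]]] := pinched_family hr1 hs1.
have half0 (a : R) : 2^-1 <= a -> 0 < a by apply: lt_le_trans; rewrite invr_gt0.
(* From r to [c2] one pays for a single block length at all orders, from [c2] to [c1] for the strict
   gap of [block_conversion], and from [c1] to c for the rounding in [block_rate]. *)
pose c1 := (2 * c + r) / 3; pose c2 := (c + 2 * r) / 3.
have [cc1 c12 c2r] : [/\ c < c1, c1 < c2 & c2 < r] by rewrite /c1 /c2; split; lra.
have c20 : 0 < c2 by exact: lt_trans (lt_trans c0 cc1) c12.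
have mu1 : 1 < r / c2 by rewrite ltr_pdivlMr// mul1r.
have [fp fq] : (forall k, pmf (p k)) /\ (forall k, pmf (q k)).
  by split=> k; case: (family_pmf hr1 hs1 hw k).
have mono (u v : forall k, 'I_(pw d1 k) -> R) : (forall k, pmf (u k)) -> (forall k, pmf (v k)) ->
    forall k a b, 2^-1 <= a /\ a != 1 -> 2^-1 <= b /\ b != 1 -> a <= b ->
    k%:R^-1 * cD a (u k) (v k) <= k%:R^-1 * cD b (u k) (v k).
  move=> hu hv k a b [_ a1] [_ b1] ab; rewrite ler_wpM2l ?invr_ge0//.
  exact: cD_mono.
have lim_near (u : nat -> R) (l y : R) : (u @ \oo --> l)%classic -> y < l ->
    (\forall k \near \oo, y <= u k)%classic.
  by move=> ul yl; near=> k; apply/ltW; near: k; exact: (cvgr_gt _ ul).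
have E1 : (\forall k \near \oo, forall a, 2^-1 <= a /\ a != 1 ->
    r * cD a p2 q2 <= r / c2 * (k%:R^-1 * cD a (p k) (q k)))%classic.
  apply: (@uniform_rate _ _ _ _ hp2 hq2 K0 (fun k a => k%:R^-1 * cD a (p k) (q k)) r _ r0 mu1 (mono p q fp fq)) => a [ah a1].
  exact: (lim_near _ _ _ (DpinL_cvg hr1 hs1 hw (half0 _ ah) a1) (H1 _ ah a1)).
have E2 : (\forall k \near \oo, forall a, 2^-1 <= a /\ a != 1 ->
    r * cD a q2 p2 <= r / c2 * (k%:R^-1 * cD a (q k) (p k)))%classic.
  apply: (@uniform_rate _ _ _ _ hq2 hp2 K0' (fun k a => k%:R^-1 * cD a (q k) (p k)) r _ r0 mu1 (mono q p fq fp)) => a [ah a1].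
  exact: (lim_near _ _ _ (DpinL_swap_cvg hr1 hs1 hw (half0 _ ah) a1) (H2 _ ah a1)).
have [k [k0 E1k E2k]] : exists k, [/\ (0 < k)%N,
    (forall a, 2^-1 <= a /\ a != 1 -> r * cD a p2 q2 <= r / c2 * (k%:R^-1 * cD a (p k) (q k))) &
    (forall a, 2^-1 <= a /\ a != 1 -> r * cD a q2 p2 <= r / c2 * (k%:R^-1 * cD a (q k) (p k)))].
  apply: (@filter_ex _ \oo%classic); near=> k; split.
  - by near: k; exact: nbhs_infty_gt.
  - by near: k; exact: E1.
  - by near: k; exact: E2.
have kp : 0 < k%:R :> R by rewrite ltr0n.
have ex (x y : R) : r * x <= r / c2 * (k%:R^-1 * y) -> c2 * k%:R * x <= y.
  have e : r / c2 * (k%:R^-1 * y) = r * (y / (c2 * k%:R)).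
    rewrite -[r / c2 * _]mulrA; congr (_ * _); rewrite [in RHS](invfM c2) [RHS]mulrC; exact: mulrA.
  have ck : 0 < c2 * k%:R by exact: mulr_gt0.
  by rewrite e (ler_pM2l r0) (ler_pdivlMr _ _ ck) [x * _]mulrC.
apply: (@block_rate k (c1 * k%:R)) => //.
- by rewrite mulr_gt0// (lt_trans c0).
- by rewrite mulfK// gt_eqF.
apply: (block_conversion (hw k) (c := c2 * k%:R)) => //.
- by rewrite mulr_gt0// (lt_trans c0).
- by rewrite ltr_pM2r.
- by move=> a ah a1; apply/ex/E1k.
- by move=> a ah a1; apply/ex/E2k.
Unshelve. all: by end_near.
Qed.

(** At order 1/2 a vanishing divergence means Bhattacharyya coefficient 1, hence Hellinger distance
    0. *)
Lemma half_pair_eq : cD 2^-1 p2 q2 = 0 -> p2 =1 q2.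
Proof.
have h0 : (2^-1 : R) != 1 by rewrite lt_eqF// invf_lt1// ltr1n.
have h2 : 1 - 2^-1 = 2^-1 :> R by field.
move=> /eqP; rewrite /cD mulf_eq0 invr_eq0 subr_eq0 (negPf h0) /= ln_eq0 ?Qc_gt0// => /eqP Q1.
have sq (f : 'I_d2 -> R) i : pmf f -> (f i `^ 2^-1) ^+ 2 = f i.
  by move=> [f0 _]; rewrite -powR_mulrn ?powR_ge0// -powRrM mulVf ?pnatr_eq0// powRr1// ltW.
have S0 : \sum_i (p2 i `^ 2^-1 - q2 i `^ 2^-1) ^+ 2 = 0.
  have e i : (p2 i `^ 2^-1 - q2 i `^ 2^-1) ^+ 2 =
      p2 i + q2 i - 2 * (p2 i `^ 2^-1 * q2 i `^ (1 - 2^-1)).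
    by rewrite h2 sqrrB (sq p2) ?(sq q2)//; ring.
  under eq_bigr do rewrite e; rewrite sumrB big_split /= -mulr_sumr.
  by rewrite (proj2 hp2) (proj2 hq2) -/(Qc 2^-1 p2 q2) Q1; ring.
move=> i; have /(_ i isT)/eqP := psumr_eq0P (fun i _ => sqr_ge0 _) S0.
by rewrite sqrf_eq0 subr_eq0 => /eqP h; rewrite -(sq p2 i hp2) h sq.
Qed.

(* Equal target states can be prepared from nothing, in any number. *)
Lemma Rstar0_trivial c n : rho2 = sigma2 -> (0 < n)%N -> (c%:E <= Rstar n)%E.
Proof.
move=> e2 n0; have np : 0 < n%:R :> R by rewrite ltr0n.
pose m := (Num.trunc (c * n%:R)).+1.
have hm : c * n%:R <= m%:R by apply: ltW; exact: truncnS_gt.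
apply: (@le_trans _ _ (m%:R / n%:R)%:E); first by rewrite lee_fin ler_pdivlMr.
apply: Rstar0_ge.
have t0 : kconv (tpow rho1 n) (tpow sigma1 n) (1%:M : 'M[C]_1) 1%:M.
  by apply: kconv_trace; exact/fstate_tr/fstate_tpow.
apply: kconv_trans t0 _; rewrite -e2 er2 sdiag_tpow.
have [_ P1] := vpow_pmf m hp2; have [P0 _] := vpow_pmf m hp2.
apply: (@kconv_prepare _ _ _ _ _ _ _ _ (fun _ j => vpow p2 m j) 1%:M (fun=> 1) (fun=> 1)).
- exact: unitary1.
- exact: unitary_tpow.
- by move=> _ j; exact: ltW.
- by [].
- by move=> i; rewrite adj1 !mul1mx mxE eqxx rC1 mulr1n.
- by move=> i; rewrite adj1 !mul1mx mxE eqxx rC1 mulr1n.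
- by move=> j; rewrite big_ord1 mulr1.
- by move=> j; rewrite big_ord1 mulr1.
Qed.

Theorem rate_lower (x : \bar R) :
  (forall a, a != 0 -> a != 1 ->
    (x <= eratio (DpinL a rho1 sigma1) (Dcl a rho2 sigma2))%E) ->
  (x <= limn_einf Rstar)%E.
Proof.
move=> hx; apply: lee_limn_einf => c cx.
have h1 : (2^-1 : R) < 1 by rewrite invf_lt1// ltr1n.
have h0 : (0 : R) < 2^-1 by rewrite invr_gt0.
have [c0|c0] := leP c 0.
  by near=> n; apply: le_trans (Rstar0_ge0 n); rewrite lee_fin.
have K := @cD_ge0 _ _ 2^-1 _ _ hp2 hq2 h0 (negbT (lt_eqF h1)).
have [K0|K0] := ltP 0 (cD 2^-1 p2 q2); last first.
  have pq : p2 =1 q2 by apply: half_pair_eq; apply/eqP; rewrite eq_le K0 K.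
  near=> n; apply: Rstar0_trivial; first by rewrite er2 es2; exact: eq_sdiag.
  by near: n; exact: nbhs_infty_gt.
have [r [cr rx]] : exists r : R, c < r /\ (r%:E < x)%E.
  case: x cx {hx} => [x||]// cx; last by exists (c + 1); rewrite ltry; split => //; lra.
  by rewrite lte_fin in cx; exists ((c + x) / 2); rewrite lte_fin; split; lra.
have step (y z : R) : 0 < z -> (x <= eratio y z)%E -> r * z < y.
  move=> z0; rewrite /eratio gt_eqF// => /(lt_le_trans rx).
  by rewrite lte_fin ltr_pdivlMr.
have Dge a (p q : 'I_d2 -> R) : pmf p -> pmf q -> 0 < cD 2^-1 p q -> 2^-1 <= a -> a != 1 -> 0 < cD a p q.
  move=> hp hq k0 ah a1; apply: lt_le_trans k0 _.
  by apply: cD_mono => //; rewrite lt_eqF.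
have K0' : 0 < cD 2^-1 q2 p2.
  have h2 : 1 - 2^-1 = 2^-1 :> R by field.
  by move: K0; rewrite /cD -{2}h2 Qc_swap.
apply: (rate_lt c0 cr K0) => a ah a1; apply: step; do ?exact: Dge.
  have a0 : a != 0 by rewrite gt_eqF// (lt_le_trans h0).
  have := hx a a0 a1; rewrite er2 es2 (Dcl_joint hV (proj1 hp2) (proj1 hq2) a1).
  exact.
have a0 : a != 0 by rewrite gt_eqF// (lt_le_trans h0).
have b0 : 1 - a != 0 by rewrite subr_eq0 eq_sym.
have b1 : 1 - a != 1 by rewrite -subr_eq0 addrAC subrr sub0r oppr_eq0.
(* The exchanged direction at order a is the hypothesis at order 1 - a, with the factor a / (1 - a)
   moved from the target to the source. *)
have := hx (1 - a) b0 b1; rewrite er2 es2 (Dcl_joint hV (proj1 hp2) (proj1 hq2) b1).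
by rewrite (cD_swap p2 q2 b0 b1) subKr (eratio_swap _ _ a0 a1).
Unshelve. all: by end_near.
Qed.

End Target.

Lemma Dcl_swap d (rho sigma V : 'M[C]_d) p q a : unitary V -> pmf p -> pmf q ->
  rho = sdiag V p -> sigma = sdiag V q -> a != 0 -> a != 1 ->
  Dcl a rho sigma = a / (1 - a) * Dcl (1 - a) sigma rho.
Proof.
move=> hV [p0 _] [q0 _] -> -> a0 a1.
have b1 : 1 - a != 1 by rewrite -subr_eq0 addrAC subrr sub0r oppr_eq0.
by rewrite (Dcl_joint hV p0 q0 a1) (Dcl_joint hV q0 p0 b1); exact: cD_swap.
Qed.

Theorem Rstar0_lower d1 d2 (rho1 sigma1 : 'M[C]_d1) (rho2 sigma2 : 'M[C]_d2) :
  fstate rho1 -> fstate sigma1 -> fstate rho2 -> fstate sigma2 ->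
  rho2 *m sigma2 = sigma2 *m rho2 ->
  (maxe
    (ereal_inf [set eratio (DpinL a rho1 sigma1) (Dcl a rho2 sigma2) | a in [set: R]]%classic)
    (ereal_inf [set eratio (DpinR a rho1 sigma1) (Dcl a rho2 sigma2) | a in [set: R]]%classic)
  <= limn_einf (Rstar0 rho1 sigma1 rho2 sigma2))%E.
Proof.
move=> hr1 hs1 hr2 hs2 com.
have [V [p [q [hV er es]]]] := spectral_commuting (pd_herm (fstate_pd hr2)) (pd_herm (fstate_pd hs2)) com.
have fpmf A f : fstate A -> A = sdiag V f -> pmf f.
  move=> hA eA; split; first exact: pd_spectrum (fstate_pd hA) hV eA.
  by apply: rC_inj; rewrite -(tr_sdiag f hV) -eA fstate_tr.
have hp := fpmf _ _ hr2 er; have hq := fpmf _ _ hs2 es.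
rewrite ge_max; apply/andP; split.
  apply: (rate_lower hr1 hs1 hV hp hq er es) => a _ _.
  by apply: ereal_inf_lbound; exists a.
(* Exchanging both pairs of states leaves the rate unchanged and turns right pinching at order 1 - a
   into left pinching at order a, up to a factor common to source and target. *)
have -> : Rstar0 rho1 sigma1 rho2 sigma2 = Rstar0 sigma1 rho1 sigma2 rho2.
  by apply/funext => n; exact: Rstar0_swap.
apply: (rate_lower hs1 hr1 hV hq hp es er) => a a0 a1.
have b0 : 1 - a != 0 by rewrite subr_eq0 eq_sym.
have b1 : 1 - a != 1 by rewrite -subr_eq0 addrAC subrr sub0r oppr_eq0.
have eL := DpinR_swap hr1 hs1 b0 b1; have eD := Dcl_swap hV hp hq er es b0 b1.
rewrite subKr in eL eD.
apply: ereal_inf_lbound; exists (1 - a); first exact: I.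
by rewrite eL eD eratio_scale// mulf_neq0// invr_eq0.
Qed.

End Achievability.

Unset Implicit Arguments.
Set Strict Implicit.
Set Printing Implicit Defensive.

Theorem theorem6 (R : realType) (d1 d2 : nat)
  (rho1 sigma1 : 'M[R[i]]_d1) (rho2 sigma2 : 'M[R[i]]_d2) :
  density rho1 -> density sigma1 -> density rho2 -> density sigma2 ->
  full_rank rho1 -> full_rank sigma1 -> full_rank rho2 -> full_rank sigma2 ->
  (rho2 *m sigma2 = sigma2 *m rho2 ->
     (maxe
        (ereal_inf [set eratio (DpinL a rho1 sigma1) (Dcl a rho2 sigma2) | a in [set: R]])
        (ereal_inf [set eratio (DpinR a rho1 sigma1) (Dcl a rho2 sigma2) | a in [set: R]])
      <= limn_einf (Rstar0 rho1 sigma1 rho2 sigma2))%E)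
  /\
  (forall n : nat, (0 < n)%N -> forall a : \bar R,
     (Rstar0 rho1 sigma1 rho2 sigma2 n
        <= eratio (Dmin a rho1 sigma1) (Dmin a rho2 sigma2))%E).
Proof.
move=> r1 s1 r2 s2 fr1 fs1 fr2 fs2.
have hr1 := density_pd r1 fr1; have hs1 := density_pd s1 fs1.
have hr2 := density_pd r2 fr2; have hs2 := density_pd s2 fs2.
split; first exact: Rstar0_lower.
exact: Rstar0_upper.
Qed.
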